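(* There is a deterministic algorithm that, given a dataset $X\subseteq\ell_\infty^d$ of size $|X|=n$ with aspect ratio $D_X$, and a parameter $0<\rho<1$, outputs a spanner for $(X,d_X)$, where $d_X(x,y)=\|x-y\|_\infty$, with stretch $O(\rho^{-1}\log\log d)$ and sparsity $O(n^{1+\rho}\rho^{-1}\log n\,\log D_X)$. The algorithm runs in $O(n^{1+\rho}\rho^{-1}d^2\log n\,\log D_X)$ time.
   Context: $\ell_\infty^d$ is $\mathbb{R}^d$ with the norm $\|x\|_\infty=\max_i|x_i|$. The aspect ratio of a finite $X\subseteq\ell_\infty^d$ (with at least two points) is $$D_X=\frac{\max_{x,y\in X}\|x-y\|_\infty}{\min_{x\ne y\in X}\|x-y\|_\infty}.$$ A spanner with stretch $t\ge1$ for a finite metric space $(X,d_X)$ is a weighted graph $G=(X,E,w)$ with edge weights $w(u,v)=d_X(u,v)$ whose shortest-path distances $d_G$ satisfy $d_X(x,y)\le d_G(x,y)\le t\cdot d_X(x,y)$ for all $x,y\in X$. Its sparsity is its number of edges $|E|$. Constants in $O(\cdot)$ are universal. Running time counts unit-cost operations on real numbers. Logarithmic factors inside $O(\cdot)$ (including $\log D_X$) are read as at least $1$. *)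

(* Defs.v *)
From mathcomp Require Import all_boot all_order all_algebra.
From mathcomp Require Import all_classical all_reals all_analysis.
Set Implicit Arguments.
Unset Strict Implicit.
Unset Printing Implicit Defensive.
Import Order.TTheory GRing.Theory Num.Theory.
Import numFieldNormedType.Exports.
Local Open Scope classical_set_scope.
Local Open Scope ring_scope.

(** * A real RAM

    Memory is split into named arrays of naturals (indices, counters, addresses)
    and named arrays of exact reals. A program mentions finitely many names, all
    of them literals; cells inside an array are addressed indirectly. The only
    real constants are integers, and nothing converts a real back to a natural
    (there is no floor), nor is there division or bit access on naturals. *)

Inductive nexp : Type :=
| NLit of nat
| NGet of nat & nexp           (* array name, index *)
| NAdd of nexp & nexp
| NSub of nexp & nexp          (* truncated *)
| NMul of nexp & nexp.

Inductive rexp : Type :=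
| RNat of nexp
| RGet of nat & nexp           (* array name, index *)
| RAdd of rexp & rexp
| RSub of rexp & rexp
| RMul of rexp & rexp
| RDiv of rexp & rexp.         (* x / 0 is 0 *)

Inductive bexp : Type :=
| BNle of nexp & nexp
| BRle of rexp & rexp
| BNot of bexp
| BAnd of bexp & bexp.

Inductive cmd : Type :=
| Skip
| NSet of nat & nexp & nexp    (* array name, index, value *)
| RSet of nat & nexp & rexp    (* array name, index, value *)
| Seq of cmd & cmd
| If of bexp & cmd & cmd
| While of bexp & cmd.

Section Semantics.
Variable R : realType.

Record store : Type := Store {
  narr : nat -> nat -> nat;
  rarr : nat -> nat -> R }.

Definition upd (T : Type) (f : nat -> nat -> T) (a i : nat) (v : T) :
    nat -> nat -> T :=
  fun b j => if (b == a) && (j == i) then v else f b j.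

Fixpoint neval (s : store) (e : nexp) : nat :=
  match e with
  | NLit k => k
  | NGet a i => narr s a (neval s i)
  | NAdd e1 e2 => (neval s e1 + neval s e2)%N
  | NSub e1 e2 => (neval s e1 - neval s e2)%N
  | NMul e1 e2 => (neval s e1 * neval s e2)%N
  end.

Fixpoint reval (s : store) (e : rexp) : R :=
  match e with
  | RNat k => (neval s k)%:R
  | RGet a i => rarr s a (neval s i)
  | RAdd e1 e2 => reval s e1 + reval s e2
  | RSub e1 e2 => reval s e1 - reval s e2
  | RMul e1 e2 => reval s e1 * reval s e2
  | RDiv e1 e2 => reval s e1 / reval s e2
  end.

(* Both sides of a conjunction are always evaluated, and charged. *)
Fixpoint beval (s : store) (b : bexp) : bool :=
  match b with
  | BNle e1 e2 => (neval s e1 <= neval s e2)%N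
  | BRle e1 e2 => reval s e1 <= reval s e2
  | BNot b1 => ~~ beval s b1
  | BAnd b1 b2 => beval s b1 && beval s b2
  end.

(* One unit for every literal, memory access, operation, test and assignment. *)
Fixpoint ncost (e : nexp) : nat :=
  match e with
  | NLit _ => 1
  | NGet _ i => (ncost i).+1
  | NAdd e1 e2 | NSub e1 e2 | NMul e1 e2 => (ncost e1 + ncost e2).+1
  end.

Fixpoint rcost (e : rexp) : nat :=
  match e with
  | RNat k => (ncost k).+1
  | RGet _ i => (ncost i).+1
  | RAdd e1 e2 | RSub e1 e2 | RMul e1 e2 | RDiv e1 e2 =>
      (rcost e1 + rcost e2).+1
  end.

Fixpoint bcost (b : bexp) : nat :=
  match b with
  | BNle e1 e2 => (ncost e1 + ncost e2).+1
  | BRle e1 e2 => (rcost e1 + rcost e2).+1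
  | BNot b1 => (bcost b1).+1
  | BAnd b1 b2 => (bcost b1 + bcost b2).+1
  end.

(* [exec c s s' T]: [c] started in [s] halts in [s'] after [T] steps. *)
Inductive exec : cmd -> store -> store -> nat -> Prop :=
| ExecSkip s : exec Skip s s 1
| ExecNSet s a i e :
    exec (NSet a i e) s
      (Store (upd (narr s) a (neval s i) (neval s e)) (rarr s))
      (ncost i + ncost e).+1
| ExecRSet s a i e :
    exec (RSet a i e) s
      (Store (narr s) (upd (rarr s) a (neval s i) (reval s e)))
      (ncost i + rcost e).+1
| ExecSeq c1 c2 s s1 s2 T1 T2 :
    exec c1 s s1 T1 -> exec c2 s1 s2 T2 ->
    exec (Seq c1 c2) s s2 (T1 + T2)
| ExecIf b c1 c2 s s1 T1 :
    exec (if beval s b then c1 else c2) s s1 T1 ->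
    exec (If b c1 c2) s s1 (bcost b + T1).+1
| ExecWhileStop b c s :
    ~~ beval s b -> exec (While b c) s s (bcost b).+1
| ExecWhileStep b c s s1 s2 T1 T2 :
    beval s b -> exec c s s1 T1 -> exec (While b c) s1 s2 T2 ->
    exec (While b c) s s2 (bcost b + T1 + T2).+1.

Lemma exec_det c s s1 T1 s2 T2 :
  exec c s s1 T1 -> exec c s s2 T2 -> s1 = s2 /\ T1 = T2.
Proof.
move=> h; elim: h s2 T2 => {c s s1 T1}.
- by move=> s s2 T2 h; inversion h.
- by move=> s a i e s2 T2 h; inversion h.
- by move=> s a i e s2 T2 h; inversion h.
- move=> c1 c2 s s1 s2 T1 T2 _ IH1 _ IH2 s' T' h.
  inversion h as [| | |? ? ? ? ? ? ? h1 h2| | |]; subst.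
  by case: (IH1 _ _ h1) => ? ?; subst; case: (IH2 _ _ h2) => ? ?; subst.
- move=> b c1 c2 s s1 T1 _ IH s' T' h.
  inversion h as [| | | |? ? ? ? ? ? h1| |]; subst.
  by case: (IH _ _ h1) => ? ?; subst.
- move=> b c s nb s' T' h.
  inversion h as [| | | | | |? ? ? ? ? ? ? hb]; subst => //.
  by rewrite hb in nb.
- move=> b c s s1 s2 T1 T2 hb _ IH1 _ IH2 s' T' h.
  inversion h as [| | | | |? ? ? nb|? ? ? ? ? ? ? _ h1 h2]; subst.
    by rewrite hb in nb.
  by case: (IH1 _ _ h1) => ? ?; subst; case: (IH2 _ _ h2) => ? ?; subst.
Qed.

End Semantics.

(** * Spanners *)

Section Spanners.
Variables (R : realType) (V : finType).

(* [weight G u v] is meaningful only when [[set u; v]] is an edge. *)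
Record wgraph : Type := WGraph {
  edges : {set {set V}};
  weight : V -> V -> R }.

Definition simple_graph (G : wgraph) : Prop :=
  forall e, e \in edges G -> #|e| = 2%N.

Definition adj (G : wgraph) : rel V := fun u v => [set u; v]%SET \in edges G.

(* Total weight of the walk visiting [x] and then the vertices of [p]. *)
Definition walk_weight (G : wgraph) (x : V) (p : seq V) : R :=
  \sum_(e <- zip (x :: p) p) weight G e.1 e.2.

(* The infimum is [+oo] when no walk joins [x] to [y]. *)
Definition gdist (G : wgraph) (x y : V) : \bar R :=
  ereal_inf [set (walk_weight G x p)%:E | p in
    [set p | path (adj G) x p /\ last x p = y]].

Definition is_spanner (dX : V -> V -> R) (t : R) (G : wgraph) : Prop :=
  [/\ 1 <= t,
      simple_graph G,
      forall u v, adj G u v -> weight G u v = dX u v &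
      forall x y, ((dX x y)%:E <= gdist G x y)%E /\
                  (gdist G x y <= (t * dX x y)%:E)%E].

End Spanners.

(** * Datasets in l_infty^d *)

Section Datasets.
Variables (R : realType) (n d : nat) (X : 'I_n -> 'rV[R]_d).

(* The norm of a row vector is the max of the absolute values of its entries,
   see [mx_normrE]. *)
Definition dist_X (i j : 'I_n) : R := `|X i - X j|.

Definition diam_X : R := \big[Num.max/0]_(p : 'I_n * 'I_n) dist_X p.1 p.2.

(* [diam_X] bounds every term, so for [1 < n] it does not affect the minimum. *)
Definition sep_X : R :=
  \big[Num.min/diam_X]_(p : 'I_n * 'I_n | p.1 != p.2) dist_X p.1 p.2.

Definition aspect_ratio : R := diam_X / sep_X.

(* [n], [d] in array 0 of naturals; [rho] in array 0 of reals and the points, in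
   row-major order, in array 1 of reals; every other cell holds 0. *)
Definition input_store (rho : R) : store R :=
  Store
    (fun a k => if a == 0%N then nth 0%N [:: n; d] k else 0%N)
    (fun a k =>
       if a == 0%N then nth 0 [:: rho] k else
       if a == 1%N then
         match (insub (k %/ d)%N : option 'I_n), (insub (k %% d)%N : option 'I_d)
         with
         | Some i, Some j => X i 0 j
         | _, _ => 0
         end
       else 0).

(* [m], the number of edges, in cell 0 of array 0 of naturals; the k-th edge and
   its weight in cell k of arrays 1 and 2 of naturals and array 1 of reals. As
   [m] equals [#|edges G|], no edge is listed twice. *)
Definition outputs_graph (s : store R) (G : wgraph R 'I_n) : Prop :=
  let m := narr s 0 0 in
  exists es : seq ('I_n * 'I_n),
    [/\ mkseq (narr s 1) m = [seq val e.1 | e <- es],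
        mkseq (narr s 2) m = [seq val e.2 | e <- es],
        mkseq (rarr s 1) m = [seq weight G e.1 e.2 | e <- es],
        edges G = [set [set e.1; e.2] | e in es]%SET &
        m = #|edges G|].

End Datasets.

(* Logarithms in bounds are read as at least 1. *)
Definition lnmax1 (R : realType) (x : R) : R := Num.max 1 (ln x).

(* Main.v *)
Require Import Defs.
From mathcomp Require Import all_boot all_order all_algebra.
From mathcomp Require Import all_classical all_reals all_analysis.
From mathcomp Require Import zify ring lra.
Set Implicit Arguments.
Unset Strict Implicit.
Unset Printing Implicit Defensive.
Import Order.TTheory GRing.Theory Num.Theory.
Import numFieldNormedType.Exports.
Local Open Scope ring_scope.

(** As in Indyk's nearest neighbour structure for l_infty, a set of m points is
    cut at every scale r by a recursion that either splits along one coordinate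
    or peels off a box.  With the negated coordinates added there are D = 2d
    coordinates and only upper tails matter.  For each of them let p_k be the
    fraction of points exceeding the median by more than k r, and put eps = 1/q
    with q the least integer such that q rho >= 1.  If p_(k+1) > 1/(2D) and
    3 p_k^(q+1) <= 2 p_(k+1)^q for some k, recurse on the points at most
    (k+1) r and on those more than k r above the median: a pair at distance at
    most r survives in one of the two parts, and the potential m^(1+eps) drops
    by a factor 1 - 1/(6Dq).  If no coordinate can be split, then (3/2) p_k is
    raised at least to the power 1+eps at every step, so some
    k = O(q log log d) has p_k <= 1/(2D) in every coordinate; the resulting box
    holds half of the points.  Its r-neighbourhood has diameter O(k r) and
    receives a star, and the recursion continues on the points outside the box.
    Stars hence contribute at most 2 n^(1+eps) edges per scale.  The scales are
    halved from the diameter until one produces no star edge; as k <= n, this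
    takes O(log n + log D_X) scales.  The lists of every node stay sorted along
    all coordinates by filtering a single initial merge sort, so a node costs
    O(m d), which the drop of the potential pays for. *)

(** * Costed weakest preconditions *)

(** The factor 3/2 serves both outcomes of the split test. Put u_k = (3/2) p_k. A failed test reads
    u_(k+1)^q < u_k^(q+1), a clean power recursion; the median gives u_0 <= 3/4, so it starts
    strictly below 1 and collapses doubly exponentially. A passed test gains (2/3)^(1/q) on the
    upper part: without this strict gain the two overlapping parts could keep the potential
    constant, and the number of nodes would not be controlled. The machine has no logarithm and no
    rounding, so no number of steps is computed in advance: a scan stops by itself, and [kmax] lives
    in the analysis alone. The index k reached by a scan is bounded twice. k = O(q log log d) gives
    the stretch. The cruder bound by the number of points serves to count scales: a star edge at
    radius r shows that the least distance is at most (2n + 2) r, so neither rho nor d enters the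
    logarithm. The time per scale is the cost O(m d) of a node times the inverse drop 6Dq of the
    potential, whence the factor d^2 / rho. *)

Fixpoint nmod (c : cmd) : seq nat :=
  match c with
  | NSet a _ _ => [:: a]
  | Seq c1 c2 | If _ c1 c2 => nmod c1 ++ nmod c2
  | While _ c1 => nmod c1
  | _ => [::]
  end.

Fixpoint rmod (c : cmd) : seq nat :=
  match c with
  | RSet a _ _ => [:: a]
  | Seq c1 c2 | If _ c1 c2 => rmod c1 ++ rmod c2
  | While _ c1 => rmod c1
  | _ => [::]
  end.

Lemma upd_neq (T : Type) (f : nat -> nat -> T) a i v b :
  b != a -> upd f a i v b = f b.
Proof. by move=> h; rewrite /upd (negbTE h). Qed.

Section Wp.
Variable R : realType.
Implicit Types (s : store R) (c : cmd) (b : bexp).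

(** Array names are literals, so the arrays that a command may write can be read off its text. Every
    frame condition thus becomes a decidable membership test, usually settled by [isT]. *)
Definition agree c s s' : Prop :=
  (forall a, a \notin nmod c -> narr s' a = narr s a) /\
  (forall a, a \notin rmod c -> rarr s' a = rarr s a).

Lemma exec_agree c s s' T : exec c s s' T -> agree c s s'.
Proof.
elim=> {c s s' T} //.
- by move=> s a i e; split=> b //=; rewrite inE => h; rewrite upd_neq.
- by move=> s a i e; split=> b //=; rewrite inE => h; rewrite upd_neq.
- move=> c1 c2 s s1 s2 T1 T2 _ [h1 g1] _ [h2 g2].
  by split=> a /=; rewrite mem_cat negb_or => /andP[u v]; rewrite (h2, g2) // (h1, g1).
- move=> b c1 c2 s s1 T1 _; case: (beval s b) => -[h g];
    by split=> a /=; rewrite mem_cat negb_or => /andP[u v]; rewrite (h, g).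
- by move=> b c s s1 s2 T1 T2 _ _ [h1 g1] _ [h2 g2]; split=> a /= u;
    rewrite (h2, g2) // (h1, g1).
Qed.

(** Total correctness: termination is part of the claim, and the postcondition also sees the exact
    number of steps. *)
Definition wp c s (Q : store R -> nat -> Prop) : Prop :=
  exists s' T, exec c s s' T /\ Q s' T.

(** Consequence and frame rule in one: specifications of commands mention only what changes, and the
    caller recovers the rest from [agree]. *)
Lemma wp_use c s (Q Q' : store R -> nat -> Prop) :
  wp c s Q -> (forall s' T, agree c s s' -> Q s' T -> Q' s' T) -> wp c s Q'.
Proof. by move=> [s' [T [e q]]] h; exists s', T; split=> //; apply: h => //; apply: exec_agree e. Qed.

Lemma wp_skip s (Q : store R -> nat -> Prop) : Q s 1%N -> wp Skip s Q.
Proof. by move=> q; exists s, 1%N; split=> //; constructor. Qed.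

Lemma wp_nset s a i e (Q : store R -> nat -> Prop) :
  Q (Store (upd (narr s) a (neval s i) (neval s e)) (rarr s)) (ncost i + ncost e).+1 ->
  wp (NSet a i e) s Q.
Proof. by move=> q; do 2 eexists; split; [apply: ExecNSet|]. Qed.

Lemma wp_rset s a i e (Q : store R -> nat -> Prop) :
  Q (Store (narr s) (upd (rarr s) a (neval s i) (reval s e))) (ncost i + rcost e).+1 ->
  wp (RSet a i e) s Q.
Proof. by move=> q; do 2 eexists; split; [apply: ExecRSet|]. Qed.

Lemma wp_seq c1 c2 s (Q : store R -> nat -> Prop) :
  wp c1 s (fun s1 T1 => wp c2 s1 (fun s2 T2 => Q s2 (T1 + T2)%N)) ->
  wp (Seq c1 c2) s Q.
Proof.
move=> [s1 [T1 [e1 [s2 [T2 [e2 q]]]]]].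
by exists s2, (T1 + T2)%N; split=> //; apply: ExecSeq e1 e2.
Qed.

Lemma wp_if b c1 c2 s (Q : store R -> nat -> Prop) :
  (beval s b -> wp c1 s (fun s' T => Q s' (bcost b + T).+1)) ->
  (~~ beval s b -> wp c2 s (fun s' T => Q s' (bcost b + T).+1)) ->
  wp (If b c1 c2) s Q.
Proof.
move=> h1 h2; have: wp (if beval s b then c1 else c2) s (fun s' T => Q s' (bcost b + T).+1).
  by case: (beval s b) h1 h2 => h1 h2; [apply: h1 | apply: h2].
by move=> [s' [T [e q]]]; exists s', (bcost b + T).+1; split=> //; apply: ExecIf.
Qed.

(** Every iteration costs at least one unit, so a nonnegative real potential that pays for the cost
    also proves termination, by the Archimedean property. Real values are required because the
    potential of a scale is a sum of powers m^(1+1/q). *)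
Lemma wp_whileR b c s0 (I : store R -> Prop) (pot : store R -> R)
    (Q : store R -> nat -> Prop) :
  I s0 ->
  (forall s, agree c s0 s -> I s -> 0 <= pot s) ->
  (forall s, agree c s0 s -> I s -> beval s b ->
     wp c s (fun s' T => I s' /\ (bcost b + T).+1%:R + pot s' <= pot s)) ->
  (forall s' T, agree c s0 s' -> I s' -> ~~ beval s' b ->
     T%:R <= pot s0 + (bcost b).+1%:R -> Q s' T) ->
  wp (While b c) s0 Q.
Proof.
move=> I0 pot0 step; suff [s' [T [e [h1 h2 h3]]]]: wp (While b c) s0
    (fun s' T => [/\ I s', ~~ beval s' b & T%:R <= pot s0 + (bcost b).+1%:R]).
  by move=> h; exists s', T; split=> //; apply: h => //; apply: exec_agree e.
have [N] : exists N : nat, pot s0 < N%:R.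
  by exists (Num.bound (pot s0)); exact: archi_boundP (pot0 _ (conj (fun=> fun=> erefl) (fun=> fun=> erefl)) I0).
have: agree c s0 s0 by [].
suff H N' s : agree c s0 s -> I s -> pot s < N'%:R -> wp (While b c) s
    (fun s' T => [/\ I s', ~~ beval s' b & T%:R <= pot s + (bcost b).+1%:R]).
  by move=> ag lt; apply: H ag I0 lt.
elim: N' s => [|{}N IH] s ag Is.
  by move=> /(le_lt_trans (pot0 _ ag Is)); rewrite ltxx.
move=> ltN; have [gd|ngd] := boolP (beval s b); last first.
  exists s, (bcost b).+1; split; first exact: ExecWhileStop.
  by split=> //; rewrite lerDr pot0.
have [s1 [T1 [e1 [I1 le1]]]] := step _ ag Is gd.
have ag1 : agree c s0 s1.
  have [h1 g1] := exec_agree e1; have [h0 g0] := ag.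
  by split=> a ha; rewrite (h1, g1) // (h0, g0).
have [|s2 [T2 [e2 [I2 nb le2]]]] := IH _ ag1 I1.
  have := ler0n R (bcost b + T1); move: le1 ltN; rewrite -!natr1.
  by move=> *; lra.
exists s2, (bcost b + T1 + T2).+1; split; first exact: ExecWhileStep e1 e2.
split=> //; rewrite -addSn natrD.
apply: le_trans (_ : (bcost b + T1).+1%:R + (pot s1 + (bcost b).+1%:R) <= _).
  by rewrite lerD2l.
by rewrite addrA lerD2r.
Qed.

Lemma wp_while b c s0 (I : store R -> Prop) (pot : store R -> nat)
    (Q : store R -> nat -> Prop) :
  I s0 ->
  (forall s, agree c s0 s -> I s -> beval s b ->
     wp c s (fun s' T => I s' /\ (bcost b + T + pot s' < pot s)%N)) ->
  (forall s' T, agree c s0 s' -> I s' -> ~~ beval s' b ->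
     (T <= pot s0 + (bcost b).+1)%N -> Q s' T) ->
  wp (While b c) s0 Q.
Proof.
move=> I0 step fin; apply: (wp_whileR (I := I) (pot := fun s => (pot s)%:R)) => //.
- move=> s ag Is gd; apply: wp_use (step _ ag Is gd) _ => s' T _ [? h]; split=> //.
  by rewrite -natrD ler_nat.
- by move=> s' T ag Is nb; rewrite -natrD ler_nat; apply: fin.
Qed.

Definition For (i : nat) (e : nexp) (c : cmd) : cmd :=
  Seq (NSet i (NLit 0) (NLit 0))
      (While (BNle (NAdd (NGet i (NLit 0)) (NLit 1)) e)
             (Seq c (NSet i (NLit 0) (NAdd (NGet i (NLit 0)) (NLit 1))))).

(** The invariant is handed over after the increment of the counter, so it need not speak of the
    counter. Test and increment cost [ncost e + 12] together. *)
Lemma wp_for i e c s0 N B (I : nat -> store R -> Prop) (Q : store R -> nat -> Prop) :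
  i \notin nmod c ->
  (forall s, agree (For i e c) s0 s -> neval s e = N) ->
  I 0 (Store (upd (narr s0) i 0 0) (rarr s0)) ->
  (forall k s, (k < N)%N -> narr s i 0 = k -> agree (For i e c) s0 s -> I k s ->
     wp c s (fun s' T => (T <= B)%N /\
                         I k.+1 (Store (upd (narr s') i 0 k.+1) (rarr s')))) ->
  (forall s' T, agree (For i e c) s0 s' -> I N s' ->
     (T <= N * (B + ncost e + 12) + ncost e + 9)%N -> Q s' T) ->
  wp (For i e c) s0 Q.
Proof.
move=> iN eN I0 step fin; apply: wp_use (_ : wp _ _ (fun s' T =>
    I N s' /\ (T <= N * (B + ncost e + 12) + ncost e + 9)%N)) _; last first.
  by move=> s' T ag [h1 h2]; apply: fin.
apply: wp_seq; apply: wp_nset => /=.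
set s1 := Store _ _.
have agS s : agree (Seq c (NSet i (NLit 0) (NAdd (NGet i (NLit 0)) (NLit 1)))) s1 s ->
    agree (For i e c) s0 s.
  move=> [h g]; split=> a /=; last exact: g.
  rewrite inE negb_or => /andP[ai ha]; rewrite h //=; first by rewrite upd_neq.
apply: (wp_while (I := fun s => [/\ (narr s i 0 <= N)%N & I (narr s i 0) s])
  (pot := fun s => ((N - narr s i 0) * (B + ncost e + 12))%N)).
- by rewrite /= /upd /= !eqxx.
- move=> s ag [le0 Is] /=. rewrite eN; last exact: agS. rewrite addn1 => lt1.
  apply: wp_seq.
  apply: wp_use (step _ _ lt1 erefl (agS _ ag) Is) _ => s' T ag' [leT Is'].
  apply: wp_nset => /=; rewrite (ag'.1 i iN) addn1 /upd /= !eqxx.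
  split=> //.
  move: leT lt1; set x := narr s i 0 => leT lt1.
  have -> : (N - x = (N - x.+1).+1)%N by lia.
  rewrite mulSn; move: ((N - x.+1) * _)%N => p; lia.
- move=> s' T ag [le0 Is] /=; rewrite eN; last exact: agS. rewrite addn1 -leqNgt => le1.
  have E : narr s' i 0 = N by apply/eqP; rewrite eqn_leq le0.
  rewrite E in Is; rewrite {1}/upd !eqxx /= subn0 => h; split=> //.
  by move: h; lia.
Qed.

End Wp.

(** * Real estimates *)

Section Real_bounds.
Variable R : realType.
Implicit Types (x y : R) (q m c k D : nat).

(** This is ln(1 + y) <= y at y = -x/(1 + x), where 1 + y = 1/(1 + x). *)
Lemma ln1D_ge x : 0 <= x -> x / (1 + x) <= ln (1 + x).
Proof.
move=> x0; have p : 0 < 1 + x by lra.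
have h : 1 - x / (1 + x) = (1 + x)^-1 by field; rewrite gt_eqF.
have i0 : 0 < (1 + x)^-1 by rewrite invr_gt0.
have := @le_ln1Dx R (- (x / (1 + x))); rewrite h lnV ?posrE // lerN2; apply; lra.
Qed.

Lemma expr_bernoulli x q : 0 <= x <= 1 -> 1 - q%:R * x <= (1 - x) ^+ q.
Proof.
move=> /andP[x0 x1]; elim: q => [|q IH]; first by rewrite mul0r subr0 expr0.
rewrite exprS; apply: le_trans (_ : (1 - x) * (1 - q%:R * x) <= _).
  have := ler0n R q; rewrite -natr1; nra.
by apply: ler_wpM2l IH; lra.
Qed.

Definition phi q m : R := m%:R `^ (1 + q%:R^-1).

(** The linear factor adds up over the children of a node, while the root is monotone and can be
    replaced by that of the parent. *)
Lemma phiE q m : phi q m = m%:R * m%:R `^ q%:R^-1.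
Proof.
rewrite /phi powRD ?powRr1 ?ler0n //.
by rewrite gt_eqF // ltr_pwDl // ?ltr01 // invr_ge0.
Qed.

Lemma phi_ge0 q m : 0 <= phi q m. Proof. exact: powR_ge0. Qed.

Lemma phi_ge q m : (0 < m)%N -> m%:R <= phi q m.
Proof. by move=> m0; apply: le1r_powR; rewrite ?ler1n // lerDl invr_ge0. Qed.

Lemma root_le q m c : (m <= c)%N -> (m%:R : R) `^ q%:R^-1 <= c%:R `^ q%:R^-1.
Proof. by move=> h; apply: ge0_ler_powR; rewrite ?invr_ge0 ?nnegrE ?ler0n // ler_nat. Qed.

Lemma phi_half q m c : (2 * c <= m)%N -> phi q c + phi q m / 2 <= phi q m.
Proof.
move=> h; suff : phi q c <= phi q m / 2 by lra.
rewrite !phiE; have h1 := root_le q (_ : (c <= m)%N).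
apply: le_trans (_ : m%:R / 2 * c%:R `^ q%:R^-1 <= _).
  apply: ler_wpM2r; first exact: powR_ge0.
  by rewrite ler_pdivlMr // -natrM ler_nat mulnC.
rewrite mulrAC; apply: ler_wpM2r => //.
by apply: ler_wpM2l => //; apply: h1; lia.
Qed.

(* Taking q-th roots in the split test, with (2/3)^(1/q) <= 1 - 1/(3q). *)
Lemma phi_tail q m c c2 : (0 < q)%N ->
  (3 * c * c ^ q <= 2 * c2 ^ q * m)%N ->
  phi q c <= c2%:R * m%:R `^ q%:R^-1 * (1 - (3 * q%:R)^-1).
Proof.
move=> q0 h; set e := q%:R^-1; set g := 1 - _.
have q0R : 0 < q%:R :> R by rewrite ltr0n.
have eq1 : q%:R * e = 1 by rewrite mulfV // gt_eqF.
have q1 : 1 <= q%:R :> R by rewrite ler1n.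
have i0 : 0 < (3 * q%:R)^-1 :> R by rewrite invr_gt0; lra.
have iq : q%:R * (3 * q%:R)^-1 = 1 / 3 :> R by field; rewrite gt_eqF.
have i1 : (3 * q%:R)^-1 <= 1 / 3 :> R by rewrite -iq ler_peMl // ltW.
have g0 : 0 <= g by rewrite /g; lra.
have gq : 2 / 3 <= g ^+ q.
  have := @expr_bernoulli (3 * q%:R)^-1 q; rewrite iq -/g => H.
  by apply: le_trans (H _); lra.
have -> : phi q c = (c%:R * c%:R ^+ q) `^ e.
  rewrite -exprS /phi -powR_mulrn // -powRrM -natr1 mulrDl eq1 mul1r addrC //.
have -> : c2%:R * m%:R `^ e * g = (c2%:R ^+ q * m%:R * g ^+ q) `^ e.
  rewrite !powRM ?mulr_ge0 ?exprn_ge0 //.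
  by rewrite -!(@powR_mulrn R _ q) // -!powRrM eq1 !powRr1.
apply: ge0_ler_powR; rewrite ?invr_ge0 ?nnegrE ?mulr_ge0 ?exprn_ge0 //.
have : 3 * c%:R * c%:R ^+ q <= 2 * c2%:R ^+ q * m%:R :> R.
  by rewrite -!natrX -!natrM ler_nat.
have : c2%:R ^+ q * m%:R * (2 / 3) <= c2%:R ^+ q * m%:R * g ^+ q.
  by apply: ler_wpM2l; rewrite ?mulr_ge0 ?exprn_ge0.
by move=> ? ?; lra.
Qed.

(** With M = m^(1/q), the lower part weighs at most (m - c2) M and, by the split test, the upper
    part at most c2 M (1 - 1/(3q)), although it has c >= c2 points. The sum falls short of m M by c2
    M / (3q), and c2 > m / (2D) turns this into m M / (6Dq). *)
Lemma phi_split q m c c2 D : (0 < q)%N -> (0 < D)%N -> (c2 <= m)%N ->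
  (m < c2 * (D + D))%N -> (3 * c * c ^ q <= 2 * c2 ^ q * m)%N ->
  phi q (m - c2) + phi q c + phi q m / (6 * D%:R * q%:R) <= phi q m.
Proof.
move=> q0 D0 cm hD /(phi_tail q0) h.
have h1 := root_le q (leq_subr c2 m).
rewrite !phiE natrB // in h h1 *.
move: h h1 (powR_ge0 (m%:R : R) q%:R^-1).
rewrite -natrB //.
move: (m%:R `^ _) => M; move: ((m - c2)%:R `^ _) => A.
move: (c%:R * c%:R `^ _) => Bc.
rewrite natrB // => h h1 M0.
have q0R : 0 < q%:R :> R by rewrite ltr0n.
have D0R : 0 < D%:R :> R by rewrite ltr0n.
have hDR : m%:R <= c2%:R * (D%:R + D%:R) :> R.
  by rewrite -natrD -natrM ler_nat ltnW.
have cmR : c2%:R <= m%:R :> R by rewrite ler_nat.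
have e1 : m%:R * M / (6 * D%:R * q%:R) <= c2%:R * M * (3 * q%:R)^-1.
  have -> : c2%:R * M * (3 * q%:R)^-1 = c2%:R * (D%:R + D%:R) * M / (6 * D%:R * q%:R).
    by field; rewrite !gt_eqF.
  apply: ler_wpM2r; first by rewrite invr_ge0 !mulr_ge0 // ltW.
  exact: ler_wpM2r.
have e2 : (m%:R - c2%:R) * A <= (m%:R - c2%:R) * M by apply: ler_wpM2l => //; lra.
rewrite mulrBr mulr1 in h.
rewrite mulrBl in e2.
by lra.
Qed.

(** This is -ln((3/2) c/m), written so that only logarithms of natural numbers occur. *)
Definition decay m c : R := ln 2 + ln m%:R - ln 3 - ln c%:R.

Lemma decay_start m c : (0 < c)%N -> (2 * c <= m)%N -> ln (4 / 3) <= decay m c.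
Proof.
move=> c0 h; have cR : 0 < c%:R :> R by rewrite ltr0n.
have mR : 0 < m%:R :> R by rewrite ltr0n; lia.
have -> : ln (4 / 3 : R) = ln 2 + ln 2 - ln 3.
  rewrite ln_div ?posrE; [|lra|lra]; rewrite -lnM ?posrE; [|lra|lra].
  by congr (ln _ - _); lra.
have : ln (2 * c%:R : R) <= ln m%:R.
  by rewrite ler_ln ?posrE ?mulr_gt0 // -natrM ler_nat.
rewrite lnM ?posrE // /decay; lra.
Qed.

(** In terms of u = 3c/(2m) and u2 = 3 c2/(2m) the failed test is u2^q < u^(q+1), all powers of m
    cancelling; taking logarithms gives the claim. *)
Lemma decay_step q m c c2 : (0 < q)%N -> (0 < c2)%N -> (0 < m)%N ->
  (2 * c2 ^ q * m < 3 * c * c ^ q)%N ->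
  (1 + q%:R^-1) * decay m c <= decay m c2.
Proof.
move=> q0 c20 m0 h.
have c0 : (0 < c)%N by move: h; case: c.
have q0R : 0 < q%:R :> R by rewrite ltr0n.
have cR : 0 < c%:R :> R by rewrite ltr0n.
have c2R : 0 < c2%:R :> R by rewrite ltr0n.
have mR : 0 < m%:R :> R by rewrite ltr0n.
have {h} : ln (2 * c2%:R ^+ q * m%:R : R) <= ln (3 * c%:R * c%:R ^+ q).
  rewrite ler_ln ?posrE ?mulr_gt0 ?exprn_gt0 //.
  by rewrite -!natrX -!natrM ler_nat ltnW.
rewrite !lnM ?posrE ?mulr_gt0 ?exprn_gt0 // !lnXn // -!(mulr_natl (ln _)) /decay.
move: (ln _) (ln _) (ln _) (ln _) (ln _) => a u2 w b u h.
have E : q%:R * (1 + q%:R^-1) = q%:R + 1 :> R by field; rewrite gt_eqF.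
by rewrite -(@ler_pM2l _ q%:R) // mulrA E; lra.
Qed.

(** The solution k of (1 + 1/q)^k ln(4/3) = ln(4D/3), plus one. The two ends are the values of
    [decay] at c = m/2 and at c = m/(2D). *)
Definition kmax q D : R := 1 + ln (ln (4 * D%:R / 3) / ln (4 / 3)) / ln (1 + q%:R^-1).

Lemma ln43_gt0 : 0 < ln (4 / 3 : R).
Proof. by apply: ln_gt0; lra. Qed.

Lemma kmax_ge q D : (0 < q)%N -> (0 < D)%N -> 1 <= kmax q D.
Proof.
move=> q0 D0; rewrite lerDl divr_ge0 //.
  apply: ln_ge0; rewrite ler_pdivlMr ?ln43_gt0 // mul1r.
  have : 1 <= D%:R :> R by rewrite ler1n.
  by move=> ?; rewrite ler_ln ?posrE; lra.
by apply: ln_ge0; rewrite lerDl invr_ge0.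
Qed.

(** As long as c > m/(2D), [decay] is below ln(4D/3), which bounds the exponent k. The summand 1 of
    [kmax] allows for the one further step taken from here. *)
Lemma kmax_step q m c D k : (0 < q)%N -> (0 < D)%N -> (0 < m)%N ->
  (m < c * (D + D))%N ->
  (1 + q%:R^-1) ^+ k * ln (4 / 3) <= decay m c -> k.+1%:R <= kmax q D.
Proof.
move=> q0 D0 m0 h hk.
have c0 : (0 < c)%N by move: h; case: c hk.
have q0R : 0 < q%:R^-1 :> R by rewrite invr_gt0 ltr0n.
have cR : 0 < c%:R :> R by rewrite ltr0n.
have mR : 0 < m%:R :> R by rewrite ltr0n.
have DR : 1 <= D%:R :> R by rewrite ler1n.
have lq : 0 < ln (1 + q%:R^-1 : R) by apply: ln_gt0; rewrite ltrDl.
have l43 := ln43_gt0.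
have hd : decay m c <= ln (4 * D%:R / 3).
  rewrite /decay -addrA -opprD -!lnM ?posrE // -ln_div ?posrE ?mulr_gt0 //.
  rewrite ler_ln ?posrE ?divr_gt0 ?mulr_gt0 //; last lra.
  rewrite ler_pdivrMr ?mulr_gt0 //.
  have : m%:R <= c%:R * (D%:R + D%:R) :> R by rewrite -natrD -natrM ler_nat ltnW.
  by move=> ?; lra.
rewrite -natr1 addrC /kmax lerD2l ler_pdivlMr //.
have e0 : 0 < (1 + q%:R^-1) ^+ k :> R by rewrite exprn_gt0 // ltr_pwDl // ltW.
have p1 : 0 < 1 + q%:R^-1 :> R by lra.
have -> : k%:R * ln (1 + q%:R^-1) = ln ((1 + q%:R^-1) ^+ k) :> R by rewrite lnXn // mulr_natl.
have le1 : (1 + q%:R^-1) ^+ k <= ln (4 * D%:R / 3) / ln (4 / 3) :> R.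
  by rewrite ler_pdivlMr //; apply: le_trans hk hd.
by rewrite ler_ln ?posrE //; apply: lt_le_trans le1.
Qed.

Lemma lnmax1_ge1 x : 1 <= lnmax1 x.
Proof. by rewrite /lnmax1 le_max lexx. Qed.

Lemma lnmax1_ge x : ln x <= lnmax1 x.
Proof. by rewrite /lnmax1 le_max lexx orbT. Qed.

(** The factor q comes from 1/ln(1 + 1/q) <= 2q. With ln(4/3) >= 1/4 and ln(8d/3) <= 3 l, the inner
    ratio is at most 12 l, its logarithm at most 12 ll, and 24 + 1 = 25. *)
Lemma kmax_le q d : (0 < q)%N -> (0 < d)%N ->
  kmax q (d + d) <= 25 * q%:R * lnmax1 (lnmax1 d%:R).
Proof.
move=> q0 d0.
have q1 : 1 <= q%:R :> R by rewrite ler1n.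
have d1 : 1 <= d%:R :> R by rewrite ler1n.
set l := lnmax1 d%:R; set ll := lnmax1 l.
have l1 : 1 <= l := lnmax1_ge1 _; have ll1 : 1 <= ll := lnmax1_ge1 _.
have iq : 0 < q%:R^-1 :> R by rewrite invr_gt0 ltr0n.
have h1 : (2 * q%:R)^-1 <= ln (1 + q%:R^-1 : R).
  apply: le_trans (ln1D_ge (ltW iq)).
  have -> : q%:R^-1 / (1 + q%:R^-1) = (q%:R + 1)^-1 :> R.
    by field; rewrite !gt_eqF //; lra.
  by rewrite lef_pV2 ?posrE; lra.
have h2 : 4^-1 <= ln (4 / 3 : R).
  have := @ln1D_ge (1 / 3) ltac:(lra); rewrite (_ : 1 + 1 / 3 = 4 / 3); last lra.
  by apply: le_trans; lra.
have h3 : ln (4 * (d + d)%:R / 3 : R) <= 3 * l.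
  have -> : 4 * (d + d)%:R / 3 = 8 / 3 * d%:R :> R by rewrite natrD; lra.
  rewrite lnM ?posrE; [|lra|lra].
  have := @le_ln1Dx R (5 / 3) ltac:(lra); rewrite (_ : 1 + 5 / 3 = 8 / 3); last lra.
  have := lnmax1_ge (d%:R : R); rewrite -/l; lra.
have h3' : 0 < ln (4 * (d + d)%:R / 3 : R).
  by apply: ln_gt0; rewrite natrD; lra.
have h4 : ln (ln (4 * (d + d)%:R / 3) / ln (4 / 3)) <= 12 * ll :> R.
  apply: le_trans (_ : ln (12 * l) <= _).
    rewrite ler_ln ?posrE; [|by rewrite divr_gt0 // ln43_gt0|lra].
    by rewrite ler_pdivrMr ?ln43_gt0 //; nra.
  rewrite lnM ?posrE; [|lra|lra].
  have := @le_ln1Dx R 11 ltac:(lra); rewrite (_ : 1 + 11 = 12); last lra.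
  have := lnmax1_ge l; rewrite -/ll; lra.
rewrite /kmax.
have : ln (ln (4 * (d + d)%:R / 3) / ln (4 / 3)) / ln (1 + q%:R^-1) <= 24 * q%:R * ll.
  have p : 0 < (2 * q%:R)^-1 :> R by rewrite invr_gt0; lra.
  rewrite ler_pdivrMr; last exact: lt_le_trans h1.
  apply: le_trans h4 _.
  have -> : 12 * ll = 24 * q%:R * ll * (2 * q%:R)^-1 by field; rewrite gt_eqF //; lra.
  by apply: ler_wpM2l => //; nra.
have : 1 <= q%:R * ll by nra.
by move=> ? ?; lra.
Qed.

End Real_bounds.

(** * The program *)

(* Arrays of naturals.  The points of node [v] sorted along coordinate [j] are
   the cells [(v * D + j) * n + i] of [vL], for [i] below cell [v] of [vSz];
   [vHd], [vTl] delimit the queue of nodes.  [vM1], [vM2] mark the points kept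
   by a filter, [vFlag] marks in cell [u * n + x] the edges present, [vC] counts
   them, [vPow] tabulates q-th powers, [vGo] tells whether the scale has an edge.
   [vRun], [vRsz], [vRh], [vRt] are a queue of sorted runs. *)
Notation vN := 3%N (only parsing).
Notation vD := 4%N (only parsing).
Notation vQ := 5%N (only parsing).
Notation vPow := 6%N (only parsing).
Notation vI := 7%N (only parsing).
Notation vJ := 8%N (only parsing).
Notation vK := 9%N (only parsing).
Notation vL := 10%N (only parsing).
Notation vSz := 11%N (only parsing).
Notation vHd := 12%N (only parsing).
Notation vTl := 13%N (only parsing).
Notation vM := 14%N (only parsing).
Notation vH := 15%N (only parsing).
Notation vFound := 16%N (only parsing).
Notation vPos := 17%N (only parsing).
Notation vFin := 18%N (only parsing).
Notation vB := 19%N (only parsing).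
Notation vCc := 20%N (only parsing).
Notation vCd := 21%N (only parsing).
Notation vSj := 22%N (only parsing).
Notation vM1 := 23%N (only parsing).
Notation vM2 := 24%N (only parsing).
Notation vCn := 25%N (only parsing).
Notation vX := 26%N (only parsing).
Notation vCtr := 27%N (only parsing).
Notation vGo := 28%N (only parsing).
Notation vU := 29%N (only parsing).
Notation vFlag := 30%N (only parsing).
Notation vC := 31%N (only parsing).
Notation vP := 32%N (only parsing).
Notation vRun := 33%N (only parsing).
Notation vRsz := 34%N (only parsing).
Notation vEnd := 35%N (only parsing).
Notation vA := 36%N (only parsing).
Notation vE := 37%N (only parsing).
Notation vRh := 38%N (only parsing).
Notation vRt := 39%N (only parsing).

(* Arrays of reals: signed coordinates, the radius of the scale, thresholds. *)
Notation rY := 2%N (only parsing).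
Notation rR := 3%N (only parsing).
Notation rT := 4%N (only parsing).

Declare Scope cmd_scope.
Delimit Scope cmd_scope with cmd.
Notation "c1 ;; c2" := (Seq c1 c2)
  (at level 90, right associativity, only parsing) : cmd_scope.
Notation "# v" := (NGet v (NLit 0)) (at level 2, format "# v", only parsing) : cmd_scope.
Notation "a '⊕' b" := (NAdd a b) (at level 50, left associativity, only parsing) : cmd_scope.
Notation "a '⊖' b" := (NSub a b) (at level 50, left associativity, only parsing) : cmd_scope.
Notation "a '⊗' b" := (NMul a b) (at level 40, left associativity, only parsing) : cmd_scope.
Notation "v '<~' e" := (NSet v (NLit 0) e) (at level 80, only parsing) : cmd_scope.
Notation "a '≼' b" := (BNle a b) (at level 70, only parsing) : cmd_scope.
Notation "a '≺' b" := (BNle (NAdd a (NLit 1)) b) (at level 70, only parsing) : cmd_scope.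

Section Program.
Local Open Scope cmd_scope.

Definition Yat (x j : nexp) : rexp := RGet rY (x ⊗ #vD ⊕ j).
Definition tau (j : nexp) : rexp := RGet rT j.
Definition rradius : rexp := RGet rR (NLit 0).
Definition naddr (v j i : nexp) : nexp := (v ⊗ #vD ⊕ j) ⊗ #vN ⊕ i.

Definition incr v : cmd := v <~ #v ⊕ NLit 1.

(** A real cannot be rounded, so q is found by counting up, in O(1/rho) steps. *)
Definition params_cmd : cmd :=
  vN <~ NGet 0 (NLit 0) ;;
  vD <~ NGet 0 (NLit 1) ⊕ NGet 0 (NLit 1) ;;
  vQ <~ NLit 1 ;;
  While (BNot (BRle (RNat (NLit 1)) (RMul (RNat #vQ) (RGet 0 (NLit 0))))) (incr vQ).

(** With the q-th powers of all possible counts tabulated, a split test takes constant time. *)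
Definition pow_cmd : cmd :=
  For vI (#vN ⊕ NLit 1)
    (NSet vPow #vI (NLit 1) ;;
     For vJ #vQ (NSet vPow #vI (NGet vPow #vI ⊗ #vI))).

Definition copy_cmd : cmd :=
  For vI #vN
    (For vJ (NGet 0 (NLit 1))
      (RSet rY (#vI ⊗ #vD ⊕ #vJ) (RGet 1 (#vI ⊗ NGet 0 (NLit 1) ⊕ #vJ)) ;;
       RSet rY (#vI ⊗ #vD ⊕ (NGet 0 (NLit 1) ⊕ #vJ))
         (RSub (RNat (NLit 0)) (RGet 1 (#vI ⊗ NGet 0 (NLit 1) ⊕ #vJ))))).

(** Only distances to point 0 are inspected: twice the largest lies between the diameter and twice
    the diameter, and no pass over all pairs is needed. *)
Definition diam_cmd : cmd :=
  RSet rR (NLit 0) (RNat (NLit 0)) ;;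
  For vI #vN
    (For vJ #vD
      (If (BRle rradius (RSub (Yat #vI #vJ) (Yat (NLit 0) #vJ)))
          (RSet rR (NLit 0) (RSub (Yat #vI #vJ) (Yat (NLit 0) #vJ)))
          Skip)) ;;
  RSet rR (NLit 0) (RAdd rradius rradius).

Definition run (t i : nexp) : nexp := NGet vRun (t ⊗ #vN ⊕ i).

Definition merge_cmd : cmd :=
  vA <~ NLit 0 ;; vB <~ NLit 0 ;;
  vE <~ NGet vRsz #vRh ⊕ NGet vRsz (#vRh ⊕ NLit 1) ;;
  For vI #vE
    (If (BAnd (#vA ≺ NGet vRsz #vRh)
              (BNot (BAnd (#vB ≺ NGet vRsz (#vRh ⊕ NLit 1))
                          (BNot (BRle (Yat (run #vRh #vA) #vJ)
                                      (Yat (run (#vRh ⊕ NLit 1) #vB) #vJ))))))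
        (NSet vRun (#vRt ⊗ #vN ⊕ #vI) (run #vRh #vA) ;; incr vA)
        (NSet vRun (#vRt ⊗ #vN ⊕ #vI) (run (#vRh ⊕ NLit 1) #vB) ;; incr vB)) ;;
  NSet vRsz #vRt #vE.

(** Empty runs pad the queue to a power of two, so every pass pairs all runs. By truncation,
    [1 ⊖ (i + 1 ⊖ n)] is the indicator of i < n. *)
Definition sort1_cmd : cmd :=
  For vI #vP
    (NSet vRun (#vI ⊗ #vN) #vI ;;
     NSet vRsz #vI (NLit 1 ⊖ (#vI ⊕ NLit 1 ⊖ #vN))) ;;
  vRh <~ NLit 0 ;; vRt <~ #vP ;;
  While (#vRh ⊕ NLit 2 ≼ #vRt)
    (vEnd <~ #vRt ;;
     While (#vRh ≺ #vEnd)
       (merge_cmd ;; vRh <~ #vRh ⊕ NLit 2 ;; incr vRt)) ;;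
  For vI #vN (NSet vL (#vJ ⊗ #vN ⊕ #vI) (run #vRh #vI)).

Definition sort_cmd : cmd :=
  vP <~ NLit 1 ;;
  While (#vP ≺ #vN) (vP <~ #vP ⊕ #vP) ;;
  For vJ #vD sort1_cmd.

(** [vPos] never moves back, so all thresholds of a coordinate are located in one pass over its
    sorted list. Both sides of the conjunction are evaluated, so a cell past the list may be read;
    the first conjunct then makes the test false anyway. *)
Definition advance_cmd (e : rexp) : cmd :=
  While (BAnd (#vPos ≺ #vM)
              (BRle (Yat (NGet vL (#vB ⊕ #vPos)) #vJ) e))
        (incr vPos).

Definition scan_step_cmd : cmd :=
  vCc <~ #vM ⊖ #vPos ;;
  If (#vCc ⊗ (#vD ⊕ #vD) ≼ #vM) (vFin <~ NLit 1)
    (advance_cmd (RAdd (tau #vJ) rradius) ;;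
     vCd <~ #vM ⊖ #vPos ;;
     If (BAnd (#vM ≺ #vCd ⊗ (#vD ⊕ #vD))
              (NLit 3 ⊗ #vCc ⊗ NGet vPow #vCc ≼ NLit 2 ⊗ NGet vPow #vCd ⊗ #vM))
        (vFound <~ NLit 1 ;; vFin <~ NLit 1 ;; vSj <~ #vJ)
        (RSet rT #vJ (RAdd (tau #vJ) rradius))).

Definition scan_cmd : cmd :=
  vB <~ naddr #vHd #vJ (NLit 0) ;;
  RSet rT #vJ (Yat (NGet vL (#vB ⊕ #vH)) #vJ) ;;
  vPos <~ #vH ;;
  advance_cmd (tau #vJ) ;;
  vFin <~ NLit 0 ;;
  While (#vFin ≺ NLit 1) scan_step_cmd.

(** Filtering all D lists keeps each of them sorted. The queue grows only when something was kept;
    an empty child leaves its slot to the next one. *)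
Definition filter_cmd (mk : nat) : cmd :=
  For vJ #vD
    (vCn <~ NLit 0 ;;
     For vI #vM
       (vX <~ NGet vL (naddr #vHd #vJ #vI) ;;
        If (NLit 1 ≼ NGet mk #vX)
           (NSet vL (naddr #vTl #vJ #vCn) #vX ;; incr vCn)
           Skip)) ;;
  NSet vSz #vTl #vCn ;;
  If (NLit 1 ≼ #vCn) (incr vTl) Skip.

Definition split_cmd : cmd :=
  For vI #vM
    (vX <~ NGet vL (naddr #vHd (NLit 0) #vI) ;;
     If (BRle (Yat #vX #vSj) (RAdd (tau #vSj) rradius))
        (NSet vM1 #vX (NLit 1)) (NSet vM1 #vX (NLit 0)) ;;
     If (BRle (Yat #vX #vSj) (tau #vSj))
        (NSet vM2 #vX (NLit 0)) (NSet vM2 #vX (NLit 1))) ;;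
  filter_cmd vM1 ;; filter_cmd vM2.

Definition add_edge_cmd : cmd :=
  vU <~ #vCtr ⊖ NLit 1 ;;
  If (NGet vFlag (#vU ⊗ #vN ⊕ #vX) ≼ NLit 0)
    (NSet vFlag (#vU ⊗ #vN ⊕ #vX) (NLit 1) ;;
     NSet vFlag (#vX ⊗ #vN ⊕ #vU) (NLit 1) ;;
     NSet 1 #vC #vU ;;
     NSet 2 #vC #vX ;;
     RSet 1 #vC (RNat (NLit 0)) ;;
     For vK #vD
       (If (BRle (RGet 1 #vC) (RSub (Yat #vU #vK) (Yat #vX #vK)))
           (RSet 1 #vC (RSub (Yat #vU #vK) (Yat #vX #vK))) Skip) ;;
     incr vC)
    Skip.

(** The first point of the neighbourhood becomes the centre. [vCtr] stores it plus one, so that 0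
    means that none has been met. *)
Definition star_cmd : cmd :=
  vCtr <~ NLit 0 ;;
  For vI #vM
    (vX <~ NGet vL (naddr #vHd (NLit 0) #vI) ;;
     If (NLit 1 ≼ NGet vM2 #vX)
       (If (#vCtr ≺ NLit 1) (vCtr <~ #vX ⊕ NLit 1)
           (vGo <~ NLit 1 ;; add_edge_cmd))
       Skip).

Definition box_cmd : cmd :=
  For vI #vM
    (vX <~ NGet vL (naddr #vHd (NLit 0) #vI) ;;
     NSet vM1 #vX (NLit 0) ;; NSet vM2 #vX (NLit 1) ;;
     For vK #vD
       (If (BRle (Yat #vX #vK) (tau #vK)) Skip (NSet vM1 #vX (NLit 1)) ;;
        If (BRle (Yat #vX #vK) (RAdd (tau #vK) rradius)) Skip (NSet vM2 #vX (NLit 0)))) ;;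
  filter_cmd vM1 ;; star_cmd.

(** Naturals cannot be divided, so the index h of the lower median, with 2h + 1 <= m <= 2h + 2, is
    found by counting; this costs O(m), no more than the rest of the node. *)
Definition node_cmd : cmd :=
  vM <~ NGet vSz #vHd ;;
  vH <~ NLit 0 ;;
  While (#vH ⊕ #vH ⊕ NLit 3 ≼ #vM) (incr vH) ;;
  vFound <~ NLit 0 ;; vJ <~ NLit 0 ;;
  While (BAnd (#vJ ≺ #vD) (#vFound ≺ NLit 1)) (scan_cmd ;; incr vJ) ;;
  If (NLit 1 ≼ #vFound) split_cmd box_cmd ;;
  incr vHd.

Definition scale_cmd : cmd :=
  vGo <~ NLit 0 ;; vHd <~ NLit 0 ;; vTl <~ NLit 1 ;; NSet vSz (NLit 0) #vN ;;
  While (#vHd ≺ #vTl) node_cmd ;;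
  RSet rR (NLit 0) (RDiv rradius (RNat (NLit 2))).

Definition spanner_cmd : cmd :=
  params_cmd ;; pow_cmd ;; copy_cmd ;; diam_cmd ;; sort_cmd ;;
  vGo <~ NLit 1 ;;
  While (NLit 1 ≼ #vGo) scale_cmd ;;
  NSet 0 (NLit 0) #vC.

End Program.

(** * Scanning a coordinate *)

Definition rd (T : Type) (f : nat -> T) (b m : nat) : seq T := mkseq (fun i => f (b + i)%N) m.

Lemma size_rd T (f : nat -> T) b m : size (rd f b m) = m.
Proof. by rewrite size_mkseq. Qed.

Lemma nth_rd (T : Type) x0 (f : nat -> T) b m i :
  (i < m)%N -> nth x0 (rd f b m) i = f (b + i)%N.
Proof. by move=> h; rewrite nth_mkseq. Qed.

Lemma rdS T (f : nat -> T) b m : rd f b m.+1 = rcons (rd f b m) (f (b + m)%N).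
Proof. by rewrite /rd mkseqS. Qed.

Lemma eq_rd T (f g : nat -> T) b b' m :
  (forall i, (i < m)%N -> f (b + i)%N = g (b' + i)%N) -> rd f b m = rd g b' m.
Proof.
move=> h; apply: (@eq_from_nth _ (f b)); rewrite !size_rd // => i im.
by rewrite !nth_rd // h.
Qed.

Section Sorted_prefix.
Variables (R : realType) (f : nat -> R).
Implicit Types (l : seq nat) (t : R).

Definition keyle : rel nat := fun x y => f x <= f y.

Lemma keyle_trans : transitive keyle.
Proof. by move=> y x z; apply: le_trans. Qed.

Lemma keyle_total : total keyle.
Proof. by move=> x y; apply: le_total. Qed.

Lemma sorted_nth_le l i k : sorted keyle l -> (i <= k)%N -> (k < size l)%N ->
  f (nth 0%N l i) <= f (nth 0%N l k).
Proof.
move=> so ik kl; apply: (sorted_leq_nth keyle_trans (fun x => lexx (f x)) 0%N so) => //.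
exact: (leq_ltn_trans ik kl).
Qed.

Lemma prefix_count (P : pred nat) l k : (k <= size l)%N ->
  (forall i, (i < k)%N -> P (nth 0%N l i)) -> (k <= count P l)%N.
Proof.
move=> kl h; rewrite -(cat_take_drop k l) count_cat.
have -> : count P (take k l) = k; last exact: leq_addr.
rewrite -[RHS](size_takel kl); apply/eqP; rewrite -all_count.
by apply/(all_nthP 0%N) => i; rewrite size_takel // => ik; rewrite nth_take // h.
Qed.

Lemma prefix_count_eq t l k : sorted keyle l -> (k <= size l)%N ->
  (forall i, (i < k)%N -> f (nth 0%N l i) <= t) ->
  ((k < size l)%N -> t < f (nth 0%N l k)) ->
  count (fun x => f x <= t) l = k.
Proof.
move=> so kl h hk; apply/eqP; rewrite eqn_leq prefix_count // andbT.
rewrite -(cat_take_drop k l) count_cat -[leqRHS]addn0.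
apply: leq_add; first by rewrite -[leqRHS](size_takel kl) count_size.
rewrite leqn0 -(negbK (_ == _)) -lt0n -has_count; apply/negP => /(hasP)[x].
move=> /(nthP 0%N)[i]; rewrite size_drop nth_drop => il <- le.
have il' : (k + i < size l)%N by rewrite -ltn_subRL.
have kl' := leq_ltn_trans (leq_addr i k) il'.
by have := lt_le_trans (hk kl') (sorted_nth_le so (leq_addr i k) il'); rewrite ltNge le.
Qed.

End Sorted_prefix.

Section Scan.
Variables (R : realType) (n D q : nat) (Y : nat -> nat -> R).
Implicit Types (s : store R) (l : seq nat).

Definition static s : Prop :=
  [/\ narr s vN 0 = n, narr s vD 0 = D,
      (forall i, (i <= n)%N -> narr s vPow i = (i ^ q)%N) &
      (forall x j, (x < n)%N -> (j < D)%N -> rarr s rY (x * D + j)%N = Y x j)].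

Definition crd (j : nat) : nat -> R := Y ^~ j.

Lemma advance_ok e t s l j :
  static s -> narr s vM 0 = size l -> narr s vJ 0 = j -> (j < D)%N ->
  rd (narr s vL) (narr s vB 0) (size l) = l ->
  sorted (keyle (crd j)) l -> all (fun x => x < n)%N l ->
  (narr s vPos 0 <= size l)%N ->
  (forall i, (i < narr s vPos 0)%N -> Y (nth 0%N l i) j <= t) ->
  (forall s', agree (advance_cmd e) s s' -> reval s' e = t) ->
  wp (advance_cmd e) s (fun s' T =>
    [/\ narr s' vPos 0 = count (fun x => Y x j <= t) l,
        (narr s vPos 0 <= narr s' vPos 0)%N,
        (forall i, (i < narr s' vPos 0)%N -> Y (nth 0%N l i) j <= t) &
        (T <= (narr s' vPos 0 - narr s vPos 0) * (rcost e + 40) + rcost e + 40)%N]).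
Proof.
move=> [sN sD _ sY] sM sJ jD rl so al p0 hp he.
set p := count _ l.
have fN s' a : agree (advance_cmd e) s s' -> a != vPos -> narr s' a = narr s a.
  by move=> ag h; apply: ag.1; rewrite inE.
have fR s' a : agree (advance_cmd e) s s' -> rarr s' a = rarr s a.
  by move=> ag; apply: ag.2.
have read s' : agree (advance_cmd e) s s' -> (narr s' vPos 0 < size l)%N ->
    reval s' (Yat (NGet vL (NAdd (NGet vB (NLit 0)) (NGet vPos (NLit 0)))) (NGet vJ (NLit 0)))
    = Y (nth 0%N l (narr s' vPos 0)) j.
  move=> ag lt /=; rewrite !(fR s') // !(fN s' vL) // !(fN s' vB) //
    !(fN s' vD) // !(fN s' vJ) // sD sJ -{1}rl nth_rd // sY //.
  by have := allP al _ (mem_nth 0%N lt); rewrite -{1}rl nth_rd.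
apply: (wp_while (I := fun s' => [/\ (narr s' vPos 0 <= size l)%N, (narr s vPos 0 <= narr s' vPos 0)%N &
    (forall i, (i < narr s' vPos 0)%N -> Y (nth 0%N l i) j <= t)])
    (pot := fun s' => ((p - narr s' vPos 0) * (rcost e + 40))%N)).
- by split.
- move=> s' ag [h1 h2 h3] /andP[g1 g2].
  have {g1} lt : (narr s' vPos 0 < size l)%N.
    by move: g1 => /=; rewrite (fN s' vM) // sM addn1.
  have {g2} le : Y (nth 0%N l (narr s' vPos 0)) j <= t.
    by move: g2; rewrite -read // -(he s').
  have h3' i : (i < (narr s' vPos 0).+1)%N -> Y (nth 0%N l i) j <= t.
    by rewrite ltnS leq_eqVlt => /orP[/eqP -> //|/h3].
  apply: wp_nset => /=; rewrite /upd /= addn1; split.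
    by split=> //; lia.
  have : (narr s' vPos 0 < p)%N by apply: (prefix_count (P := fun x => Y x j <= t)).
  move: (narr s' vPos 0) => x xp; have -> : (p - x = (p - x.+1).+1)%N by lia.
  rewrite mulSn; move: (_ * _)%N => w; lia.
- move=> s' T ag [h1 h2 h3] gd hT.
  have E : narr s' vPos 0 = p.
    rewrite /p; apply/esym/(@prefix_count_eq R (crd j)) => // lt.
    rewrite ltNge; apply/negP => le; move/negP: gd; apply; apply/andP; split.
      by rewrite /= (fN s' vM) // sM addn1.
    by move: le; rewrite /crd -read // -(he s' ag).
  split=> //; rewrite E; apply: leq_trans hT _ => /=.
  move: ((p - _) * _)%N => w; lia.
Qed.

Lemma static_eq s s' :
  narr s' vN = narr s vN -> narr s' vD = narr s vD -> narr s' vPow = narr s vPow ->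
  rarr s' rY = rarr s rY -> static s -> static s'.
Proof. by move=> e1 e2 e3 e4; rewrite /static e1 e2 e3 e4. Qed.

Definition cgt l j (t : R) : nat := count (fun x => t < Y x j) l.

Lemma cgtE l j t : (cgt l j t = size l - count (fun x => Y x j <= t)%R l)%N.
Proof.
rewrite -(count_predC (fun x => Y x j <= t) l) addKn.
by apply: eq_count => x /=; rewrite -ltNge.
Qed.

(** The last two clauses are the tests of the scan with denominators cleared. The first, inherited
    from the median, ensures that the lower part is not empty. *)
Definition good_split l j (t r : R) : Prop :=
  let c := cgt l j t in let c2 := cgt l j (t + r) in
  [/\ (2 * c <= size l)%N, (size l < c2 * (D + D))%N &
      (3 * c * c ^ q <= 2 * c2 ^ q * size l)%N].

(** The anchor [a] is the median, remembered only through its majority of points at or above it: the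
    majorities of a coordinate and of its negation must meet. Both bounds on k are kept, one for the
    stretch and one for the number of scales. *)
Definition good_tau l j (t r : R) : Prop :=
  (cgt l j t * (D + D) <= size l)%N /\
  exists (a : R) (k : nat), [/\ t = a + k%:R * r, (k <= size l)%N, k%:R <= kmax R q D &
    (size l < 2 * count (fun x => a <= Y x j)%R l)%N].

Lemma median_above l j h : sorted (keyle (crd j)) l ->
  (2 * h + 1 <= size l)%N ->
  (size l < 2 * count (fun x => Y (nth 0%N l h) j <= Y x j)%R l)%N.
Proof.
move=> so hl; suff : (size l - h <= count (fun x => Y (nth 0%N l h) j <= Y x j)%R l)%N by lia.
rewrite -{3}(cat_take_drop h l) count_cat -size_drop.
apply: leq_trans (leq_addl _ _); apply: eq_leq; apply/esym/eqP; rewrite -all_count.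
apply/(all_nthP 0%N) => i; rewrite size_drop nth_drop => il.
by apply: (sorted_nth_le so); rewrite ?leq_addr // -ltn_subRL.
Qed.

(** The clause c + k <= m records that every step loses a point. The growth of [decay] is claimed
    only while c > m/(2D): the tail may become empty, and ln 0 would carry no information. *)
Definition scanning l j (a r : R) (k : nat) s : Prop :=
  let c := cgt l j (a + k%:R * r) in
  [/\ [/\ narr s vFin 0 = 0%N, narr s vFound 0 = 0%N & rarr s rT j = a + k%:R * r],
      narr s vPos 0 = count (fun x => Y x j <= a + k%:R * r) l,
      (forall i, (i < narr s vPos 0)%N -> Y (nth 0%N l i) j <= a + k%:R * r),
      [/\ (2 * c <= size l)%N, (c + k <= size l)%N & k%:R <= kmax R q D] &
      (size l < c * (D + D))%N -> (1 + q%:R^-1) ^+ k * ln (4 / 3) <= decay R (size l) c].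

Definition scanned l j (r : R) s : Prop :=
  (narr s vFound 0 = 0%N /\ good_tau l j (rarr s rT j) r) \/
  [/\ narr s vFound 0 = 1%N, narr s vSj 0 = j & good_split l j (rarr s rT j) r].

(** A step ends the scan or moves the pointer strictly forward. Its cost is charged to the points
    passed, which makes the scan linear whatever the value of [kmax]. *)
Lemma scan_step_ok s l j a k :
  static s -> narr s vM 0 = size l -> narr s vJ 0 = j -> (j < D)%N -> (0 < q)%N ->
  rd (narr s vL) (narr s vB 0) (size l) = l ->
  sorted (keyle (crd j)) l -> all (fun x => x < n)%N l ->
  (0 < size l)%N -> (size l <= n)%N -> 0 <= rarr s rR 0 ->
  (size l < 2 * count (fun x => a <= Y x j)%R l)%N ->
  scanning l j a (rarr s rR 0) k s ->
  wp scan_step_cmd s (fun s' T =>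
    [/\ forall j', j' != j -> rarr s' rT j' = rarr s rT j',
        (narr s vPos 0 <= size l)%N &
        (scanning l j a (rarr s rR 0) k.+1 s' /\
          (narr s vPos 0 < narr s' vPos 0 <= size l)%N /\
         (T <= (narr s' vPos 0 - narr s vPos 0) * 200)%N) \/
        [/\ narr s' vFin 0 = 1%N, scanned l j (rarr s rR 0) s' &
          (T <= (size l - narr s vPos 0) * 200 + 200)%N]]).
Proof.
move=> st sM sJ jD q0 rl so al l0 lle r0 med [[f0 fd0 tj] pE ple [c1 c2 ck] dec].
have [sN sD sP _] := st.
set r := rarr s rR 0 in r0 tj pE ple c1 c2 ck dec *.
set t := a + k%:R * r in tj pE ple c1 c2 dec *.
have pl : (narr s vPos 0 <= size l)%N by rewrite pE count_size.
have cE : cgt l j t = (size l - narr s vPos 0)%N by rewrite cgtE pE.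
apply: wp_seq; apply: wp_nset; set s1 := Store _ _.
have e1 : narr s1 vCc 0 = cgt l j t by rewrite /s1 /= sM cE.
apply: wp_if; rewrite [beval _ _](_ : _ = (cgt l j t * (D + D) <= size l)%N);
  try by rewrite -e1 /s1 /= /upd /= sD sM.
  move=> small; apply: wp_nset; split=> //; right; split=> //; last by rewrite /=; lia.
  left; split=> //=; rewrite tj; split=> //; exists a, k; split=> //; lia.
rewrite -ltnNge => big.
apply: wp_seq; set e := RAdd _ _.
have he s' : agree (advance_cmd e) s1 s' -> reval s' e = t + r.
  by move=> ag; rewrite /= !ag.2 // !ag.1 // /s1 /= /upd /= sJ tj.
have tr : t <= t + r by rewrite lerDl.
have st1 : static s1 by apply: static_eq st.
apply: wp_use (advance_ok st1 sM sJ jD rl so al pl _ he) _ => [i /ple /le_trans -> //|].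
move=> s2 T2 ag2 [p2E p2 p2le hT2].
have n2 v : v != vPos -> v != vCc -> narr s2 v = narr s v.
  by move=> h1 h2; rewrite ag2.1 ?inE //= upd_neq.
have n2c : narr s2 vCc 0 = cgt l j t by rewrite ag2.1 // e1.
have r2 v : rarr s2 v = rarr s v by apply: ag2.2.
have p2l : (narr s2 vPos 0 <= size l)%N by rewrite p2E count_size.
have c2E : cgt l j (t + r) = (size l - narr s2 vPos 0)%N by rewrite cgtE p2E.
apply: wp_seq; apply: wp_nset; set s3 := Store _ _.
have e3 : narr s3 vCd 0 = cgt l j (t + r) by rewrite /s3 /= n2 // c2E sM.
have e3c : narr s3 vCc 0 = cgt l j t by rewrite /s3 /upd /= n2c.
have ebev : beval s3 (BAnd (BNle (NAdd (NGet vM (NLit 0)) (NLit 1)) (NMul (NGet vCd (NLit 0)) (NAdd (NGet vD (NLit 0)) (NGet vD (NLit 0)))))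
              (BNle (NMul (NMul (NLit 3) (NGet vCc (NLit 0))) (NGet vPow (NGet vCc (NLit 0))))
                (NMul (NMul (NLit 2) (NGet vPow (NGet vCd (NLit 0)))) (NGet vM (NLit 0)))))
   = (size l < cgt l j (t + r) * (D + D))%N &&
     (3 * cgt l j t * cgt l j t ^ q <= 2 * cgt l j (t + r) ^ q * size l)%N.
  have cn x : (cgt l j x <= n)%N by apply: leq_trans lle; apply: count_size.
  by rewrite [LHS]/= /s3 /= /upd /= n2c !(n2 vM) // !(n2 vD) // !(n2 vPow) // sM sD -c2E addn1 !sP.
apply: wp_if; rewrite ebev.
  move=> /andP[g1 g2]; do 2 (apply: wp_seq; apply: wp_nset); apply: wp_nset; split=> //.
    by move=> j' _; rewrite /= r2.
  right; split=> //.
    by right; split; rewrite /= ?/upd /= ?(n2 vJ) // ?r2 ?tj //; split.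
  move: hT2; rewrite /= /s1 /= /upd /=; move: (narr s vPos 0) (narr s2 vPos 0) p2l p2 => x y; rewrite /upd /=; lia.
move=> ng; apply: wp_rset; split=> //.
  by move=> j' nj; rewrite /= /upd /= (n2 vJ) // sJ (negbTE nj) r2.
left; have tk : a + k.+1%:R * r = t + r by rewrite -natr1 mulrDl mul1r addrA.
(* With equal tails the test would read 3c <= 2m up to a common factor, which holds as 2c <= m. A
   failed test therefore removes at least one point from the tail. *)
have lt : (cgt l j (t + r) < cgt l j t)%N.
  rewrite ltn_neqAle; apply/andP; split; last by rewrite c2E cE leq_sub2l.
  apply: contra ng => /eqP ->; rewrite big /=.
  rewrite -mulnA [leqRHS]mulnAC mulnA leq_mul2r; apply/orP; right.
  by lia.
have ltp : (narr s vPos 0 < narr s2 vPos 0)%N.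
  by move: lt; rewrite c2E cE; lia.
split.
  rewrite /scanning tk; split=> //.
  - by split; rewrite /= /upd /= ?(n2 vFin) ?(n2 vFound) ?(n2 vJ) // sJ eqxx !r2 tj.
  - split; [lia|lia|].
    apply: (@kmax_step R q (size l) (cgt l j t)) => //; first by case: (D) jD.
    exact: dec.
  - move=> c20; rewrite exprS -mulrA.
    apply: le_trans (_ : (1 + q%:R^-1) * decay R (size l) (cgt l j t) <= _).
      by apply: ler_wpM2l; [rewrite addr_ge0 // invr_ge0 | apply: dec].
    apply: decay_step => //; first by case: (cgt l j (t + r)) c20.
    by rewrite ltnNge; apply: contra ng => ->; rewrite c20.
split; first by rewrite ltp p2l.
move: hT2; rewrite /= /s1 /= /upd /=; move: (narr s vPos 0) (narr s2 vPos 0) ltp p2l p2 => x y; rewrite /upd /=; lia.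
Qed.

Lemma scan_ok s l j :
  static s -> narr s vM 0 = size l -> narr s vJ 0 = j -> (j < D)%N -> (0 < q)%N ->
  rd (narr s vL) ((narr s vHd 0 * D + j) * n) (size l) = l ->
  sorted (keyle (crd j)) l -> all (fun x => x < n)%N l ->
  (0 < size l)%N -> (size l <= n)%N -> 0 <= rarr s rR 0 ->
  (2 * narr s vH 0 + 1 <= size l <= 2 * narr s vH 0 + 2)%N ->
  narr s vFound 0 = 0%N ->
  wp scan_cmd s (fun s' T =>
    [/\ forall j', j' != j -> rarr s' rT j' = rarr s rT j',
        scanned l j (rarr s rR 0) s' &
        (T <= 800 * size l)%N]).
Proof.
move=> st sM sJ jD q0 rl so al l0 lle r0 /andP[hl hu] fd0.
have [sN sD _ sY] := st.
set r := rarr s rR 0 in r0 *; set h := narr s vH 0 in hl hu.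
have hL : (h < size l)%N by lia.
set a := Y (nth 0%N l h) j.
rewrite /scan_cmd; do 3 (apply: wp_seq; first [apply: wp_nset | apply: wp_rset]).
set s1 := Store _ _.
have e1B : narr s1 vB 0 = ((narr s vHd 0 * D + j) * n)%N.
  by rewrite /s1 /= /upd /= sD sN sJ addn0.
have e1T j' : rarr s1 rT j' = if j' == j then a else rarr s rT j'.
  rewrite /s1 /= /upd /= sD sN sJ; case: eqP => // _.
  rewrite addn0 -(nth_rd 0%N (narr s vL) _ hL) rl sY //.
  by have := allP al _ (mem_nth 0%N hL).
have st1 : static s1 by apply: static_eq st.
have p1 : narr s1 vPos 0 = h by [].
apply: wp_seq.
have he s' : agree (advance_cmd (tau (NGet vJ (NLit 0)))) s1 s' ->
    reval s' (tau (NGet vJ (NLit 0))) = a.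
  move=> ag; rewrite /= (ag.2 rT isT) (ag.1 vJ isT) e1T.
  by rewrite (_ : narr s1 vJ 0 = j) // eqxx.
apply: wp_use (advance_ok (l := l) (j := j) st1 _ _ jD _ so al _ _ he) _ => //.
- by rewrite e1B.
- by rewrite p1 ltnW.
- by move=> i; rewrite p1 => ih; apply: sorted_nth_le so (ltnW ih) hL.
move=> s2 T2 ag2 [p2E p2 p2le hT2].
have p2l : (narr s2 vPos 0 <= size l)%N by rewrite p2E count_size.
apply: wp_seq; apply: wp_nset; set s3 := Store _ _.
have n3 v : v \notin [:: vB; vPos; vFin] -> narr s3 v = narr s v.
  rewrite !inE !negb_or => /and3P[h1 h2 h3].
  by rewrite /s3 /= upd_neq // ag2.1 ?inE //= !upd_neq.
have r3T j' : rarr s3 rT j' = if j' == j then a else rarr s rT j'.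
  by rewrite /s3 /= ag2.2.
have r3 v : v != rT -> rarr s3 v = rarr s v.
  by move=> hv; rewrite /s3 /= ag2.2 //= upd_neq.
have e3B : narr s3 vB = narr s1 vB by rewrite /s3 /= upd_neq // ag2.1.
have e3P : narr s3 vPos 0 = narr s2 vPos 0 by [].
have med := median_above so hl.
(* At least h + 1 points are at or below the median and m <= 2h + 2, so at most half exceed it. *)
have c0 : (2 * cgt l j a <= size l)%N.
  have : (h.+1 <= count (fun x => Y x j <= a)%R l)%N.
    apply: prefix_count => // i; rewrite ltnS => ih.
    by rewrite -/(crd j _) sorted_nth_le.
  by rewrite cgtE; lia.
have jD0 : (0 < D)%N by case: (D) jD.
apply: (wp_while (I := fun s' =>
   (forall j', j' != j -> rarr s' rT j' = rarr s rT j') /\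
       (       (exists k, scanning l j a r k s') \/ (narr s' vFin 0 = 1%N /\ scanned l j r s')))
   (pot := fun s' => if narr s' vFin 0 == 0%N then ((size l - narr s' vPos 0) * 220 + 220)%N else 0%N)).
- split=> //; first by move=> j' nj; rewrite r3T (negbTE nj).
  left; exists 0%N; rewrite /scanning mul0r addr0; split=> //.
  + by split=> //; [rewrite n3 | rewrite r3T eqxx].
  + split=> //; first by rewrite addn0; lia.
    by apply: le_trans (kmax_ge R q0 jD0).
  + move=> big; rewrite expr0 mul1r; apply: decay_start c0.
    by case: (cgt l j a) big.
- move=> s' ag [hj [[k sc]|[f1 _]]] gd; last by rewrite /= f1 in gd.
  have a2 v : v != rT -> rarr s' v = rarr s3 v by move=> hv; apply: ag.2; rewrite /= inE.
  have st' : static s'.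
    by apply: static_eq st; rewrite ?(ag.1 vN isT) ?(ag.1 vD isT) ?(ag.1 vPow isT) ?(a2 rY isT) ?n3 ?r3.
  have rE : rarr s' rR 0 = r by rewrite a2 // r3.
  have f0 : narr s' vFin 0 = 0%N by case: sc => -[].
  apply: wp_use (@scan_step_ok s' l j a k st' _ _ jD q0 _ so al l0 lle _ med _) _.
  + by rewrite (ag.1 vM isT) n3.
  + by rewrite (ag.1 vJ isT) n3.
  + by rewrite (ag.1 vL isT) (ag.1 vB isT) e3B e1B n3.
  + by rewrite rE.
  + by rewrite rE.
  move=> s4 T4 _ [hj4 hp' []]; rewrite rE f0 eqxx.
    move=> [sc4 [/andP[lt4 le4] hT4]].
    have f4 : narr s4 vFin 0 = 0%N by case: sc4 => -[].
    split; first by split; [move=> j' nj; rewrite hj4 // hj | left; exists k.+1].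
    rewrite f4 /=; move: hT4 lt4 le4; move: (narr _ _ 0) (narr _ _ 0) => x y; lia.
  move=> [f4 sd4 hT4]; split.
    by split; [move=> j' nj; rewrite hj4 // hj | right].
  by rewrite f4 /=; move: hT4; move: (narr _ _ 0) => y; lia.
- move=> s' T ag [hj hS] gd.
  rewrite (_ : narr s3 vFin 0 = 0%N) // e3P => hT; split=> //.
    case: hS => [[k sc]|[_ //]].
    by move: gd; case: sc => -[f0 _ _] _ _ _ _; rewrite /= f0.
  move: hT hT2 p2 p2l hL; rewrite /= -/h; move: (narr s2 vPos 0) => y; lia.
Qed.

End Scan.

(** * Filtering the sorted lists *)

Lemma addr_lt a b i n : (a < b)%N -> (i < n)%N -> (a * n + i < b * n)%N.
Proof.
move=> ab im; apply: (@leq_trans (a.+1 * n)); last by rewrite leq_mul2r ab orbT.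
by rewrite mulSn addnC ltn_add2r.
Qed.

Lemma upd_at (T : Type) (f : nat -> nat -> T) a i v j :
  upd f a i v a j = if j == i then v else f a j.
Proof. by rewrite /upd eqxx. Qed.

Section Filter.
Variables (R : realType) (n D q : nat) (Y : nat -> nat -> R).
Implicit Types (s : store R) (l : seq nat).

(** The child is written to slot w > v, so the lists of v are read intact while it grows. [vCn] is
    reset for every coordinate, hence the size stems from the last one, [D.-1]. *)
Lemma filter_ok mk s (ls : nat -> seq nat) m v w :
  static n D q Y s -> mk \in [:: vM1; vM2] ->
  narr s vM 0 = m -> narr s vHd 0 = v -> narr s vTl 0 = w -> (v < w)%N ->
  (0 < D)%N -> (0 < m <= n)%N ->
  (forall j, (j < D)%N -> rd (narr s vL) ((v * D + j) * n) m = ls j) ->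
  let P x := (0 < narr s mk x)%N in
  wp (filter_cmd mk) s (fun s' T =>
    [/\ forall a, (a < w * D * n)%N -> narr s' vL a = narr s vL a,
        forall j, (j < D)%N ->
          rd (narr s' vL) ((w * D + j) * n) (count P (ls j)) = seq.filter P (ls j),
        forall u, narr s' vSz u = if u == w then count P (ls D.-1) else narr s vSz u,
        narr s' vTl 0 = (w + (0 < count P (ls D.-1)))%N &
        (T <= 300 * (m * D))%N]).
Proof.
move=> [sN sD _ _] mkin sM sH sT vw D0 /andP[m0 mn] rl P.
have szl j : (j < D)%N -> size (ls j) = m by move=> jD; rewrite -rl // size_rd.
have mk0 s' c : agree c s s' -> nmod c =i [:: vJ; vCn; vI; vX; vL] ->
    narr s' mk = narr s mk.
  by move=> ag ec; apply: ag.1; rewrite ec; move: mkin; rewrite !inE => /orP[] /eqP->.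
apply: wp_seq.
apply: (@wp_for R vJ _ _ s D (m * 73 + 50) (fun j s' =>
  [/\ forall a, (a < w * D * n)%N -> narr s' vL a = narr s vL a,
      forall j', (j' < j)%N ->
          rd (narr s' vL) ((w * D + j') * n) (count P (ls j')) = seq.filter P (ls j') &
      (0 < j)%N -> narr s' vCn 0 = count P (ls j.-1)])) => //.
- by move=> s' ag; rewrite /= (ag.1 vD isT).
- move=> j s1 jD s1J ag1 [low fl cn].
  have mk1 : narr s1 mk = narr s mk by apply: (mk0 _ _ ag1) => x; rewrite !inE; do !case: eqP.
  have M1 : narr s1 vM 0 = m by rewrite (ag1.1 vM isT).
  apply: wp_seq; apply: wp_nset; set s2 := Store _ _.
  apply: (@wp_for R vI _ _ s2 m 57 (fun i s' =>
    [/\ forall a, (a < (w * D + j) * n)%N -> narr s' vL a = narr s1 vL a,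
        narr s' vCn 0 = count P (take i (ls j)) &
        rd (narr s' vL) ((w * D + j) * n) (count P (take i (ls j))) = seq.filter P (take i (ls j))])) => //.
  + by move=> s' ag; rewrite /= (ag.1 vM isT) /s2 /= /upd /= M1.
  + by rewrite take0.
  + move=> i s3 im s3I ag3 [low3 cn3 fl3].
    have n3 a : a \notin [:: vCn; vI; vX; vL] -> narr s3 a = narr s1 a.
      by rewrite !inE !negb_or => /and4P[h1 h2 h3 h4]; rewrite ag3.1 /= ?inE ?negb_or ?h1 ?h2 ?h3 ?h4 // /s2 /= upd_neq.
    have ab : (v * D + j < w * D + j)%N by rewrite ltn_add2r ltn_mul2r D0.
    have il : (i < size (ls j))%N by rewrite szl.
    have xE : narr s3 vL ((v * D + j) * n + i)%N = nth 0%N (ls j) i.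
      rewrite low3; last by apply: addr_lt; lia.
      rewrite low -?rl ?nth_rd //.
      by apply: addr_lt; [nia | lia].
    have tk : take i.+1 (ls j) = rcons (take i (ls j)) (nth 0%N (ls j) i) by rewrite (take_nth 0%N).
    apply: wp_seq; apply: wp_nset; rewrite [neval _ (NGet _ _)](_ : _ = nth 0%N (ls j) i); last first.
      by rewrite /= !(n3 vHd) // !(n3 vD) // !(n3 vN) // !(n3 vJ) // ?s1J ?(ag1.1 vN isT) ?(ag1.1 vD isT) ?(ag1.1 vHd isT) ?sN ?sD ?sH // s3I xE.
    set x := nth _ _ _ in tk xE *; set s4 := Store _ _.
    have mk4 : narr s4 mk x = narr s mk x.
      rewrite /s4 /= upd_neq; last by move: mkin; rewrite !inE => /orP[] /eqP->.
      rewrite n3 ?mk1 //; by move: mkin; rewrite !inE => /orP[] /eqP->.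
    have x4 : narr s4 vX 0 = x by [].
    have n4 a : a != vX -> narr s4 a = narr s3 a by move=> h; rewrite /s4 /= upd_neq.
    clearbody s4.
    have cle : (count P (take i (ls j)) < n)%N.
      apply: leq_ltn_trans (count_size _ _) _; rewrite size_takel; lia.
    apply: wp_if; rewrite [beval _ _](_ : _ = P x); try by rewrite /= x4 mk4.
      move=> Px; do 2 (apply: wp_seq || apply: wp_nset); apply: wp_nset.
      rewrite [neval _ (naddr _ _ _)](_ : _ = ((w * D + j) * n + count P (take i (ls j)))%N); last first.
        rewrite /= !n4 // cn3 !(n3 vTl) // !(n3 vD) // !(n3 vN) // !(n3 vJ) //.
        by rewrite s1J (ag1.1 vTl isT) (ag1.1 vD isT) (ag1.1 vN isT) sN sD sT.
      split; first by rewrite /=; lia.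
      rewrite tk -cats1 count_cat filter_cat /= Px addn0 addn1 cats1.
      split.
      * move=> a ha; rewrite /= upd_neq // upd_neq // upd_at x4.
        by rewrite !n4 // low3 //; case: eqP => // E; lia.
      * by rewrite /= /upd /= n4 // cn3 addn1.
      * rewrite (addn1 (count _ _)) rdS; congr rcons; last by rewrite /= upd_neq // upd_neq // upd_at eqxx.
        rewrite -fl3; apply: eq_rd => k hk.
        by rewrite /= upd_neq // upd_neq // upd_at eqn_add2l ltn_eqF // n4.
    move=> nPx; apply: wp_skip; split; first by rewrite /=; lia.
    rewrite tk -cats1 count_cat filter_cat /= (negbTE nPx) /= !addn0 cats0.
    by split=> [a ha||]; rewrite /= upd_neq // n4 // ?low3.
  move=> s5 T5 ag5 [low5 cn5 fl5] hT5; split.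
    move: hT5; rewrite /=; lia.
  rewrite -(szl _ jD) take_size in cn5 fl5 *.
  split.
  + move=> a ha; rewrite /= upd_neq // low5 ?low //; nia.
  + move=> j'; rewrite ltnS leq_eqVlt => /orP[/eqP->|lt].
      by rewrite -{}fl5; apply: eq_rd => k _; rewrite /= upd_neq.
    rewrite -fl //; apply: eq_rd => k hk; rewrite /= upd_neq // low5 //.
    apply: addr_lt; first by rewrite ltn_add2l.
    have := count_size P (ls j'); rewrite szl; lia.
  + by move=> _; rewrite /= upd_neq.
- move=> s1 T1 ag1 [low fl cn] hT1.
  have cn' := cn D0.
  have T1E : narr s1 vTl 0 = w by rewrite (ag1.1 vTl isT).
  apply: wp_seq; apply: wp_nset; apply: wp_if; rewrite [beval _ _](_ : _ = (0 < count P (ls D.-1))%N); try by rewrite /= /upd /= cn'.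
    move=> cp; apply: wp_nset; split.
    + by move=> a ha; rewrite /= !upd_neq // low.
    + by move=> j jD; rewrite /= !upd_neq // fl.
    + by move=> u; rewrite /= upd_neq // upd_at T1E cn'; case: eqP => // _; rewrite (ag1.1 vSz isT).
    + by rewrite /= upd_at /= upd_neq // T1E cp addn1.
    + move: hT1; rewrite /=; have : (D <= m * D)%N by rewrite leq_pmull.
      by lia.
  move=> cp; apply: wp_skip; split.
  + by move=> a ha; rewrite /= !upd_neq // low.
  + by move=> j jD; rewrite /= !upd_neq // fl.
  + by move=> u; rewrite /= upd_at T1E cn'; case: eqP => // _; rewrite (ag1.1 vSz isT).
  + by rewrite /= upd_neq // T1E (negbTE cp) addn0.
  + move: hT1; rewrite /=; have : (D <= m * D)%N by rewrite leq_pmull.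
    by lia.
Qed.

End Filter.

(** * Edges and stars *)

Lemma addr_inj n a b i k : (i < n)%N -> (k < n)%N ->
  (a * n + i == b * n + k)%N = (a == b) && (i == k).
Proof.
move=> im km; apply/eqP/andP => [E|[/eqP-> /eqP->]] //.
have n0 : (0 < n)%N by case: n im {km E}.
have := congr1 (divn^~ n) E; rewrite !divnMDl // !divn_small // !addn0 => eab.
by move: E; rewrite eab => /addnI ->.
Qed.

Section Star.
Variables (R : realType) (n D q : nat) (Y : nat -> nat -> R).
Implicit Types (s : store R) (l : seq nat).

(** The recursion follows the loop that computes an edge weight: signed differences, starting from
    0. Over coordinates closed under negation it yields the sup norm. *)
Fixpoint maxdiff (x y k : nat) : R :=
  if k is k'.+1 then Num.max (maxdiff x y k') (Y x k' - Y y k') else 0.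

Definition dY (x y : nat) : R := maxdiff x y D.

Lemma maxdiff_le x y k (t : R) :
  (maxdiff x y k <= t) <-> (0 <= t /\ forall i, (i < k)%N -> Y x i - Y y i <= t).
Proof.
elim: k => [|k IH] /=; first by split=> [h|[h _]].
rewrite ge_max; split=> [/andP[/IH[h1 h2] h3]|[h1 h2]].
  by split=> // i; rewrite ltnS leq_eqVlt => /orP[/eqP->|/h2].
by rewrite h2 // andbT; apply/IH; split=> // i hi; apply: h2; apply: ltnW.
Qed.

Lemma maxdiff_ge0 x y k : 0 <= maxdiff x y k.
Proof. by have /maxdiff_le[] := lexx (maxdiff x y k). Qed.

Definition es s : seq (nat * nat) :=
  mkseq (fun i => (narr s 1 i, narr s 2 i)) (narr s vC 0).

Definition el s : rel nat := fun x y => ((x, y) \in es s) || ((y, x) \in es s).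

Lemma elC s x y : el s x y = el s y x. Proof. exact: orbC. Qed.

(** The flags make the search for an edge a constant-time lookup. The last clause excludes repeated
    and reversed pairs, so that the counter is the true number of undirected edges. *)
Definition edges_ok s : Prop :=
  [/\ forall e, e \in es s -> [&& (e.1 < n)%N, (e.2 < n)%N & e.1 != e.2],
      forall i, (i < narr s vC 0)%N -> rarr s 1 i = dY (narr s 1 i) (narr s 2 i),
      forall u x, (u < n)%N -> (x < n)%N -> (0 < narr s vFlag (u * n + x))%N = el s u x &
      uniq (es s) /\ forall u x, (u, x) \in es s -> (x, u) \notin es s].

Lemma edges_ok_eq s s' :
  narr s' 1 = narr s 1 -> narr s' 2 = narr s 2 -> narr s' vC = narr s vC ->
  narr s' vFlag = narr s vFlag -> rarr s' 1 = rarr s 1 -> edges_ok s -> edges_ok s'.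
Proof. by move=> e1 e2 e3 e4 e5; rewrite /edges_ok /el /es e1 e2 e3 e4 e5. Qed.

Lemma add_edge_ok s u x :
  static n D q Y s -> edges_ok s -> narr s vCtr 0 = u.+1 -> narr s vX 0 = x ->
  (u < n)%N -> (x < n)%N -> u != x ->
  wp add_edge_cmd s (fun s' T =>
    [/\ edges_ok s', {subset es s <= es s'}, el s' u x,
        (narr s' vC 0 <= narr s vC 0 + 1)%N & (T <= 100 * D + 200)%N]).
Proof.
move=> [sN sD _ sY] eok sC sX un xn nux; have [e1 e2 e3 [e4 e5]] := eok.
apply: wp_seq; apply: wp_nset; set s1 := Store _ _.
have n1 a : a != vU -> narr s1 a = narr s a by move=> h; rewrite /s1 /= upd_neq.
have u1 : narr s1 vU 0 = u by rewrite /s1 /= /upd /= sC subn1.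
have r1 a : rarr s1 a = rarr s a by [].
clearbody s1.
have es1 : es s1 = es s by rewrite /es !n1.
apply: wp_if; rewrite [beval _ _](_ : _ = ~~ el s u x);
  try by rewrite /= u1 !n1 // sX sN leqNgt e3.
- move=> nel; have [nel1 nel2] : (u, x) \notin es s /\ (x, u) \notin es s.
    by apply/andP; rewrite -negb_or.
  do 4 (apply: wp_seq; apply: wp_nset); apply: wp_seq; apply: wp_rset.
  set s2 := Store _ _; set C := narr s vC 0 in e2 *.
  have n2 a : a \notin [:: vFlag; 1%N; 2%N] -> narr s2 a = narr s1 a.
    by rewrite !inE !negb_or => /and3P[h1 h2 h3]; rewrite /s2 /= !upd_neq.
  have F2 p : narr s2 vFlag p = if (p == u * n + x)%N || (p == x * n + u)%N then 1%N else narr s vFlag p.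
    rewrite /s2 /= ![upd _ 2 _ _ _]upd_neq // ![upd _ 1 _ _ _]upd_neq //.
    rewrite !upd_at /= !(upd_neq _ _ _ (a := vFlag)) // u1 !n1 // sX sN.
    by case: (p == _); case: (p == _).
  have E2 i : (narr s2 1 i, narr s2 2 i) = if i == C then (u, x) else (narr s 1 i, narr s 2 i).
    by rewrite /s2 /= /upd /= u1 !n1 // -/C sX; case: eqP.
  have R2 i : rarr s2 1 i = if i == C then 0 else rarr s 1 i.
    by rewrite /s2 /= /upd /= n1 // r1 -/C; case: eqP.
  have R2n a : a != 1%N -> rarr s2 a = rarr s a.
    by move=> h; rewrite /s2 /= upd_neq // r1.
  clearbody s2.
  apply: wp_seq.
  apply: (@wp_for R vK _ _ s2 D 60 (fun k s' =>
     (forall i, i != C -> rarr s' 1 i = rarr s 1 i) /\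
     rarr s' 1 C = maxdiff u x k)) => //.
  + by move=> s' ag; rewrite /= (ag.1 vD isT) n2 // n1.
  + rewrite /= R2 eqxx; split=> // i hi; by rewrite R2 (negbTE hi).
  + move=> k s3 kD k3 ag3 [I1 I2].
    have val : reval s3 (RSub (Yat (NGet vU (NLit 0)) (NGet vK (NLit 0)))
        (Yat (NGet vX (NLit 0)) (NGet vK (NLit 0)))) = Y u k - Y x k.
      rewrite /= k3 !(ag3.1 vU isT) !(ag3.1 vD isT) !(ag3.1 vX isT) !(ag3.2 rY isT).
      by rewrite !n2 // !R2n // u1 !n1 // sX sD !sY.
    have C3 : narr s3 vC 0 = C by rewrite (ag3.1 vC isT) n2 // n1.
    have old : reval s3 (RGet 1 (NGet vC (NLit 0))) = rarr s3 1 C by rewrite /= C3.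
    apply: wp_if; rewrite [beval _ _](_ : _ = (rarr s3 1 C <= Y u k - Y x k));
      try by rewrite -val -old.
      move=> le; apply: wp_rset; rewrite val [neval _ _]/= C3; split=> //=.
       split=> [i hi|]; rewrite upd_at; first by rewrite (negbTE hi) I1.
      by rewrite eqxx -I2; apply/esym/max_idPr.
    rewrite -ltNge => /ltW le; apply: wp_skip; split=> //=; split=> //.
    by rewrite -I2; apply/esym/max_idPl.
  move=> s3 T3 ag3 [I1 I2] hT3; apply: wp_nset.
  rewrite [neval _ (NLit 0)]/=; set s4 := Store _ _.
  have C4 : narr s4 vC 0 = C.+1 by rewrite /s4 /= /upd /= (ag3.1 vC isT) n2 // n1 // addn1.
  have n4 a : a != vC -> a != vK -> narr s4 a = narr s2 a.
    by move=> h1 h2; rewrite /s4 /= upd_neq // ag3.1 //= !inE !negb_or h2.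
  have r4 : rarr s4 1 = rarr s3 1 by [].
  have es4 : es s4 = rcons (es s) (u, x).
    rewrite /es C4 mkseqS !n4 // E2 eqxx; congr rcons.
    by apply/eq_in_map => i; rewrite mem_iota /= => hi; rewrite E2 ltn_eqF.
  have eln a b : el s4 a b = el s a b || ((a == u) && (b == x)) || ((a == x) && (b == u)).
    rewrite /el es4 !mem_rcons !inE !xpair_eqE.
    by case: (_ \in _); case: (_ \in _); rewrite /= ?orbT ?orbF // andbC [X in _ || X]andbC.
  split.
  + split.
    * move=> e; rewrite es4 mem_rcons inE => /orP[/eqP->|/e1 //].
      by rewrite /= un xn nux.
    * move=> i; rewrite C4 ltnS leq_eqVlt r4 !n4 // => h.
      have [E21 E22] : narr s2 1 i = (if i == C then (u, x) else (narr s 1 i, narr s 2 i)).1 /\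
         narr s2 2 i = (if i == C then (u, x) else (narr s 1 i, narr s 2 i)).2.
        by rewrite -E2.
      rewrite E21 E22; case/orP: h => [/eqP->|lt]; first by rewrite eqxx I2.
      by rewrite ltn_eqF //= I1 ?ltn_eqF // e2.
    * move=> a b an bn; rewrite n4 // F2 eln -e3 // !addr_inj //.
      by case: (_ && _) => //=; rewrite ?orbT // ?orbF; case: (_ && _); rewrite ?orbT ?orbF.
    * rewrite es4 rcons_uniq nel1 e4; split=> // a b.
      rewrite !mem_rcons !inE !xpair_eqE !negb_or.
      move=> /orP[/andP[/eqP-> /eqP->]|h].
        by rewrite nel2 andbT negb_and; rewrite eq_sym nux.
      rewrite e5 // andbT; apply/negP => /andP[/eqP bu /eqP ax].
      by move: nel2; rewrite -bu -ax h.
  + by move=> e he; rewrite es4 mem_rcons inE he orbT.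
  + by rewrite eln !eqxx /= orbT.
  + by rewrite C4 addn1.
  + move: hT3; rewrite /=; lia.
- rewrite negbK => hel; apply: wp_skip; rewrite es1 /el es1; split=> //=; last lia.
    by apply: edges_ok_eq eok; rewrite ?n1 ?r1.
  by rewrite n1 // leq_addr.
Qed.

Lemma el_sub s s' x y : {subset es s <= es s'} -> el s x y -> el s' x y.
Proof. by move=> h /orP[] /h e; rewrite /el e ?orbT. Qed.

Lemma star_ok s l v :
  static n D q Y s -> edges_ok s -> narr s vM 0 = size l -> narr s vHd 0 = v ->
  (0 < D)%N -> (0 < size l <= n)%N -> uniq l -> all (fun x => x < n)%N l ->
  rd (narr s vL) ((v * D + 0) * n) (size l) = l ->
  let B := [seq x <- l | (0 < narr s vM2 x)%N] in
  wp star_cmd s (fun s' T =>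
    [/\ edges_ok s' /\ {subset es s <= es s'},
        forall x, x \in B -> x = head 0%N B \/ el s' (head 0%N B) x,
        (narr s' vC 0 <= narr s vC 0 + (size B).-1)%N,
        narr s' vGo 0 = (if (1 < size B)%N then 1%N else narr s vGo 0) &
        (T <= 500 * (size l * D))%N]).
Proof.
move=> st eok sM sH D0 /andP[l0 ln] ul al rl B; have [sN sD _ _] := st.
pose P x := (0 < narr s vM2 x)%N; pose Bi i := [seq x <- take i l | P x].
apply: wp_seq; apply: wp_nset; set s1 := Store _ _.
have n1 a : a != vCtr -> narr s1 a = narr s a by move=> h; rewrite /s1 /= upd_neq.
have es1 : es s1 = es s by [].
have st1 : static n D q Y s1 by apply: static_eq st.
have ok1 : edges_ok s1 by apply: edges_ok_eq eok.
have c1 : narr s1 vCtr 0 = 0%N by [].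
have r1 : rarr s1 = rarr s by [].
clearbody s1.
apply: (@wp_for R vI _ _ s1 (size l) (100 * D + 240) (fun i s' =>
  [/\ edges_ok s' /\ {subset es s <= es s'},
      forall x, x \in Bi i -> x = head 0%N (Bi i) \/ el s' (head 0%N (Bi i)) x,
      (narr s' vC 0 <= narr s vC 0 + (size (Bi i)).-1)%N,
      narr s' vGo 0 = (if (1 < size (Bi i))%N then 1%N else narr s vGo 0) &
      narr s' vCtr 0 = (if Bi i is z :: _ then z.+1 else 0%N)])) => //.
- by move=> s' ag; rewrite /= (ag.1 vM isT) n1.
- rewrite /Bi take0 /=; split; rewrite ?upd_neq ?c1 ?n1 ?addn0 //.
  split; first by apply: edges_ok_eq ok1 => /=; rewrite ?upd_neq.
  by move=> e; rewrite -es1 /es /= !upd_neq.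
- move=> i s2 il s2I ag2 [[ok2 sub2] I2 C2 G2 Z2].
  have tk : Bi i.+1 = Bi i ++ (if P (nth 0%N l i) then [:: nth 0%N l i] else [::]).
    by rewrite /Bi (take_nth 0%N il) -cats1 filter_cat /=.
  set x := nth 0%N l i in tk.
  have xl : x \in l by apply: mem_nth.
  have xn : (x < n)%N := allP al _ xl.
  (* As the points of the list are distinct, the centre is never joined to itself. *)
  have xNB : x \notin Bi i.
    rewrite mem_filter negb_and; apply/orP; right.
    have : uniq (take i l ++ drop i l) by rewrite cat_take_drop.
    by rewrite (drop_nth 0%N il) cat_uniq => /and3P[_ /= /norP[]].
  apply: wp_seq; apply: wp_nset; rewrite [neval _ (NGet _ _)](_ : _ = x); last first.
    rewrite /= !(ag2.1 vD isT) !(ag2.1 vN isT) !(ag2.1 vHd isT) !(ag2.1 vL isT) !n1 // s2I sN sD sH.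
    by rewrite -(nth_rd 0%N (narr s vL) _ il) rl.
  set s3 := Store _ _.
  have n3 a : a != vX -> narr s3 a = narr s2 a by move=> h; rewrite /s3 /= upd_neq.
  have x3 : narr s3 vX 0 = x by [].
  have r3 a : rarr s3 a = rarr s2 a by [].
  clearbody s3.
  have es3 : es s3 = es s2 by rewrite /es !n3.
  have ok3 : edges_ok s3 by apply: edges_ok_eq ok2; rewrite ?n3 ?r3.
  have st3 : static n D q Y s3.
    apply: static_eq st1; rewrite ?r3 ?n3 //;
      by rewrite ?(ag2.1 vN isT) ?(ag2.1 vD isT) ?(ag2.1 vPow isT) ?(ag2.2 rY isT).
  apply: wp_if; rewrite [beval _ _](_ : _ = P x);
    try by rewrite /= x3 n3 // (ag2.1 vM2 isT) n1.
  + move=> Px; rewrite Px in tk.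
    apply: wp_if; rewrite [beval _ _](_ : _ = (size (Bi i) == 0%N));
      try by rewrite /= n3 // Z2 addn1; case: (Bi i).
    * move=> /eqP/size0nil B0; apply: wp_nset; split=> //=; first by lia.
      rewrite tk B0 /= in C2 G2 *.
      split=> /=.
      - split; last by move=> e /sub2; rewrite -es3 /es /= !upd_neq.
        by apply: edges_ok_eq ok3 => /=; rewrite ?upd_neq.
      - by move=> y; rewrite inE => /eqP->; left.
      - by rewrite !upd_neq // n3.
      - by rewrite !upd_neq // n3.
      - by rewrite upd_neq // upd_at x3 addn1.
    * move=> Bne; apply: wp_seq; apply: wp_nset; set s4 := Store _ _.
      have n4 a : a != vGo -> narr s4 a = narr s3 a by move=> h; rewrite /s4 /= upd_neq.
      have g4 : narr s4 vGo 0 = 1%N by [].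
      have r4 a : rarr s4 a = rarr s3 a by [].
      clearbody s4.
      have es4 : es s4 = es s2 by rewrite -es3 /es !n4.
      have ok4 : edges_ok s4 by apply: edges_ok_eq ok3; rewrite ?n4 ?r4.
      have st4 : static n D q Y s4 by apply: static_eq st3; rewrite ?n4 ?r4.
      have [z [B' Be]] : exists z B', Bi i = z :: B' by case: (Bi i) Bne => // z B' _; exists z, B'.
      have zB : z \in Bi i by rewrite Be mem_head.
      have zx : z != x by apply: contraNneq xNB => <-.
      have zn : (z < n)%N by move: zB; rewrite mem_filter => /andP[_ /mem_take /(allP al)].
      apply: wp_use (@add_edge_ok s4 z x st4 ok4 _ _ zn xn zx) _.
      - by rewrite n4 // n3 // Z2 Be.
      - by rewrite n4.
      move=> s5 T5 ag5 [ok5 sub5 el5 C5 hT5]; split; first by rewrite /=; lia.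
      have es6 k : es (Store (upd (narr s5) vI 0 k) (rarr s5)) = es s5.
        by rewrite /es /= !upd_neq.
      rewrite tk Be /=; split; rewrite ?upd_neq //.
      - split; first by apply: edges_ok_eq ok5 => /=; rewrite ?upd_neq.
        by move=> e /sub2; rewrite es6 -es4 => /sub5.
      - move=> y; rewrite -cat_cons -Be mem_cat => /orP[yB|].
          have [->|h] := I2 _ yB; first by left; rewrite Be.
          right; rewrite /el es6; apply: (@el_sub s2 s5); first by rewrite -es4.
          by move: h; rewrite Be.
        by rewrite inE => /eqP->; right; rewrite /el es6.
      - move: C5; rewrite n4 // n3 // size_cat /= => C5; apply: leq_trans C5 _.
        by move: C2; rewrite Be /=; lia.
      - by rewrite (ag5.1 vGo isT) g4 size_cat /= addn1.
      - by rewrite (ag5.1 vCtr isT) n4 // n3 // Z2 Be.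
  + move=> nPx; rewrite (negbTE nPx) cats0 in tk; apply: wp_skip; rewrite tk; split; first by rewrite /=; lia.
    have es6 k : es (Store (upd (narr s3) vI 0 k) (rarr s3)) = es s2.
      by rewrite -es3 /es /= !upd_neq.
    split; rewrite /= ?upd_neq ?n3 //.
    - split; first by apply: edges_ok_eq ok3 => /=; rewrite ?upd_neq.
      by move=> e /sub2; rewrite es6.
    - by move=> y /I2; rewrite /el es6.
- move=> s2 T2 ag2 [h1 h2 h3 h4 _] hT2.
  rewrite /Bi take_size -/B in h2 h3 h4; split=> //.
  move: hT2; rewrite /=; have : (size l <= size l * D)%N by rewrite leq_pmulr.
  have : (0 < size l * D)%N by rewrite muln_gt0 l0.
  lia.
Qed.

End Star.

(** * Split and box nodes *)

Section Node.
Variables (R : realType) (n D q : nat) (Y : nat -> nat -> R).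
Hypothesis D0 : (0 < D)%N.
Implicit Types (s : store R) (l : seq nat).

Definition nl s v j : seq nat := rd (narr s vL) ((v * D + j) * n) (narr s vSz v).

Definition node_ok s v : Prop :=
  [/\ (0 < narr s vSz v)%N, uniq (nl s v 0), all (fun x => x < n)%N (nl s v 0),
      forall j, (j < D)%N -> perm_eq (nl s v j) (nl s v 0) &
      forall j, (j < D)%N -> sorted (keyle (crd Y j)) (nl s v j)].

Lemma node_size s v : node_ok s v -> (narr s vSz v <= n)%N.
Proof.
move=> [_ ul al _ _]; rewrite -(size_rd (narr s vL) ((v * D + 0) * n) (narr s vSz v)).
rewrite -[leqRHS](size_iota 0); apply: uniq_leq_size => // x xl.
by rewrite mem_iota /=; apply: (allP al).
Qed.

(** Queue discipline: slots below the tail, whether processed or waiting, stay as they are.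
    Everything known about waiting nodes is carried along by this relation. *)
Definition keeps w s s' : Prop :=
  (forall a, (a < w * D * n)%N -> narr s' vL a = narr s vL a) /\
  (forall u, (u < w)%N -> narr s' vSz u = narr s vSz u).

Lemma keeps_trans w s s' s'' : keeps w s s' -> keeps w s' s'' -> keeps w s s''.
Proof. by move=> [h1 h2] [h3 h4]; split=> a ha; rewrite ?h3 ?h4 // ?h1 ?h2. Qed.

Lemma keeps_le w w' s s' : (w <= w')%N -> keeps w' s s' -> keeps w s s'.
Proof.
move=> ww [h1 h2]; split=> a ha; [apply: h1|apply: h2]; apply: leq_trans ha _ => //.
by rewrite -mulnA -[(w' * D * n)%N]mulnA leq_mul2r ww orbT.
Qed.

Lemma keeps_nl w s s' u j : keeps w s s' -> (u < w)%N -> (narr s vSz u <= n)%N ->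
  (j < D)%N -> nl s' u j = nl s u j.
Proof.
move=> [h1 h2] uw un jD; rewrite /nl h2 //; apply: eq_rd => i hi; apply: h1.
by apply: addr_lt; [nia | lia].
Qed.

Lemma keeps_node w s s' u : keeps w s s' -> (u < w)%N -> node_ok s u -> node_ok s' u.
Proof.
move=> kp uw ok; have un := node_size ok; have [h1 h2 h3 h4 h5] := ok.
have e j : (j < D)%N -> nl s' u j = nl s u j by move=> jD; apply: keeps_nl kp uw un jD.
by split=> [||| j jD | j jD]; rewrite ?(kp.2 _ uw) ?e //; [apply: h4 | apply: h5].
Qed.

Lemma filter_node mk s v w (P : pred nat) :
  static n D q Y s -> mk \in [:: vM1; vM2] ->
  narr s vM 0 = narr s vSz v -> narr s vHd 0 = v -> narr s vTl 0 = w -> (v < w)%N ->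
  node_ok s v -> (forall x, x \in nl s v 0 -> (0 < narr s mk x)%N = P x) ->
  let fl := [seq x <- nl s v 0 | P x] in
  wp (filter_cmd mk) s (fun s' T =>
    [/\ keeps w s s', nl s' w 0 = fl, narr s' vSz w = size fl /\ ((0 < size fl)%N -> node_ok s' w),
        narr s' vTl 0 = (w + (0 < size fl))%N & (T <= 300 * (narr s vSz v * D))%N]).
Proof.
move=> st mkin sM sH sT vw ok mkP fl.
have vn := node_size ok; have [v0 ul al pl so] := ok.
apply: wp_use (@filter_ok R n D q Y mk s (nl s v) _ v w st mkin sM sH sT vw D0 _ _) _ => //.
  by rewrite v0.
move=> s' T ag [low fil szE tlE hT].
have fE j : (j < D)%N -> [seq x <- nl s v j | (0 < narr s mk x)%N] = [seq x <- nl s v j | P x].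
  by move=> jD; apply: eq_in_filter => x; rewrite (perm_mem (pl _ jD)); apply: mkP.
have cE j : (j < D)%N -> count (fun x => 0 < narr s mk x)%N (nl s v j) = size fl.
  move=> jD; rewrite (permP (pl _ jD)) -size_filter fE //.
have szw : narr s' vSz w = size fl by rewrite szE eqxx cE // prednK.
have nlw j : (j < D)%N -> nl s' w j = [seq x <- nl s v j | P x].
  by move=> jD; rewrite -fE // -fil // /nl szw cE.
split=> //.
- by split=> // u uw; rewrite szE ltn_eqF.
- exact: nlw.
- split=> // f0; split=> [||| j jD | j jD]; rewrite ?nlw ?szw //.
  + exact: filter_uniq.
  + by apply/allP => x; rewrite mem_filter => /andP[_ /(allP al)].
  + by apply/permP => p; rewrite !count_filter; apply/permP/pl.
  + by apply: sorted_filter (so _ jD); apply: keyle_trans.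
- by rewrite tlE cE // prednK.
Qed.

Lemma filter_agree mk s s' : agree (filter_cmd mk) s s' ->
  (forall a, a \notin [:: vI; vJ; vCn; vX; vL; vSz; vTl] -> narr s' a = narr s a) /\
  rarr s' = rarr s.
Proof.
move=> [h g]; split; last by apply/funext => a; apply: g.
by move=> a; rewrite !inE !negb_or => hh; apply: h; move: hh;
  rewrite /= !inE !negb_or => /and4P[-> -> -> /and4P[-> -> -> ->]].
Qed.

(** Both parts are assumed nonempty, so each of them advances the tail and they occupy the slots w
    and w + 1. *)
Lemma split_ok s v w j :
  let l := nl s v 0 in let t := rarr s rT j in let r := rarr s rR 0 in
  static n D q Y s -> narr s vM 0 = narr s vSz v -> narr s vHd 0 = v -> narr s vTl 0 = w ->
  (v < w)%N -> node_ok s v -> narr s vSj 0 = j -> (j < D)%N ->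
  has (fun x => Y x j <= t + r) l -> has (fun x => t < Y x j) l ->
  wp split_cmd s (fun s' T =>
    [/\ keeps w s s', narr s' vTl 0 = w.+2, node_ok s' w /\ node_ok s' w.+1,
        nl s' w 0 = [seq x <- l | Y x j <= t + r] /\ nl s' w.+1 0 = [seq x <- l | t < Y x j] &
        (T <= 1000 * (narr s vSz v * D))%N]).
Proof.
move=> l t r st sM sH sT vw ok sJ jD has1 has2; have [sN sD _ sY] := st.
have [v0 ul al _ _] := ok; have sl : size l = narr s vSz v by rewrite size_rd.
pose m := narr s vSz v.
apply: wp_seq; apply: (@wp_for R vI _ _ s m 80 (fun i s' =>
  forall x, x \in take i l -> (0 < narr s' vM1 x)%N = (Y x j <= t + r) /\
    (0 < narr s' vM2 x)%N = (t < Y x j))) => //.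
- by move=> s' ag; rewrite /= (ag.1 vM isT).
- by rewrite take0.
- move=> i s1 im s1I ag1 I1.
  have il : (i < size l)%N by rewrite sl.
  set x := nth 0%N l i; have xn : (x < n)%N by apply: (allP al); apply: mem_nth.
  apply: wp_seq; apply: wp_nset; rewrite [neval _ (NGet _ _)](_ : _ = x); last first.
    rewrite /= !(ag1.1 vD isT) !(ag1.1 vN isT) !(ag1.1 vHd isT) !(ag1.1 vL isT) s1I sN sD sH.
    by rewrite -(nth_rd 0%N (narr s vL) _ im).
  set s2 := Store _ _.
  have n2 a : a != vX -> narr s2 a = narr s1 a by move=> h; rewrite /s2 /= upd_neq.
  have x2 : narr s2 vX 0 = x by [].
  have r2 : rarr s2 = rarr s1 by [].
  clearbody s2.
  have yE s' : rarr s' = rarr s1 -> narr s' vX 0 = x -> narr s' vD = narr s1 vD ->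
      narr s' vSj = narr s1 vSj ->
      reval s' (Yat (NGet vX (NLit 0)) (NGet vSj (NLit 0))) = Y x j /\
      reval s' (tau (NGet vSj (NLit 0))) = t /\ reval s' rradius = r.
    move=> e1 e2 e3 e4; rewrite /= e1 e2 e3 e4 !(ag1.1 vD isT) !(ag1.1 vSj isT).
    by rewrite (ag1.2 rY isT) (ag1.2 rT isT) (ag1.2 rR isT) sD sJ sY.
  pose s3 := Store (upd (narr s2) vM1 x (Y x j <= t + r)) (rarr s2).
  apply: wp_seq.
  have h3 : wp (If (BRle (Yat (NGet vX (NLit 0)) (NGet vSj (NLit 0))) (RAdd (tau (NGet vSj (NLit 0))) rradius))
      (NSet vM1 (NGet vX (NLit 0)) (NLit 1)) (NSet vM1 (NGet vX (NLit 0)) (NLit 0))) s2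
      (fun s' T => s' = s3 /\ (T <= 30)%N).
    have [y2 [t2 rr2]] := yE s2 r2 x2 (n2 vD isT) (n2 vSj isT).
    by apply: wp_if; rewrite [beval _ _](_ : _ = (Y x j <= t + r));
      try (by rewrite -y2 -t2 -rr2); rewrite /s3 => h; apply: wp_nset; split=> //=;
      rewrite x2 ?h ?(negbTE h).
  apply: wp_use h3 _ => _ T3 _ [-> hT3].
  have n3 a : a != vM1 -> narr s3 a = narr s2 a by move=> h; rewrite /s3 /= upd_neq.
  have h4 : wp (If (BRle (Yat (NGet vX (NLit 0)) (NGet vSj (NLit 0))) (tau (NGet vSj (NLit 0))))
      (NSet vM2 (NGet vX (NLit 0)) (NLit 0)) (NSet vM2 (NGet vX (NLit 0)) (NLit 1))) s3
      (fun s' T => s' = Store (upd (narr s3) vM2 x (t < Y x j)) (rarr s3) /\ (T <= 28)%N).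
    have X3 : narr s3 vX 0 = x by rewrite n3.
    have D3 : narr s3 vD = narr s1 vD by rewrite n3 // n2.
    have S3 : narr s3 vSj = narr s1 vSj by rewrite n3 // n2.
    have [y3 [t3 rr3]] := yE s3 r2 X3 D3 S3.
    by apply: wp_if; rewrite [beval _ _](_ : _ = (Y x j <= t));
      try (by rewrite -y3 -t3); move=> h; apply: wp_nset; split=> //;
      rewrite (X3 : neval s3 (NGet vX (NLit 0)) = x) ltNge ?h ?(negbTE h).
  apply: wp_use h4 _ => _ T4 _ [-> hT4]; split; first by rewrite /=; lia.
  move=> y; rewrite (take_nth 0%N il) mem_rcons inE -/x => hy.
  set s4 := Store _ _.
  have -> : narr s4 vM1 y = if y == x then nat_of_bool (Y x j <= t + r) else narr s1 vM1 y.
    by rewrite /s4 /= upd_neq // upd_neq // upd_at n2.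
  have -> : narr s4 vM2 y = if y == x then nat_of_bool (t < Y x j) else narr s1 vM2 y.
    by rewrite /s4 /= upd_neq // upd_at upd_neq // n2.
  by case: eqP hy => [->|_ /I1 //]; rewrite !lt0b.
move=> s1 T1 ag1 I1 hT1.
rewrite (_ : m = size l) ?take_size // in I1.
have st1 : static n D q Y s1.
  by apply: static_eq st; rewrite ?(ag1.1 vN isT) ?(ag1.1 vD isT) ?(ag1.1 vPow isT) ?(ag1.2 rY isT).
have k1 : keeps w s s1 by split=> a _; rewrite ?(ag1.1 vL isT) ?(ag1.1 vSz isT).
have l1 : nl s1 v 0 = l by rewrite /nl (ag1.1 vL isT) (ag1.1 vSz isT).
have ok1 := keeps_node k1 vw ok.
apply: wp_seq.
apply: wp_use (@filter_node vM1 s1 v w (fun x => Y x j <= t + r) st1 isT _ _ _ vw ok1 _) _.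
- by rewrite (ag1.1 vM isT) (ag1.1 vSz isT).
- by rewrite (ag1.1 vHd isT).
- by rewrite (ag1.1 vTl isT).
- by move=> x; rewrite l1 => /I1[].
rewrite l1 => s2 T2 /filter_agree[ag2 rg2] [k2 nl2 [sz2 ok2] tl2 hT2].
move: tl2 ok2; rewrite size_filter -has_count has1 addn1 => tl2 /(_ isT) ok2.
have st2 : static n D q Y s2 by apply: static_eq st1; rewrite ?ag2 ?rg2.
have l2 : nl s2 v 0 = l by rewrite -l1; apply: keeps_nl k2 vw (node_size ok1) D0.
apply: wp_use (@filter_node vM2 s2 v w.+1 (fun x => t < Y x j) st2 isT _ _ _ _ _ _) _ => //.
- by rewrite ag2 // k2.2 // (ag1.1 vM isT) (ag1.1 vSz isT).
- by rewrite ag2 // (ag1.1 vHd isT).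
- exact: ltnW.
- exact: keeps_node k2 vw ok1.
- by move=> x; rewrite l2 ag2 // => /I1[].
rewrite l2 => s3 T3 _ [k3 nl3 [sz3 ok3] tl3 hT3].
move: tl3 ok3; rewrite size_filter -has_count has2 addn1 => tl3 /(_ isT) ok3.
split=> //.
- by apply: keeps_trans k1 (keeps_trans k2 (keeps_le _ k3)).
- by split=> //; apply: keeps_node k3 _ ok2.
- by split=> //; rewrite -nl2; apply: keeps_nl k3 _ (node_size ok2) D0.
- move: hT1 hT2 hT3; rewrite k2.2 // (ag1.1 vSz isT) -/m /=.
  have : (m <= m * D)%N by rewrite leq_pmulr.
  have : (0 < m * D)%N by rewrite muln_gt0 v0.
  lia.
Qed.

Lemma has_iotaS (P : pred nat) k : has P (iota 0 k.+1) = has P (iota 0 k) || P k.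
Proof. by rewrite -addn1 iotaD has_cat /= orbF. Qed.

Lemma all_iotaS (P : pred nat) k : all P (iota 0 k.+1) = all P (iota 0 k) && P k.
Proof. by rewrite -addn1 iotaD all_cat /= andbT. Qed.

Definition outside s x : bool := has (fun k => rarr s rT k < Y x k) (iota 0 D).
Definition near_box s x : bool :=
  all (fun k => Y x k <= rarr s rT k + rarr s rR 0) (iota 0 D).

Lemma box_ok s v w :
  let l := nl s v 0 in
  static n D q Y s -> edges_ok n D Y s ->
  narr s vM 0 = narr s vSz v -> narr s vHd 0 = v -> narr s vTl 0 = w ->
  (v < w)%N -> node_ok s v ->
  let ch := [seq x <- l | outside s x] in let B := [seq x <- l | near_box s x] in
  wp box_cmd s (fun s' T =>
    [/\ keeps w s s',
        [/\ narr s' vTl 0 = (w + (0 < size ch))%N, nl s' w 0 = ch,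
            narr s' vSz w = size ch & (0 < size ch)%N -> node_ok s' w],
        [/\ edges_ok n D Y s', {subset es s <= es s'},
            forall x, x \in B -> x = head 0%N B \/ el s' (head 0%N B) x &
            (narr s' vC 0 <= narr s vC 0 + (size B).-1)%N],
        narr s' vGo 0 = (if (1 < size B)%N then 1%N else narr s vGo 0) &
        (T <= 1500 * (narr s vSz v * D))%N]).
Proof.
move=> l st eok sM sH sT vw ok ch B; have [sN sD _ sY] := st.
have vn := node_size ok.
have [v0 ul al _ _] := ok; have sl : size l = narr s vSz v by rewrite size_rd.
pose m := narr s vSz v; pose r := rarr s rR 0; pose t k := rarr s rT k.
apply: wp_seq; apply: (@wp_for R vI _ _ s m (100 * D + 80) (fun i s' =>
  forall x, x \in take i l -> (0 < narr s' vM1 x)%N = outside s x /\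
    (0 < narr s' vM2 x)%N = near_box s x)) => //.
- by move=> s' ag; rewrite /= (ag.1 vM isT).
- by rewrite take0.
- move=> i s1 im s1I ag1 I1.
  have il : (i < size l)%N by rewrite sl.
  set x := nth 0%N l i; have xn : (x < n)%N by apply: (allP al); apply: mem_nth.
  apply: wp_seq; apply: wp_nset; rewrite [neval _ (NGet _ _)](_ : _ = x); last first.
    rewrite /= !(ag1.1 vD isT) !(ag1.1 vN isT) !(ag1.1 vHd isT) !(ag1.1 vL isT) s1I sN sD sH.
    by rewrite -(nth_rd 0%N (narr s vL) _ im).
  do 2 (apply: wp_seq; apply: wp_nset); set s2 := Store _ _.
  have n2 a : a \notin [:: vX; vM1; vM2] -> narr s2 a = narr s1 a.
    by rewrite !inE !negb_or => /and3P[h1 h2 h3]; rewrite /s2 /= !upd_neq.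
  have x2 : narr s2 vX 0 = x by [].
  have r2 : rarr s2 = rarr s1 by [].
  have m12 y : narr s2 vM1 y = if y == x then 0%N else narr s1 vM1 y.
    by rewrite /s2 /= /upd /=.
  have m22 y : narr s2 vM2 y = if y == x then 1%N else narr s1 vM2 y.
    by rewrite /s2 /= /upd /=.
  clearbody s2.
  apply: (@wp_for R vK _ _ s2 D 80 (fun k s' =>
    [/\ (0 < narr s' vM1 x)%N = has (fun k' => t k' < Y x k') (iota 0 k),
        (0 < narr s' vM2 x)%N = all (fun k' => Y x k' <= t k' + r) (iota 0 k) &
        forall y, y != x -> narr s' vM1 y = narr s1 vM1 y /\ narr s' vM2 y = narr s1 vM2 y])) => //.
  + by move=> s' ag; rewrite /= (ag.1 vD isT) n2 // (ag1.1 vD isT).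
  + rewrite /= upd_neq // upd_neq //.
    by split=> [||y /negbTE yx]; rewrite ?m12 ?m22 ?eqxx ?yx.
  + move=> k s3 kD k3 ag3 [A1 A2 A3].
    have x3 : narr s3 vX 0 = x by rewrite (ag3.1 vX isT).
    have yE s' : rarr s' = rarr s3 -> narr s' vX 0 = x -> narr s' vD = narr s3 vD ->
        narr s' vK = narr s3 vK ->
        reval s' (Yat (NGet vX (NLit 0)) (NGet vK (NLit 0))) = Y x k /\
        reval s' (tau (NGet vK (NLit 0))) = t k /\ reval s' rradius = r.
      move=> e1 e2 e3 e4; rewrite /= e1 e2 e3 e4 k3 (ag3.1 vD isT) n2 // (ag1.1 vD isT).
      rewrite (ag3.2 rY isT) (ag3.2 rT isT) (ag3.2 rR isT) r2.
      by rewrite (ag1.2 rY isT) (ag1.2 rT isT) (ag1.2 rR isT) sD sY.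
    apply: wp_seq; apply: wp_use (_ : wp _ _ (fun s' T => [/\
       (0 < narr s' vM1 x)%N = has (fun k' => t k' < Y x k') (iota 0 k.+1),
        forall y, y != x -> narr s' vM1 y = narr s1 vM1 y & (T <= 30)%N])) _.
      have [y3 [t3 _]] := yE s3 erefl x3 erefl erefl.
      rewrite has_iotaS -A1.
      apply: wp_if; rewrite [beval _ _](_ : _ = (Y x k <= t k)); try (by rewrite -y3 -t3).
        move=> h; apply: wp_skip; split=> //=; first by rewrite ltNge h orbF.
        by move=> y yx; case: (A3 _ yx).
      move=> h; apply: wp_nset; rewrite (x3 : neval s3 (NGet vX (NLit 0)) = x).
      split=> //=; first by rewrite upd_at eqxx ltNge h orbT.
      by move=> y yx; rewrite upd_at (negbTE yx); case: (A3 _ yx).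
    move=> s4 T4 ag4 [B1 B3 hT4].
    have x4 : narr s4 vX 0 = x by rewrite (ag4.1 vX isT).
    have r4 : rarr s4 = rarr s3 by apply/funext => a; apply: ag4.2.
    have m4 : narr s4 vM2 = narr s3 vM2 by apply: ag4.1.
    have [y4 [t4 rr4]] := yE s4 r4 x4 (ag4.1 vD isT) (ag4.1 vK isT).
    apply: wp_if; rewrite [beval _ _](_ : _ = (Y x k <= t k + r)); try (by rewrite -y4 -t4 -rr4).
      move=> h; apply: wp_skip; split; first by rewrite /=; lia.
      rewrite all_iotaS -A2 h andbT -B1 -m4 [narr _ vM1]upd_neq // [narr _ vM2]upd_neq //.
      by split=> // y yx; rewrite B3 // m4; split=> //; case: (A3 _ yx).
    move=> h; apply: wp_nset; rewrite (x4 : neval s4 (NGet vX (NLit 0)) = x).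
    split; first by rewrite /=; lia.
    rewrite all_iotaS (negbTE h) andbF -B1; split=> /=.
    - by rewrite !upd_neq.
    - by rewrite upd_neq // upd_at eqxx.
    - move=> y yx; rewrite upd_neq // upd_neq // upd_neq // upd_at (negbTE yx) B3 // m4; split=> //.
      by case: (A3 _ yx).
  move=> s3 T3 ag3 [A1 A2 A3] hT3; split; first by move: hT3; rewrite /=; lia.
  move=> y; rewrite (take_nth 0%N il) mem_rcons inE -/x => hy.
  rewrite /= !upd_neq //.
  by case: eqP hy => [->|/eqP yx /I1]; [rewrite A1 A2 | have [-> ->] := A3 _ yx].
move=> s1 T1 ag1 I1 hT1.
rewrite (_ : m = size l) ?take_size // in I1.
have st1 : static n D q Y s1.
  by apply: static_eq st; rewrite ?(ag1.1 vN isT) ?(ag1.1 vD isT) ?(ag1.1 vPow isT) ?(ag1.2 rY isT).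
have k1 : keeps w s s1 by split=> a _; rewrite ?(ag1.1 vL isT) ?(ag1.1 vSz isT).
have l1 : nl s1 v 0 = l by rewrite /nl (ag1.1 vL isT) (ag1.1 vSz isT).
have ok1 := keeps_node k1 vw ok.
have eok1 : edges_ok n D Y s1.
  by apply: edges_ok_eq eok; rewrite ?(ag1.1 1%N isT) ?(ag1.1 2%N isT) ?(ag1.1 vC isT) ?(ag1.1 vFlag isT) ?(ag1.2 1%N isT).
have es1 : es s1 = es s by rewrite /es (ag1.1 1%N isT) (ag1.1 2%N isT) (ag1.1 vC isT).
apply: wp_seq.
apply: wp_use (@filter_node vM1 s1 v w (outside s) st1 isT _ _ _ vw ok1 _) _.
- by rewrite (ag1.1 vM isT) (ag1.1 vSz isT).
- by rewrite (ag1.1 vHd isT).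
- by rewrite (ag1.1 vTl isT).
- by move=> x; rewrite l1 => /I1[].
rewrite l1 -/ch => s2 T2 /filter_agree[ag2 rg2] [k2 nl2 [sz2 ok2] tl2 hT2].
have st2 : static n D q Y s2 by apply: static_eq st1; rewrite ?ag2 ?rg2.
have l2 : nl s2 v 0 = l by rewrite -l1; apply: keeps_nl k2 vw (node_size ok1) D0.
have eok2 : edges_ok n D Y s2 by apply: edges_ok_eq eok1; rewrite ?ag2 ?rg2.
have es2 : es s2 = es s by rewrite -es1 /es !ag2.
have BE : [seq x <- l | (0 < narr s2 vM2 x)%N] = B.
  by apply: eq_in_filter => x /I1[_ <-]; rewrite ag2.
apply: wp_use (@star_ok R n D q Y s2 l v st2 eok2 _ _ D0 _ ul al _) _.
- by rewrite ag2 // (ag1.1 vM isT) sl.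
- by rewrite ag2 // (ag1.1 vHd isT).
- by rewrite sl v0 vn.
- by rewrite sl -[RHS]l2 /nl k2.2 // (ag1.1 vSz isT).
rewrite BE => s3 T3 ag3 [[eok3 sub3] B3 C3 G3 hT3].
have k3 : keeps w.+1 s2 s3 by split=> a _; rewrite ?(ag3.1 vL isT) ?(ag3.1 vSz isT).
split=> //.
- by apply: keeps_trans k1 (keeps_trans k2 (keeps_le _ k3)).
- split; rewrite ?(ag3.1 vTl isT) ?(ag3.1 vSz isT) //.
    by rewrite -nl2 /nl (ag3.1 vL isT) (ag3.1 vSz isT).
  by move=> /ok2; apply: keeps_node k3 _.
- split=> //; first by rewrite -es2.
  by move: C3; rewrite ag2 // (ag1.1 vC isT).
- by rewrite G3 ag2 // (ag1.1 vGo isT).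
- move: hT1 hT2 hT3; rewrite sl (ag1.1 vSz isT) -/m /=.
  have : (m <= m * D)%N by rewrite leq_pmulr.
  have : (0 < m * D)%N by rewrite muln_gt0 v0.
  lia.
Qed.

End Node.

(** * Geometry of a node *)

Section Step.
Variables (R : realType) (n D q : nat) (Y : nat -> nat -> R).
Hypotheses (D0 : (0 < D)%N) (q0 : (0 < q)%N).
Hypothesis Yop : forall j, (j < D)%N ->
  exists2 j', (j' < D)%N & forall x, (x < n)%N -> Y x j' = - Y x j.
Implicit Types (s : store R) (l : seq nat).

Local Notation dY := (dY D Y).
Local Notation good_tau := (good_tau D q Y).
Local Notation good_split := (good_split D q Y).

Lemma dY_le x y (t : R) : 0 <= t -> (forall k, (k < D)%N -> Y x k - Y y k <= t) -> dY x y <= t.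
Proof. by move=> t0 h; apply/maxdiff_le. Qed.

Lemma dY_ge x y k : (k < D)%N -> Y x k - Y y k <= dY x y.
Proof. by have /maxdiff_le[_] := lexx (dY x y); apply. Qed.

(** Signed differences are not symmetric one by one; the negated coordinate supplies the opposite
    sign. *)
Lemma dYC x y : (x < n)%N -> (y < n)%N -> dY x y = dY y x.
Proof.
suff h u v : (u < n)%N -> (v < n)%N -> dY u v <= dY v u.
  by move=> xn yn; apply/le_anti/andP; split; apply: h.
move=> un vn; apply: dY_le => [|k kD]; first exact: maxdiff_ge0.
have [k' kD' op] := Yop kD.
have := dY_ge v u kD'; rewrite !op //; lra.
Qed.

Lemma dY_abs x y k : (x < n)%N -> (y < n)%N -> (k < D)%N -> `|Y x k - Y y k| <= dY x y.
Proof.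
move=> xn yn kD; rewrite ler_norml dY_ge // andbT.
by rewrite lerNl opprB dYC // dY_ge.
Qed.

Definition near s (t : R) c x : Prop := (c = x \/ el s c x) /\ dY c x <= t.

(** Two points of a common star: they are joined by at most two edges, each of length at most t. *)
Definition linked s (t : R) x y : Prop :=
  exists c, [/\ (c < n)%N, near s t c x & near s t c y].

Lemma linked_sub s s' t x y : {subset es s <= es s'} -> linked s t x y -> linked s' t x y.
Proof.
by move=> h [c [cn [[e|e] d] [[e'|e'] d']]]; exists c; split=> //; split; auto;
  right; apply: el_sub h _.
Qed.

(** More than half of the points are at or above the anchor a in coordinate j, and more than half at
    or above a' in the negated coordinate. Some point satisfies both, so a + a' <= 0 and only the
    multiples of r remain in t + t'. *)
Lemma good_tau_opposite l j j' (t t' r : R) :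
  all (fun x => x < n)%N l -> (forall x, (x < n)%N -> Y x j' = - Y x j) -> 0 <= r ->
  good_tau l j t r -> good_tau l j' t' r ->
  t + t' <= (2 * kmax R q D) * r /\ t + t' <= (2 * size l)%:R * r.
Proof.
move=> al op r0 [_ [a [k [-> kl km ca]]]] [_ [a' [k' [-> kl' km' ca']]]].
have : has (predI (fun x => a <= Y x j) (fun x => a' <= Y x j')) l.
  rewrite has_count; have := count_predUI (fun x => a <= Y x j) (fun x => a' <= Y x j') l.
  have := count_size (predU (fun x => a <= Y x j) (fun x => a' <= Y x j')) l.
  move=> h1 h2; lia.
move=> /hasP[x xl /= /andP[h1 h2]].
have e := op _ (allP al _ xl).
have kR : k%:R <= (size l)%:R :> R by rewrite ler_nat.
have kR' : k'%:R <= (size l)%:R :> R by rewrite ler_nat.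
rewrite e in h2; rewrite natrM; split; nra.
Qed.

(** A union bound: each coordinate cuts off at most a fraction 1/(2D), hence all D together at most
    half. *)
Lemma outside_half l (t : nat -> R) (r : R) K : (K <= D)%N ->
  (forall k, (k < K)%N -> good_tau l k (t k) r) ->
  (count (fun x => has (fun k => (t k < Y x k)%R) (iota 0 K)) l * (D + D) <= K * size l)%N.
Proof.
elim: K => [|K IH] KD h.
  by rewrite (eq_count (a2 := pred0)) // count_pred0.
have -> : count (fun x => has (fun k => t k < Y x k) (iota 0 K.+1)) l =
  count (predU (fun x => has (fun k => t k < Y x k) (iota 0 K)) (fun x => t K < Y x K)) l.
  by apply: eq_count => x; rewrite has_iotaS.
have h1 := count_predUI (fun x => has (fun k => t k < Y x k) (iota 0 K)) (fun x => t K < Y x K) l.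
have h2 := IH (ltnW KD) (fun k hk => h k (ltnW hk)).
have [h3 _] := h K (ltnSn K); rewrite /cgt in h3.
rewrite mulSn addnC; apply: leq_trans (leq_add h2 h3).
by rewrite -mulnDl leq_mul2r; apply/orP; right; lia.
Qed.

(** In coordinate k, x is at most t_k + r, while the negated coordinate k' bounds y from below by
    -(t_k' + r). The difference is at most t_k + t_k' + 2r, and opposite thresholds nearly
    cancel. *)
Lemma near_box_close l (t : nat -> R) (r : R) x y :
  all (fun x => x < n)%N l -> 0 <= r ->
  (forall k, (k < D)%N -> good_tau l k (t k) r) ->
  (x < n)%N -> (y < n)%N ->
  all (fun k => Y x k <= t k + r) (iota 0 D) -> all (fun k => Y y k <= t k + r) (iota 0 D) ->
  dY x y <= (2 * kmax R q D + 2) * r /\ dY x y <= (2 * size l + 2)%:R * r.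
Proof.
move=> al r0 gt xn yn /allP hx /allP hy.
have H k : (k < D)%N -> Y x k - Y y k <= (2 * kmax R q D + 2) * r /\
    Y x k - Y y k <= (2 * size l + 2)%:R * r.
  move=> kD; have [k' kD' op] := Yop kD.
  have [h1 h2] := good_tau_opposite al op r0 (gt _ kD) (gt _ kD').
  have := hx k; rewrite mem_iota => /(_ kD) h3.
  have := hy k'; rewrite mem_iota => /(_ kD'); rewrite op // => h4.
  by rewrite natrD; split; nra.
have k1 := kmax_ge R q0 D0.
by split; apply: dY_le => [|k /H[] //]; apply: mulr_ge0 => //; lra.
Qed.

Lemma good_tau_perm l l' j (t r : R) : perm_eq l l' -> good_tau l j t r -> good_tau l' j t r.
Proof.
by move=> pe; rewrite /good_tau /cgt -(permP pe) -(perm_size pe) =>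
  -[h [a [k [h1 h2 h3 h4]]]]; split=> //; exists a, k; rewrite -(permP pe).
Qed.

(** What one node achieves for close pairs: such a pair is settled by a star or stays together in a
    new child. Once the queue is empty, every close pair is settled. *)
Definition covered w w' s s' (r : R) (l : seq nat) : Prop :=
  forall x y, x \in l -> y \in l -> x != y -> dY x y <= r ->
    (narr s' vGo 0 = 1%N /\ linked s' ((2 * kmax R q D + 2) * r) x y) \/
    exists u, [/\ (w <= u < w')%N, x \in nl n D s' u 0 & y \in nl n D s' u 0].

(** A raised flag certifies two distinct points at distance O(n r). This keeps the radius from
    falling far below the least distance while the main loop runs. *)
Definition go_sound s s' (r : R) : Prop :=
  narr s' vGo 0 = narr s vGo 0 \/
  (narr s' vGo 0 = 1%N /\ exists x y, [/\ (x < n)%N, (y < n)%N, x != y &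
     dY x y <= (2 * n + 2)%:R * r]).

Definition mass w w' s : R := \sum_(w <= u < w') phi R q (narr s vSz u).

Lemma split_step s v w j :
  let l := nl n D s v 0 in let r := rarr s rR 0 in let m := narr s vSz v in
  static n D q Y s -> edges_ok n D Y s -> narr s vM 0 = m ->
  narr s vHd 0 = v -> narr s vTl 0 = w -> (v < w)%N -> node_ok n D Y s v -> 0 <= r ->
  narr s vSj 0 = j -> (j < D)%N -> good_split (nl n D s v j) j (rarr s rT j) r ->
  wp split_cmd s (fun s' T => exists w',
    [/\ [/\ keeps n D w s s', edges_ok n D Y s', {subset es s <= es s'}, (w <= w')%N & narr s' vTl 0 = w'],
        (forall u, (w <= u < w')%N -> node_ok n D Y s' u), covered w w' s s' r l,
        go_sound s s' r &
        [/\ mass w w' s' + phi R q m / (6 * D%:R * q%:R) <= phi R q m,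
            (narr s' vC 0)%:R + 2 * mass w w' s' <= (narr s vC 0)%:R + 2 * phi R q m &
            (T <= 1500 * (m * D))%N]]).
Proof.
move=> l r m st eok sM sH sT vw ok r0 sJ jD.
have [m0 ul al pl _] := ok; have ml : size l = m by rewrite size_rd.
set t := rarr s rT j; have pj := pl _ jD; rewrite /good_split /cgt !(permP pj) (perm_size pj) -/l ml.
set c := count _ l; set c2 := count _ l => -[h1 h2 h3].
have c2E : (count (fun x => Y x j <= t + r)%R l = m - c2)%N.
  have := cgtE Y l j (t + r); rewrite /cgt -/c2 ml => ->.
  by rewrite subKn // -ml count_size.
have c20 : (0 < c2)%N by case: (c2) h2.
have c2c : (c2 <= c)%N.
  by apply: sub_count => x /=; apply: le_lt_trans; rewrite lerDl.
have A0 : (0 < m - c2)%N by lia.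
apply: wp_use (split_ok D0 st sM sH sT vw ok sJ jD _ _) _.
- by rewrite has_count c2E.
- by rewrite has_count -/c; lia.
move=> s' T ag [kp tl [okw okw1] [nw nw1] hT]; exists w.+2.
have sz u : size (nl n D s' u 0) = narr s' vSz u by rewrite size_rd.
have szw : narr s' vSz w = (m - c2)%N by rewrite -sz nw size_filter c2E.
have szw1 : narr s' vSz w.+1 = c by rewrite -sz nw1 size_filter.
have eE : es s' = es s by rewrite /es (ag.1 1%N isT) (ag.1 2%N isT) (ag.1 vC isT).
have mE : mass w w.+2 s' = phi R q (m - c2) + phi R q c.
  by rewrite /mass big_nat_recl // big_nat1 szw szw1.
have ps := phi_split R q0 D0 (_ : (c2 <= m)%N) h2 h3.
split.
- split=> //; last exact: leq_trans (leqnSn _) (leqnSn _).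
    apply: edges_ok_eq eok; rewrite ?(ag.1 1%N isT) ?(ag.1 2%N isT) ?(ag.1 vC isT) ?(ag.1 vFlag isT) ?(ag.2 1%N isT) //.
  by rewrite eE.
- move=> u /andP[u1 u2]; have : (u == w) || (u == w.+1) by lia.
  by move=> /orP[]/eqP->.
- move=> x y xl yl xy dxy; right.
  have xn := allP al _ xl; have yn := allP al _ yl.
  have := le_trans (dY_abs xn yn jD) dxy; rewrite ler_norml => /andP[d1 d2].
  (* If one point exceeds t + r, the other exceeds t, as they differ by at most r along j: no close
     pair is separated. *)
  have [xA|xA] := leP (Y x j) (t + r); have [yA|yA] := leP (Y y j) (t + r).
  + by exists w; rewrite leqnn ltnS leqnSn nw !mem_filter xA yA xl yl.
  + exists w.+1; rewrite leqnSn ltnSn nw1 !mem_filter xl yl !andbT; split=> //; rewrite -/t; lra.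
  + exists w.+1; rewrite leqnSn ltnSn nw1 !mem_filter xl yl !andbT; split=> //; rewrite -/t; lra.
  + exists w.+1; rewrite leqnSn ltnSn nw1 !mem_filter xl yl !andbT; split=> //; rewrite -/t; lra.
- by left; rewrite (ag.1 vGo isT).
- have c2m : (c2 <= m)%N by lia.
  have p0 : 0 <= phi R q m / (6 * D%:R * q%:R).
    by rewrite divr_ge0 ?phi_ge0 // !mulr_ge0.
  rewrite mE (ag.1 vC isT); split.
  + exact: ps.
  + have := ps c2m; lra.
  + by move: hT; rewrite -/m; lia.
Qed.

(** The child has at most m/2 points, so the potential falls by at least [phi m / 2], hence by at
    least m/2. Twice this pays for the fewer than m star edges, and it exceeds the drop asked of a
    split. *)
Lemma box_step s v w :
  let l := nl n D s v 0 in let r := rarr s rR 0 in let m := narr s vSz v in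
  static n D q Y s -> edges_ok n D Y s -> narr s vM 0 = m ->
  narr s vHd 0 = v -> narr s vTl 0 = w -> (v < w)%N -> node_ok n D Y s v -> 0 <= r ->
  (forall j, (j < D)%N -> good_tau (nl n D s v j) j (rarr s rT j) r) ->
  wp box_cmd s (fun s' T => exists w',
    [/\ [/\ keeps n D w s s', edges_ok n D Y s', {subset es s <= es s'}, (w <= w')%N & narr s' vTl 0 = w'],
        (forall u, (w <= u < w')%N -> node_ok n D Y s' u), covered w w' s s' r l,
        go_sound s s' r &
        [/\ mass w w' s' + phi R q m / (6 * D%:R * q%:R) <= phi R q m,
            (narr s' vC 0)%:R + 2 * mass w w' s' <= (narr s vC 0)%:R + 2 * phi R q m &
            (T <= 1500 * (m * D))%N]]).
Proof.
move=> l r m st eok sM sH sT vw ok r0 gt.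
have [m0 ul al pl _] := ok; have ml : size l = m by rewrite size_rd.
have mn : (m <= n)%N := node_size ok.
have {}gt j : (j < D)%N -> good_tau l j (rarr s rT j) r.
  by move=> jD; apply: good_tau_perm (pl _ jD) (gt _ jD).
apply: wp_use (box_ok D0 st eok sM sH sT vw ok) _.
rewrite -/l; set ch := [seq x <- l | _]; set B := [seq x <- l | _].
move=> s' T ag [kp [tl nw szw okw] [eok' sub Bl C'] G' hT].
have chm : (2 * size ch <= m)%N.
  have := outside_half (leqnn D) gt; rewrite ml size_filter -/(outside _ _ _).
  by rewrite -[X in (X <= _)%N]/(count (outside D Y s) l * _)%N; nia.
have Bm : (size B <= m)%N by rewrite -ml size_filter count_size.
have Bsub x : x \in B -> [/\ x \in l, (x < n)%N & near_box D Y s x].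
  by rewrite mem_filter => /andP[h xl]; rewrite (allP al _ xl).
have close x y : x \in B -> y \in B -> dY x y <= (2 * kmax R q D + 2) * r /\ dY x y <= (2 * m + 2)%:R * r.
  move=> /Bsub[xl xn xB] /Bsub[yl yn yB]; rewrite -ml.
  exact: near_box_close al r0 gt xn yn xB yB.
exists (w + (0 < size ch))%N.
have mass_le : mass w (w + (0 < size ch)) s' <= phi R q (size ch).
  rewrite /mass; case: (posnP (size ch)) => [->|ch0]; rewrite ?ch0.
    by rewrite addn0 big_geq // phi_ge0.
  by rewrite addn1 big_nat1 szw.
have ph := phi_half R q chm.
have dq : phi R q m / (6 * D%:R * q%:R) <= phi R q m / 2.
  apply: ler_wpM2l; first exact: phi_ge0.
  have ? : 1 <= D%:R :> R by rewrite ler1n.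
  have ? : 1 <= q%:R :> R by rewrite ler1n.
  by rewrite lef_pV2 ?posrE; nra.
have pm : m%:R <= phi R q m by apply: phi_ge.
split.
- by split=> //; rewrite leq_addr.
- move=> u /andP[u1 u2]; have [ch0 ->] : (0 < size ch)%N /\ u = w by lia.
  exact: okw.
- move=> x y xl yl xy dxy.
  have xn := allP al _ xl; have yn := allP al _ yl.
  have to_out : outside D Y s x -> outside D Y s y ->
      exists u, [/\ (w <= u < w + (0 < size ch))%N, x \in nl n D s' u 0 & y \in nl n D s' u 0].
    move=> ox oy; exists w; rewrite nw !mem_filter ox oy xl yl; split=> //.
    have : x \in ch by rewrite mem_filter ox.
    by case: (ch) => //= *; rewrite leqnn addn1 ltnSn.
  (* If one point of a close pair lies in the box, the other lies within r of it. So the pair is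
     either wholly outside or wholly inside the neighbourhood. *)
  have nearB z z' : (z < n)%N -> (z' < n)%N -> dY z z' <= r -> ~~ outside D Y s z -> near_box D Y s z'.
    move=> zn zn' d /hasPn nz; apply/allP => k kD; have := nz _ kD; rewrite -leNgt => h.
    move: kD; rewrite mem_iota /= => kD.
    by have := le_trans (dY_abs zn zn' kD) d; rewrite ler_norml => /andP[d1 d2]; rewrite -/r; lra.
  suff hB : ~~ (outside D Y s x && outside D Y s y) -> x \in B /\ y \in B.
    have [/andP[ox oy]|/hB[xB yB]] := boolP (outside D Y s x && outside D Y s y).
      by right; apply: to_out.
    (* Two distinct points in the neighbourhood force a star edge, so the flag is raised whenever a
       pair is settled here. This makes a scale without edges a valid signal to stop. *)
    left; have B1 : (1 < size B)%N.
      rewrite ltnNge; apply/negP => B1; move: xB yB; case: (B) B1 => // z [] // _.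
      by rewrite !inE => /eqP xz /eqP yz; rewrite xz yz eqxx in xy.
    rewrite G' B1; split=> //; exists (head 0%N B).
    have hB' : head 0%N B \in B by case: (B) B1 => // z ? _; rewrite mem_head.
    have nb z : z \in B -> near s' ((2 * kmax R q D + 2) * r) (head 0%N B) z.
      move=> zB; split; last by case: (close _ _ hB' zB).
      by case: (Bl _ zB) => [->|]; [left|right].
    by split; [case: (Bsub _ hB') | apply: nb | apply: nb].
  rewrite negb_and => nxy.
  have dyx : dY y x <= r by rewrite dYC.
  rewrite !mem_filter xl yl !andbT.
  have d0 z : (z < n)%N -> dY z z <= r.
    by move=> zn; apply: dY_le => // k _; rewrite subrr.
  case/orP: nxy => no; split;
    [apply: (nearB x) | apply: (nearB x) | apply: (nearB y) | apply: (nearB y)] => //; exact: d0.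
- rewrite /go_sound G'; case: ltnP => B1; [right; split=> // | by left].
  have [a [b [aB bB ab]]] : exists a b, [/\ a \in B, b \in B & a != b].
    have : uniq B by apply: filter_uniq.
    case: (B) B1 => [|a [|b B']] // _ /= /andP[]; rewrite inE negb_or => /andP[ab _] _.
    by exists a, b; rewrite !inE !eqxx orbT.
  exists a, b; have [_ an _] := Bsub _ aB; have [_ bn _] := Bsub _ bB; split=> //.
  apply: le_trans (proj2 (close _ _ aB bB)) _; apply: ler_wpM2r => //.
  by rewrite ler_nat; lia.
- split; first by lra.
    have : (narr s' vC 0)%:R <= (narr s vC 0)%:R + m%:R :> R.
      by rewrite -natrD ler_nat; apply: leq_trans C' _; rewrite leq_add2l; lia.
    by move=> ?; lra.
  by move: hT; rewrite -/m.
Qed.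

End Step.

(** * One scale *)

Section Scale.
Variables (R : realType) (n D q : nat) (Y : nat -> nat -> R).
Hypotheses (D0 : (0 < D)%N) (q0 : (0 < q)%N) (n0 : (0 < n)%N).
Hypothesis Yop : forall j, (j < D)%N ->
  exists2 j', (j' < D)%N & forall x, (x < n)%N -> Y x j' = - Y x j.
Implicit Types (s : store R) (l : seq nat).

Local Notation dY := (dY D Y).
Local Notation phi := (phi R q).
Local Notation lambda := (2 * kmax R q D + 2).

(** Splits and boxes obey the same inequalities for potential, edges and time, so the queue loop
    need not tell them apart. *)
Lemma node_step s v w :
  let l := nl n D s v 0 in let r := rarr s rR 0 in let m := narr s vSz v in
  static n D q Y s -> edges_ok n D Y s ->
  narr s vHd 0 = v -> narr s vTl 0 = w -> (v < w)%N -> node_ok n D Y s v -> 0 <= r ->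
  wp node_cmd s (fun s' T => exists w',
    [/\ [/\ keeps n D w s s', edges_ok n D Y s', {subset es s <= es s'}, (w <= w')%N &
            narr s' vTl 0 = w' /\ narr s' vHd 0 = v.+1],
        (forall u, (w <= u < w')%N -> node_ok n D Y s' u), covered n D q Y w w' s s' r l,
        go_sound n D Y s s' r &
        [/\ mass q w w' s' + phi m / (6 * D%:R * q%:R) <= phi m,
            (narr s' vC 0)%:R + 2 * mass q w w' s' <= (narr s vC 0)%:R + 2 * phi m &
            (T <= 3000 * (m * D))%N]]).
Proof.
move=> l r m st eok sH sT vw ok r0; have [sN sD sP sY] := st.
have [m0 ul al pl so] := ok; have mn : (m <= n)%N := node_size ok.
do 2 (apply: wp_seq; apply: wp_nset); set s1 := Store _ _.
have n1 a : a \notin [:: vM; vH] -> narr s1 a = narr s a.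
  by rewrite !inE !negb_or => /andP[h1 h2]; rewrite /s1 /= !upd_neq.
have m1 : narr s1 vM 0 = m by rewrite /s1 /= /upd /= sH.
have h1 : narr s1 vH 0 = 0%N by [].
have r1 : rarr s1 = rarr s by [].
clearbody s1.
apply: wp_seq; apply: (@wp_while R _ _ s1 (fun s' => (2 * narr s' vH 0 + 1 <= m)%N)
  (fun s' => (m - narr s' vH 0) * 30)%N); first by rewrite h1.
  move=> s' ag h /=; rewrite (ag.1 vM isT) m1 => g; apply: wp_nset.
  by rewrite /= /upd /=; lia.
move=> s2 T2 ag2 hI; rewrite /= (ag2.1 vM isT) m1 h1 => hg hT2.
have hH : (2 * narr s2 vH 0 + 1 <= m <= 2 * narr s2 vH 0 + 2)%N.
  by rewrite hI /=; move: hg; lia.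
do 2 (apply: wp_seq; apply: wp_nset); set s3 := Store _ _.
have n3 a : a \notin [:: vM; vH; vFound; vJ] -> narr s3 a = narr s a.
  rewrite !inE !negb_or => /and4P[h1' h2' h3' h4']; rewrite /s3 /= !upd_neq //.
  by rewrite ag2.1 ?inE //= n1 // !inE negb_or h1'.
have m3 : narr s3 vM 0 = m by rewrite /s3 /= !upd_neq // ag2.1.
have hH3 : narr s3 vH 0 = narr s2 vH 0 by [].
have f3 : narr s3 vFound 0 = 0%N by [].
have j3 : narr s3 vJ 0 = 0%N by [].
have r3 : rarr s3 = rarr s.
  by rewrite -r1 /s3 /=; apply/funext => a; apply: ag2.2.
clearbody s3.
have scan_keep s' : agree (While (BAnd (BNle (NAdd (NGet vJ (NLit 0)) (NLit 1)) (NGet vD (NLit 0)))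
      (BNle (NAdd (NGet vFound (NLit 0)) (NLit 1)) (NLit 1)))
      (Seq scan_cmd (incr vJ))) s3 s' ->
    [/\ static n D q Y s', forall u j, nl n D s' u j = nl n D s u j,
        [/\ narr s' vM 0 = m, narr s' vHd 0 = v, narr s' vTl 0 = w & narr s' vH 0 = narr s3 vH 0],
        [/\ rarr s' rR = rarr s rR, rarr s' 1 = rarr s 1 & narr s' vGo = narr s vGo] &
        [/\ narr s' 1 = narr s 1, narr s' 2 = narr s 2, narr s' vC = narr s vC, narr s' vFlag = narr s vFlag & narr s' vSz = narr s vSz /\ narr s' vL = narr s vL]].
  move=> ag; split.
  - by apply: static_eq st; rewrite ?(ag.1 vN isT) ?(ag.1 vD isT) ?(ag.1 vPow isT) ?(ag.2 rY isT) ?n3 ?r3.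
  - by move=> u j; rewrite /nl (ag.1 vL isT) (ag.1 vSz isT) !n3.
  - by rewrite (ag.1 vM isT) (ag.1 vHd isT) (ag.1 vTl isT) (ag.1 vH isT) m3 (n3 vHd) // (n3 vTl).
  - by rewrite (ag.2 rR isT) (ag.2 1%N isT) (ag.1 vGo isT) r3 n3.
  - by rewrite (ag.1 1%N isT) (ag.1 2%N isT) (ag.1 vC isT) (ag.1 vFlag isT) (ag.1 vSz isT) (ag.1 vL isT) !n3.
apply: wp_seq; apply: (@wp_while R _ _ s3 (fun s' =>
    (narr s' vJ 0 <= D)%N /\
    ((narr s' vFound 0 = 0%N /\ forall j, (j < narr s' vJ 0)%N -> good_tau D q Y (nl n D s v j) j (rarr s' rT j) r) \/
     [/\ narr s' vFound 0 = 1%N, (narr s' vSj 0 < D)%N &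
      good_split D q Y (nl n D s v (narr s' vSj 0)) (narr s' vSj 0) (rarr s' rT (narr s' vSj 0)) r]))
  (fun s' => (D - narr s' vJ 0) * (800 * m + 40))%N).
- by rewrite j3; split=> //; left.
- move=> s' ag [jD hs]; have [st' nl' [M' H' T' hH'] [rR' r1' go'] [_ _ _ _ [_ eL']]] := scan_keep _ ag.
  rewrite /= => /andP[g1 g2]; case: hs => [[f0 gt]|[f1 _ _]]; last by rewrite f1 in g2.
  have [_ sD' _ _] := st'; rewrite sD' addn1 in g1.
  set j := narr s' vJ 0 in jD gt g1 *.
  have szl : size (nl n D s v j) = m by rewrite size_rd.
  apply: wp_seq; apply: wp_use (@scan_ok R n D q Y s' (nl n D s v j) j st' _ _ g1 q0 _ (so _ g1) _ _ _ _ _ f0) _ => //.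
  + by rewrite M' szl.
  + by rewrite szl H' eL'.
  + by rewrite (perm_all _ (pl _ g1)).
  + by rewrite szl.
  + by rewrite szl.
  + by rewrite rR'.
  + by rewrite szl hH' hH3.
  move=> s4 T4 ag4 [tj sc hT4]; apply: wp_nset.
  rewrite [neval _ _]/= [neval _ (NAdd _ _)]/= (ag4.1 vJ isT) -/j addn1.
  rewrite szl in hT4; split; last first.
    rewrite /= /upd /=; have -> : (D - j = (D - j.+1).+1)%N by lia.
    by rewrite (mulSn (D - j.+1)); move: ((D - j.+1) * _)%N => x; lia.
  rewrite /= /upd /=; split=> //; case: sc => [[f4 gt4]|[f4 sj4 gs4]]; [left|right].
    split=> // j'; rewrite ltnS leq_eqVlt => /orP[/eqP->|lt].
      by rewrite rR' in gt4.
    by rewrite tj ?ltn_eqF //; apply: gt.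
  by rewrite f4 sj4 rR' in gs4 *.
move=> s4 T4 ag4 [jD hs] ng hT4; have [st4 nl4 [M4 H4 T4' _] [rR4 r14 go4] [e1 e2 eC eF [eS eL]]] := scan_keep _ ag4.
have eok4 : edges_ok n D Y s4 by apply: edges_ok_eq eok.
have es4 : es s4 = es s by rewrite /es e1 e2 eC.
have kp4 : keeps n D w s s4 by split=> a _; rewrite ?eS ?eL.
have ok4 := keeps_node D0 kp4 vw ok.
have vf : beval s4 (BNle (NLit 1) (NGet vFound (NLit 0))) = (0 < narr s4 vFound 0)%N by [].
apply: wp_seq; apply: wp_use (_ : wp _ _ (fun s5 T5 => exists w',
    [/\ [/\ keeps n D w s4 s5, edges_ok n D Y s5, {subset es s4 <= es s5}, (w <= w')%N &
            narr s5 vTl 0 = w' /\ narr s5 vHd 0 = v],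
        (forall u, (w <= u < w')%N -> node_ok n D Y s5 u), covered n D q Y w w' s4 s5 r l,
        go_sound n D Y s4 s5 r &
        [/\ mass q w w' s5 + phi m / (6 * D%:R * q%:R) <= phi m,
            (narr s5 vC 0)%:R + 2 * mass q w w' s5 <= (narr s4 vC 0)%:R + 2 * phi m &
            (T5 <= 1510 * (m * D))%N]])) _.
  have mD : (0 < m * D)%N by rewrite muln_gt0 m0.
  apply: wp_if; rewrite vf.
    move=> f0; case: hs => [[f1 _]|[_ sjD gs]]; first by rewrite f1 in f0.
    have := @split_step R n D q Y D0 q0 Yop s4 v w _ st4 eok4 _ H4 T4' vw ok4 _ erefl sjD.
    rewrite !nl4 -/l rR4 -/r eS -/m => H.
    apply: wp_use (H M4 r0 gs) _ => s5 T5 ag5 [w' [[k5 eok5 sub5 le5 tl5] nk5 cv5 gs5 [ms5 ed5 hT5]]].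
    exists w'; split=> //; first by split=> //; rewrite (ag5.1 vHd isT).
    by split=> //; rewrite /=; lia.
  rewrite -eqn0Ngt => /eqP f0; case: hs => [[_ gt]|[f1 _ _]]; last by rewrite f1 in f0.
  have jE : narr s4 vJ 0 = D.
    move: ng; have [_ sD4 _ _] := st4; rewrite /= f0 sD4 andbT addn1 -leqNgt => h.
    by apply/eqP; rewrite eqn_leq jD.
  rewrite jE in gt.
  have := @box_step R n D q Y D0 q0 Yop s4 v w st4 eok4 _ H4 T4' vw ok4.
  rewrite !nl4 -/l rR4 -/r eS -/m => H.
  have gt' j : (j < D)%N -> good_tau D q Y (nl n D s4 v j) j (rarr s4 rT j) r.
    by move=> jD'; rewrite nl4; apply: gt.
  apply: wp_use (H M4 r0 gt') _ => s5 T5 ag5 [w' [[k5 eok5 sub5 le5 tl5] nk5 cv5 gs5 [ms5 ed5 hT5]]].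
  exists w'; split=> //; first by split=> //; rewrite (ag5.1 vHd isT).
  by split=> //; rewrite /=; lia.
move=> s5 T5 _ [w' [[k5 eok5 sub5 le5 [tl5 hd5]] nk5 cv5 gs5 [ms5 ed5 hT5]]].
apply: wp_nset; rewrite [neval _ (NLit 0)]/= [neval _ (NAdd _ _)]/= hd5 addn1.
set s6 := Store _ _; exists w'.
have n6 a : a != vHd -> narr s6 a = narr s5 a by move=> h; rewrite /s6 /= upd_neq.
have r6 : rarr s6 = rarr s5 by [].
have h6 : narr s6 vHd 0 = v.+1 by [].
clearbody s6.
have es6 : es s6 = es s5 by rewrite /es !n6.
have nl6 u j : nl n D s6 u j = nl n D s5 u j by rewrite /nl !n6.
have k56 x : keeps n D x s5 s6 by split=> a _; rewrite n6.
split.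
- split=> //.
  + exact: keeps_trans kp4 (keeps_trans k5 (k56 _)).
  + by apply: edges_ok_eq eok5; rewrite ?n6 ?r6.
  + by move=> e; rewrite es6 -es4 => /sub5.
  + by rewrite n6.
- by move=> u hu; apply: (keeps_node D0 (k56 u.+1)) => //; apply: nk5.
- move=> x y xl yl xy d; case: (cv5 x y xl yl xy d) => [[g ln]|[u [u1 u2 u3]]].
    left; rewrite n6 //; split=> //; apply: linked_sub ln.
    by rewrite es6.
  by right; exists u; rewrite !nl6.
- by move: gs5; rewrite /go_sound n6 // go4.
- have ms : mass q w w' s6 = mass q w w' s5 by rewrite /mass n6.
  rewrite ms n6 // -eC; split=> //.
  have hm : (m <= m * D)%N by rewrite leq_pmulr.
  have hD : (D <= m * D)%N by rewrite leq_pmull.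
  have mD : (0 < m * D)%N by rewrite muln_gt0 m0.
  move: hT2 hT4; rewrite j3 subn0 /= => hT2 hT4.
  lia.
Qed.

(** Children are written from slot 1 on, so the sorted lists of the whole set in slot 0 survive a
    scale and the next one starts from them. *)
Definition root_ok s : Prop := forall j, (j < D)%N ->
  let l := rd (narr s vL) (j * n) n in
  perm_eq l (iota 0 n) /\ sorted (keyle (crd Y j)) l.

Lemma root_node s : root_ok s -> narr s vSz 0 = n -> node_ok n D Y s 0.
Proof.
move=> rt sz; have [p0 _] := rt 0%N D0; rewrite mul0n in p0.
split; rewrite ?sz // /nl sz ?mul0n ?add0n ?mul0n.
- by rewrite (perm_uniq p0) iota_uniq.
- by rewrite (perm_all _ p0); apply/allP => x; rewrite mem_iota.
- move=> j jD; rewrite add0n; have [pj _] := rt j jD.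
  by rewrite (perm_trans pj) // perm_sym.
- by move=> j jD; rewrite add0n; have [] := rt j jD.
Qed.

Lemma massS s v w : (v < w)%N -> mass q v w s = phi (narr s vSz v) + mass q v.+1 w s :> R.
Proof. by move=> vw; rewrite /mass big_ltn. Qed.

Lemma mass_cat s u v w : (u <= v)%N -> (v <= w)%N ->
  mass q u w s = mass q u v s + mass q v w s :> R.
Proof. by move=> uv vw; rewrite /mass (big_cat_nat uv vw). Qed.

Lemma mass_keep s s' v w : keeps n D w s s' -> mass q v w s' = mass q v w s :> R.
Proof.
by move=> [_ h]; rewrite /mass; apply: eq_big_nat => u /andP[_ uw]; rewrite h.
Qed.

Lemma mass_ge0 s v w : 0 <= mass q v w s :> R.
Proof. by apply: sumr_ge0 => u _; apply: phi_ge0. Qed.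

(** The 3000 units of [node_step] per point and coordinate, and 10 to cover the test of the queue
    loop. *)
Definition node_cost : nat := 3010.

(** The total potential of the queue starts at [phi n]. Time is charged to its decrease, and the
    number of edges plus twice the remaining potential never grows. *)
Lemma scale_ok s :
  let r := rarr s rR 0 in
  static n D q Y s -> root_ok s -> edges_ok n D Y s -> 0 <= r ->
  wp scale_cmd s (fun s' T =>
    [/\ [/\ static n D q Y s', root_ok s', edges_ok n D Y s', {subset es s <= es s'} &
          rarr s' rR 0 = r / 2],
        forall x y, (x < n)%N -> (y < n)%N -> x != y -> dY x y <= r ->
          narr s' vGo 0 = 1%N /\ linked n D Y s' (lambda * r) x y,
        narr s' vGo 0 = 0%N \/ (narr s' vGo 0 = 1%N /\
          exists x y, [/\ (x < n)%N, (y < n)%N, x != y & dY x y <= (2 * n + 2)%:R * r]),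
        (narr s' vC 0)%:R <= (narr s vC 0)%:R + 2 * phi n &
        T%:R <= (6 * D * q * (node_cost * D))%:R * phi n + 60]).
Proof.
move=> r st rt eok r0; have [sN sD sP sY] := st.
do 4 (apply: wp_seq; apply: wp_nset); set s1 := Store _ _.
have n1 a : a \notin [:: vGo; vHd; vTl; vSz] -> narr s1 a = narr s a.
  by rewrite !inE !negb_or => /and4P[h1 h2 h3 h4]; rewrite /s1 /= !upd_neq.
have g1 : narr s1 vGo 0 = 0%N by [].
have h1 : narr s1 vHd 0 = 0%N by [].
have t1 : narr s1 vTl 0 = 1%N by [].
have z1 : narr s1 vSz 0 = n by rewrite /s1 /= /upd /= sN.
have r1 : rarr s1 = rarr s by [].
clearbody s1.
have st1 : static n D q Y s1 by apply: static_eq st; rewrite ?n1 ?r1.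
have rt1 : root_ok s1 by move=> j jD; rewrite n1 //; apply: rt.
have eok1 : edges_ok n D Y s1 by apply: edges_ok_eq eok; rewrite ?n1 ?r1.
have es1 : es s1 = es s by rewrite /es !n1.
have ok0 := root_node rt1 z1.
pose W : R := (6 * D * q * (node_cost * D))%:R.
have W0 : 0 <= W by apply: ler0n.
apply: wp_seq; apply: (@wp_whileR R _ _ s1 (fun s' =>
    [/\ [/\ (narr s' vHd 0 <= narr s' vTl 0)%N, (0 < narr s' vTl 0)%N, keeps n D 1 s1 s',
            edges_ok n D Y s' & {subset es s <= es s'}],
        (forall u, (narr s' vHd 0 <= u < narr s' vTl 0)%N -> node_ok n D Y s' u),
        covered n D q Y (narr s' vHd 0) (narr s' vTl 0) s s' r (iota 0 n),
        narr s' vGo 0 = 0%N \/ (narr s' vGo 0 = 1%N /\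
          exists x y, [/\ (x < n)%N, (y < n)%N, x != y & dY x y <= (2 * n + 2)%:R * r]) &
        (narr s' vC 0)%:R + 2 * mass q (narr s' vHd 0) (narr s' vTl 0) s' <= (narr s vC 0)%:R + 2 * phi n])
    (fun s' => W * mass q (narr s' vHd 0) (narr s' vTl 0) s')).
- rewrite h1 t1; split=> //.
  + by split=> // e; rewrite es1.
  + by move=> u; rewrite leq0n ltnS leqn0 => /eqP->.
  + move=> x y xn yn _ _; right; exists 0%N; split=> //.
      by rewrite /nl mul0n add0n z1; have [p0 _] := rt1 0%N D0; rewrite (perm_mem p0).
    by rewrite /nl mul0n add0n z1; have [p0 _] := rt1 0%N D0; rewrite (perm_mem p0).
  + by left.
  + by rewrite /mass big_nat1 z1 n1.
- by move=> s' _ _; rewrite mulr_ge0 // mass_ge0.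
- move=> s' ag [[vw w0 k' eok' sub'] nk cv gs ed] g.
  have {g} vw' : (narr s' vHd 0 < narr s' vTl 0)%N by move: g; rewrite /= addn1.
  set v := narr s' vHd 0 in vw vw' nk cv ed *; set w := narr s' vTl 0 in vw vw' w0 nk cv ed *.
  have rE : rarr s' rR 0 = r by rewrite (ag.2 rR isT) r1.
  have st' : static n D q Y s'.
    by apply: static_eq st1; rewrite ?(ag.1 vN isT) ?(ag.1 vD isT) ?(ag.1 vPow isT) ?(ag.2 rY isT).
  have okv : node_ok n D Y s' v by apply: nk; rewrite leqnn vw'.
  have [m0 _ _ _ _] := okv; set m := narr s' vSz v in m0.
  apply: wp_use (@node_step s' v w st' eok' erefl erefl vw' okv _) _; rewrite rE // -/m.
  move=> s2 T2 _ [w' [[k2 eok2 sub2 ww' [tl2 hd2]] nk2 cv2 gs2 [ms2 ed2 hT2]]].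
  have mE : mass q v w s' = phi m + mass q v.+1 w s' by rewrite massS.
  have mE2 : mass q v.+1 w' s2 = mass q v.+1 w s' + mass q w w' s2.
    by rewrite (mass_cat _ (_ : v.+1 <= w)%N ww') // (mass_keep _ k2).
  rewrite hd2 tl2; split.
    split.
    + split=> //; [exact: leq_trans vw' ww'|exact: leq_trans ww'| |].
        by apply: keeps_trans k' (keeps_le w0 k2).
      by move=> e /sub' /sub2.
    + move=> u /andP[u1 u2]; have [uw|wu] := ltnP u w.
        by apply: (keeps_node D0 k2 uw); apply: nk; rewrite uw ltnW.
      by apply: nk2; rewrite wu u2.
    + move=> x y xn yn xy d.
      have goK : narr s' vGo 0 = 1%N -> narr s2 vGo 0 = 1%N by case: gs2 => [->|[]].
      case: (cv x y xn yn xy d) => [[g l]|[u [/andP[u1 u2] xu yu]]].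
        by left; split; [apply: goK | apply: linked_sub l].
      have [uv|vu] := eqVneq u v.
        rewrite uv in xu yu; case: (cv2 x y xu yu xy d) => [?|[u' [/andP[a b] c e]]]; first by left.
        by right; exists u'; split=> //; rewrite b andbT (leq_trans vw').
      have oku : node_ok n D Y s' u by apply: nk; rewrite u1.
      right; exists u; rewrite !(keeps_nl D0 k2) ?(node_size oku) // (leq_trans u2 ww') andbT.
      by rewrite ltn_neqAle eq_sym vu.
    + by case: gs2 => [->|]; [| right].
    + rewrite mE2; move: ed; rewrite mE; lra.
  rewrite mE2 mE.
  (* The potential drops by at least [phi m] / (6Dq) >= m / (6Dq); multiplied by 6Dq it pays for the
     time of the node, which is linear in m. *)
  have : (6 * D%:R * q%:R) * (phi m - mass q w w' s2) >= m%:R.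
    apply: le_trans (phi_ge R q m0) _; rewrite mulrC -ler_pdivrMr.
      by rewrite lerBrDl; move: ms2; lra.
    by rewrite !mulr_gt0 ?ltr0n.
  move=> hg; have {hg} : (node_cost * D)%:R * m%:R <= W * (phi m - mass q w w' s2).
    have -> : W = (node_cost * D)%:R * (6 * D%:R * q%:R).
      by rewrite /W mulnC natrM; congr (_ * _); rewrite !natrM.
    by rewrite -mulrA; apply: ler_wpM2l.
  have : (bcost (BNle (NAdd (NGet vHd (NLit 0)) (NLit 1)) (NGet vTl (NLit 0))) + T2).+1%:R <= (node_cost * D)%:R * m%:R :> R.
    rewrite -!natrM ler_nat /node_cost /=; have : (0 < m * D)%N by rewrite muln_gt0 m0.
    by lia.
  by rewrite !mulrDr mulrN; move: (W * phi m) (W * mass q w w' s2) (W * _) => a b c; lra.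
move=> s2 T2 ag2 [[vw w0 k2 eok2 sub2] nk cv gs ed] ng hT2.
have vw' : (narr s2 vTl 0 <= narr s2 vHd 0)%N by move: ng; rewrite /= addn1 -leqNgt.
rewrite /mass big_geq // mulr0 addr0 in ed.
apply: wp_rset; set s3 := Store _ _.
have r3 : rarr s3 rR 0 = r / 2 by rewrite /s3 /= /upd /= (ag2.2 rR isT) r1.
have n3 : narr s3 = narr s2 by [].
have r3n a : a != rR -> rarr s3 a = rarr s2 a by move=> h; rewrite /s3 /= upd_neq.
clearbody s3.
have es3 : es s3 = es s2 by rewrite /es n3.
split.
- split=> //.
  + apply: static_eq st1; rewrite ?n3 ?r3n //;
      by rewrite ?(ag2.1 vN isT) ?(ag2.1 vD isT) ?(ag2.1 vPow isT) ?(ag2.2 rY isT).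
  + move=> j jD; rewrite n3 (_ : rd _ _ _ = rd (narr s1 vL) (j * n) n); first exact: rt1.
    by apply: eq_rd => i hi; rewrite k2.1 // mul1n; apply: addr_lt.
  + by apply: edges_ok_eq eok2; rewrite ?n3 ?r3n.
  + by rewrite es3.
- move=> x y xn yn xy d; rewrite n3.
  case: (cv x y _ _ xy d); rewrite ?mem_iota // => -[].
    by move=> g l; split=> //; apply: linked_sub l; rewrite es3.
  by move=> u [/andP[u1 u2] _ _]; move: (leq_ltn_trans u1 u2); rewrite ltnNge vw'.
- by rewrite n3.
- by rewrite n3.
- move: hT2; rewrite h1 t1 /mass big_nat1 z1 -/W => hT2.
  have b8 : (bcost (BNle (NAdd (NGet vHd (NLit 0)) (NLit 1)) (NGet vTl (NLit 0)))).+1%:R <= 20 :> R.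
    by rewrite ler_nat.
  apply: le_trans (_ : T2%:R + 40 <= _); last by lra.
  by rewrite -natrD ler_nat /=; lia.
Qed.

End Scale.

(** * Merge sort *)

Lemma merge_nil (T : Type) (e : rel T) l : path.merge e l [::] = l.
Proof. by case: l. Qed.

Section Sort.
Variables (R : realType) (n D q : nat) (Y : nat -> nat -> R).
Hypotheses (D0 : (0 < D)%N) (n0 : (0 < n)%N).
Implicit Types (s : store R) (l : seq nat).

Definition rn s u : seq nat := rd (narr s vRun) (u * n) (narr s vRsz u).

Local Notation le j := (keyle (crd Y j)).

(** The loop invariant says that the output followed by the library merge of the unread parts is the
    merge of the two runs. Sortedness and permutation then come from the library. *)
Lemma merge_ok s j h t :
  static n D q Y s -> narr s vJ 0 = j -> (j < D)%N ->
  narr s vRh 0 = h -> narr s vRt 0 = t -> (h.+1 < t)%N ->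
  all (fun x => x < n)%N (rn s h) -> all (fun x => x < n)%N (rn s h.+1) ->
  (narr s vRsz h + narr s vRsz h.+1 <= n)%N ->
  wp merge_cmd s (fun s' T =>
    [/\ rn s' t = path.merge (le j) (rn s h) (rn s h.+1),
        forall a, (a < t * n)%N -> narr s' vRun a = narr s vRun a,
        forall u, narr s' vRsz u = if u == t then (narr s vRsz h + narr s vRsz h.+1)%N
                                   else narr s vRsz u &
        (T <= 200 * (narr s vRsz h + narr s vRsz h.+1) + 60)%N]).
Proof.
move=> [sN sD _ sY] sJ jD sh stt ht al1 al2 szn.
set m1 := narr s vRsz h in szn *; set m2 := narr s vRsz h.+1 in szn *.
set l1 := rn s h in al1 *; set l2 := rn s h.+1 in al2 *.
have sz1 : size l1 = m1 by rewrite size_rd.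
have sz2 : size l2 = m2 by rewrite size_rd.
do 3 (apply: wp_seq; apply: wp_nset); set s1 := Store _ _.
have n1 a : a \notin [:: vA; vB; vE] -> narr s1 a = narr s a.
  by rewrite !inE !negb_or => /and3P[h1 h2 h3]; rewrite /s1 /= !upd_neq.
have A1 : narr s1 vA 0 = 0%N by [].
have B1 : narr s1 vB 0 = 0%N by [].
have E1 : narr s1 vE 0 = (m1 + m2)%N by rewrite /s1 /= /upd /= sh addn1.
have r1 : rarr s1 = rarr s by [].
clearbody s1.
apply: wp_seq; apply: (@wp_for R vI _ _ s1 (m1 + m2) 150 (fun i s' =>
  [/\ (narr s' vA 0 <= m1)%N, (narr s' vB 0 <= m2)%N, (narr s' vA 0 + narr s' vB 0)%N = i,
      forall a, (a < t * n)%N -> narr s' vRun a = narr s vRun a &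
      rd (narr s' vRun) (t * n) i ++ path.merge (le j) (drop (narr s' vA 0) l1) (drop (narr s' vB 0) l2)
        = path.merge (le j) l1 l2])) => //.
- by move=> s' ag; rewrite /= (ag.1 vE isT).
- rewrite /= !upd_neq // A1 B1; split=> //; first by move=> a _; rewrite n1.
  by rewrite !drop0.
- move=> i s2 im s2I ag2 [I1 I2 I3 I4 I5].
  set a := narr s2 vA 0 in I1 I3 I5 *; set b := narr s2 vB 0 in I2 I3 I5 *.
  have m2E a' : a' \notin [:: vI; vA; vB; vRun; vE] -> narr s2 a' = narr s a'.
    rewrite !inE !negb_or => /and5P[h1 h2 h3 h4 h5].
    by rewrite ag2.1 ?n1 //= !inE !negb_or ?h1 ?h2 ?h3 ?h4 ?h5.
  have r2 : rarr s2 = rarr s by rewrite -r1; apply/funext => x; apply: ag2.2.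
  have rdA : (a < m1)%N -> narr s2 vRun (h * n + a)%N = nth 0%N l1 a.
    move=> am; rewrite I4 ?nth_rd //.
    by apply: addr_lt; lia.
  have rdB : (b < m2)%N -> narr s2 vRun (h.+1 * n + b)%N = nth 0%N l2 b.
    move=> bm; rewrite I4 ?nth_rd //.
    by apply: addr_lt; lia.
  have keyA : (a < m1)%N -> reval s2 (Yat (run (NGet vRh (NLit 0)) (NGet vA (NLit 0))) (NGet vJ (NLit 0))) = Y (nth 0%N l1 a) j.
    move=> am; rewrite /= !(m2E vRh) // !(m2E vN) // !(m2E vD) // !(m2E vJ) // sh sN sD sJ r2.
    by rewrite rdA // sY //; apply: (allP al1); apply: mem_nth; rewrite sz1.
  have keyB : (b < m2)%N -> reval s2 (Yat (run (NAdd (NGet vRh (NLit 0)) (NLit 1)) (NGet vB (NLit 0))) (NGet vJ (NLit 0))) = Y (nth 0%N l2 b) j.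
    move=> bm; rewrite /= !(m2E vRh) // !(m2E vN) // !(m2E vD) // !(m2E vJ) // sh sN sD sJ r2 addn1.
    by rewrite rdB // sY //; apply: (allP al2); apply: mem_nth; rewrite sz2.
  have mstep (x : nat) (s3 : store R) :
      (forall p, narr s3 vRun p = if p == (t * n + i)%N then x else narr s2 vRun p) ->
      (forall p, (p < t * n)%N -> narr s3 vRun p = narr s vRun p) /\
      rd (narr s3 vRun) (t * n) i.+1 = rcons (rd (narr s2 vRun) (t * n) i) x.
    move=> h3; split=> [p hp|]; first by rewrite h3 I4 //; case: eqP hp => // -> ; lia.
    rewrite rdS h3 eqxx; congr rcons; apply: eq_rd => k hk.
    by rewrite h3 eqn_add2l ltn_eqF.
  pose cnd := (a < m1)%N && ~~ ((b < m2)%N && ~~ (Y (nth 0%N l1 a) j <= Y (nth 0%N l2 b) j)).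
  have e1 : beval s2 (BNle (NAdd (NGet vA (NLit 0)) (NLit 1)) (NGet vRsz (NGet vRh (NLit 0)))) = (a < m1)%N.
    by rewrite /= !(m2E vRsz) // !(m2E vRh) // sh addn1.
  have e2 : beval s2 (BNle (NAdd (NGet vB (NLit 0)) (NLit 1)) (NGet vRsz (NAdd (NGet vRh (NLit 0)) (NLit 1)))) = (b < m2)%N.
    by rewrite /= !(m2E vRsz) // !(m2E vRh) // sh !addn1.
  set bc := BAnd _ _.
  have cE : beval s2 bc = cnd.
    have bA c1 c2 : beval s2 (BAnd c1 c2) = beval s2 c1 && beval s2 c2 by [].
    have bN c : beval s2 (BNot c) = ~~ beval s2 c by [].
    have bR x y : beval s2 (BRle x y) = (reval s2 x <= reval s2 y) by [].
    rewrite /bc !bA !bN !bA !bN bR e1 e2 /cnd.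
    (* The guard also compares keys when a run is exhausted; the keys are identified only where both
       runs have a next element, since elsewhere the comparison cannot affect the outcome. *)
    by case: ltnP => // am; case: ltnP => // bm; rewrite keyA // keyB.
  apply: wp_if; rewrite cE.
  + move=> /andP[am cb].
    apply: wp_seq; apply: wp_nset; apply: wp_nset.
    rewrite [neval _ (NAdd (NMul _ _) _)](_ : _ = (t * n + i)%N); last first.
      by rewrite /= !(m2E vRt) // !(m2E vN) // stt sN s2I.
    rewrite [neval _ (run _ _)](_ : _ = nth 0%N l1 a); last first.
      by rewrite /= !(m2E vRh) // !(m2E vN) // sh sN rdA.
    rewrite [neval _ (NLit 0)]/= [neval _ (NAdd _ _)](_ : _ = a.+1); last by rewrite /= upd_neq // addn1.
    split=> //; set s3 := Store _ _.
    have A3 : narr s3 vA 0 = a.+1 by [].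
    have B3 : narr s3 vB 0 = b by [].
    have h3 p : narr s3 vRun p = if p == (t * n + i)%N then nth 0%N l1 a else narr s2 vRun p.
      by rewrite /s3 /= upd_neq // upd_neq // upd_at.
    have [p1 p2] := mstep _ _ h3.
    rewrite A3 B3; split=> //; first by rewrite addSn I3.
    rewrite p2 -cats1 -catA -I5; congr (_ ++ _).
    rewrite (drop_nth 0%N (_ : a < size l1)%N) ?sz1 // cat1s.
    have [bm|bm] := ltnP b m2; last by rewrite (@drop_oversize _ b l2) ?sz2 // !merge_nil.
    rewrite (drop_nth 0%N (_ : b < size l2)%N) ?sz2 // /=.
    by move: cb; rewrite bm /= negbK /keyle /crd => ->.
  + rewrite negb_and negbK => nc.
    have bm : (b < m2)%N.
      case/orP: nc => [|/andP[]//]; rewrite -leqNgt => am; lia.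
    apply: wp_seq; apply: wp_nset; apply: wp_nset.
    rewrite [neval _ (NAdd (NMul _ _) _)](_ : _ = (t * n + i)%N); last first.
      by rewrite /= !(m2E vRt) // !(m2E vN) // stt sN s2I.
    rewrite [neval _ (run _ _)](_ : _ = nth 0%N l2 b); last first.
      by rewrite /= !(m2E vRh) // !(m2E vN) // sh sN addn1 rdB.
    rewrite [neval _ (NLit 0)]/= [neval _ (NAdd _ _)](_ : _ = b.+1); last by rewrite /= upd_neq // addn1.
    split=> //; set s3 := Store _ _.
    have A3 : narr s3 vA 0 = a by [].
    have B3 : narr s3 vB 0 = b.+1 by [].
    have h3 p : narr s3 vRun p = if p == (t * n + i)%N then nth 0%N l2 b else narr s2 vRun p.
      by rewrite /s3 /= upd_neq // upd_neq // upd_at.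
    have [p1 p2] := mstep _ _ h3.
    rewrite A3 B3; split=> //; first by rewrite addnS I3.
    rewrite p2 -cats1 -catA -I5; congr (_ ++ _).
    rewrite (drop_nth 0%N (_ : b < size l2)%N) ?sz2 // cat1s.
    have [am|am] := ltnP a m1; last by rewrite (@drop_oversize _ a l1) ?sz1.
    rewrite (drop_nth 0%N (_ : a < size l1)%N) ?sz1 // /=.
    by move: nc; rewrite am bm /= /keyle /crd => /negbTE ->.
move=> s2 T2 ag2 [I1 I2 I3 I4 I5] hT2; apply: wp_nset; set s3 := Store _ _.
have z3 u : narr s3 vRsz u = if u == t then (m1 + m2)%N else narr s vRsz u.
  by rewrite /s3 /= upd_at /= (ag2.1 vRt isT) n1 // stt (ag2.1 vE isT) E1 (ag2.1 vRsz isT) n1.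
have u3 : narr s3 vRun = narr s2 vRun by rewrite /s3 /= upd_neq.
split.
- rewrite /rn z3 eqxx u3; move: I5.
  have -> : narr s2 vA 0 = m1 by lia.
  have -> : narr s2 vB 0 = m2 by lia.
  have -> : drop m1 l1 = [::] by rewrite -sz1 drop_size.
  have -> : drop m2 l2 = [::] by rewrite -sz2 drop_size.
  by rewrite cats0.
- by move=> a ha; rewrite u3 I4.
- exact: z3.
- by move: hT2; rewrite /=; lia.
Qed.

Definition runs s h t : seq nat := flatten [seq rn s u | u <- iota h (t - h)].

(** A permutation rather than an equality: every merge moves elements from the head of the queue to
    its tail. *)
Definition runs_ok s h t j : Prop :=
  perm_eq (runs s h t) (iota 0 n) /\
  forall u, (h <= u < t)%N -> sorted (le j) (rn s u).

Lemma runs_cons s h t : (h < t)%N -> runs s h t = rn s h ++ runs s h.+1 t.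
Proof. by move=> ht; rewrite /runs -[(t - h)%N]prednK ?subn_gt0 //= subnS. Qed.

Lemma runs_rcons s h t : (h <= t)%N -> runs s h t.+1 = runs s h t ++ rn s t.
Proof.
by move=> ht; rewrite /runs subSn // -addn1 iotaD map_cat flatten_cat /= cats0 subnKC.
Qed.

(** A run is a block of a permutation of n indices, so it fits into its n cells and neighbouring
    runs do not overlap. *)
Lemma runs_size s h t j u : runs_ok s h t j -> (h <= u < t)%N ->
  (narr s vRsz u <= n)%N /\ all (fun x => x < n)%N (rn s u).
Proof.
move=> [pe _] /andP[hu ut].
have sub : {subset rn s u <= runs s h t}.
  move=> x xu; apply/flattenP; exists (rn s u) => //; apply/mapP; exists u => //.
  by rewrite mem_iota hu subnKC // ltnW // (leq_ltn_trans hu).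
split; last by apply/allP => x /sub; rewrite (perm_mem pe) mem_iota.
rewrite -(size_rd (narr s vRun) (u * n) (narr s vRsz u)) -/(rn s u) -(size_iota 0 n) -(perm_size pe).
rewrite /runs size_flatten /shape -map_comp -[X in (X <= _)%N]/((size \o rn s) u).
have /path.splitPr[p1 p2] : u \in iota h (t - h).
  by rewrite mem_iota hu subnKC // ltnW // (leq_ltn_trans hu).
by rewrite map_cat sumn_cat /=; lia.
Qed.

Lemma merge_step s s' h t j :
  (h.+1 < t)%N -> runs_ok s h t j ->
  rn s' t = path.merge (le j) (rn s h) (rn s h.+1) ->
  (forall a, (a < t * n)%N -> narr s' vRun a = narr s vRun a) ->
  (forall u, u != t -> narr s' vRsz u = narr s vRsz u) ->
  runs_ok s' h.+2 t.+1 j.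
Proof.
move=> ht ok rt low sz; have [pe so] := ok.
have keep u : (h <= u < t)%N -> rn s' u = rn s u.
  move=> hu; have [zu _] := runs_size ok hu; move/andP: hu => [_ ut].
  rewrite /rn sz ?ltn_eqF //; apply: eq_rd => i hi; apply: low.
  by apply: addr_lt => //; apply: leq_trans zu.
have rk : runs s' h.+2 t = runs s h.+2 t.
  rewrite /runs; congr flatten; apply/eq_in_map => u; rewrite mem_iota => hu.
  by apply: keep; lia.
split.
  apply: perm_trans pe; rewrite runs_rcons // rk rt (runs_cons _ (ltnW ht)) (runs_cons _ ht) catA.
  by rewrite perm_catC perm_cat2r perm_merge.
move=> u /andP[u1]; rewrite ltnS leq_eqVlt => /orP[/eqP->|u2].
  rewrite rt merge_sorted ?so ?leqnn ?leqnSn ?(ltnW ht) //.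
  by apply: keyle_total.
by rewrite keep; [apply: so|]; rewrite u2 andbT; lia.
Qed.

(** A pass halves the number of runs. It costs O(1) per element and per run, hence O(n), as there
    are at most 2n runs; k passes leave a single run. *)
Lemma sort1_ok s j k :
  static n D q Y s -> narr s vJ 0 = j -> (j < D)%N ->
  narr s vP 0 = (2 ^ k)%N -> (n <= 2 ^ k <= 2 * n)%N ->
  wp sort1_cmd s (fun s' T =>
    [/\ forall a, (a < j * n)%N -> narr s' vL a = narr s vL a,
        let l := rd (narr s' vL) (j * n) n in
        perm_eq l (iota 0 n) /\ sorted (le j) l &
        (T <= 1500 * (n * k.+1))%N]).
Proof.
move=> st sJ jD sP /andP[Pn P2]; have [sN sD _ sY] := st.
apply: wp_seq; apply: (@wp_for R vI _ _ s (2 ^ k) 40 (fun i s' =>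
   forall u, (u < i)%N -> narr s' vRun (u * n)%N = u /\ narr s' vRsz u = (u < n)%N)) => //.
- by move=> s' ag; rewrite /= (ag.1 vP isT).
- move=> i s1 ik s1I ag1 I1.
  apply: wp_seq; apply: wp_nset; apply: wp_nset; split=> //.
  have N1 : narr s1 vN 0 = n by rewrite (ag1.1 vN isT).
  move=> u; rewrite ltnS => ui; rewrite /= /upd /= s1I N1 eqn_mul2r (gtn_eqF n0) /=.
  case: (eqVneq u i) => [->|ne]; last by apply: I1; rewrite ltn_neqAle ne.
  by split=> //; case: ltnP => ?; lia.
move=> s1 T1 ag1 I1 hT1.
do 2 (apply: wp_seq; apply: wp_nset); set s2 := Store _ _.
have n2 a : a \notin [:: vRh; vRt] -> narr s2 a = narr s1 a.
  by rewrite !inE !negb_or => /andP[h1 h2]; rewrite /s2 /= !upd_neq.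
have H2 : narr s2 vRh 0 = 0%N by [].
have Tl2 : narr s2 vRt 0 = (2 ^ k)%N by rewrite /s2 /= /upd /= (ag1.1 vP isT).
have r2 : rarr s2 = rarr s by apply/funext => a; apply: ag1.2.
clearbody s2.
have m2 a : a \notin [:: vRh; vRt; vI; vRun; vRsz] -> narr s2 a = narr s a.
  rewrite !inE !negb_or => /and5P[h1 h2 h3 h4 h5].
  by rewrite n2 ?inE ?negb_or ?h1 ?h2 // ag1.1 //= !inE !negb_or ?h3 ?h4 ?h5.
have rn2 u : (u < 2 ^ k)%N -> rn s2 u = if (u < n)%N then [:: u] else [::].
  move=> uk; have [e1 e2] := I1 _ uk; rewrite /rn !n2 // e2.
  by case: ifP => // _; rewrite /rd /mkseq /= addn0 e1.
have ok2 : runs_ok s2 0 (2 ^ k) j.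
  split; last by move=> u /andP[_ uk]; rewrite rn2 //; case: ifP.
  rewrite /runs subn0 (_ : flatten _ = iota 0 n) // -(subnKC Pn) iotaD map_cat flatten_cat.
  rewrite (_ : flatten [seq rn s2 i | i <- iota (0 + n) _] = [::]) ?cats0.
    rewrite (_ : map _ _ = map (fun u => [:: u]) (iota 0 n)) ?flatten_seq1 //.
    apply/eq_in_map => u; rewrite mem_iota add0n => /andP[_ un].
    by rewrite rn2 ?un // (leq_trans un).
  rewrite (_ : map _ _ = map (fun _ => [::]) (iota (0 + n) (2 ^ k - n))).
    by elim: (iota _ _).
  apply/eq_in_map => u; rewrite mem_iota add0n subnKC // => /andP[un uk].
  by rewrite rn2 // ltnNge un.
have st2 : static n D q Y s2 by apply: static_eq st; rewrite ?m2 ?r2.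
apply: wp_seq; apply: (@wp_while R _ _ s2 (fun s' => exists i h,
    [/\ narr s' vRh 0 = h, narr s' vRt 0 = (h + 2 ^ i)%N, (i <= k)%N & runs_ok s' h (h + 2 ^ i) j])
   (* Between passes the queue length is a power of two, and its logarithm is the number of passes
      left. *)
   (fun s' => trunc_log 2 (narr s' vRt 0 - narr s' vRh 0) * (1000 * n))%N).
- by exists k, 0%N; rewrite add0n.
- move=> s3 ag3 [i [h [H3 T3 ik ok3]]] g.
  have i0 : (0 < i)%N.
    by case: i g T3 {ik ok3} => // g T3; move: g; rewrite /= T3 H3 expn0; lia.
  have st3 : static n D q Y s3.
    by apply: static_eq st2; rewrite ?(ag3.1 vN isT) ?(ag3.1 vD isT) ?(ag3.1 vPow isT) ?(ag3.2 rY isT).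
  have J3 : narr s3 vJ 0 = j by rewrite (ag3.1 vJ isT) m2.
  apply: wp_seq; apply: wp_nset; set s4 := Store _ _.
  have n4 a : a != vEnd -> narr s4 a = narr s3 a by move=> ha; rewrite /s4 /= upd_neq.
  have E4 : narr s4 vEnd 0 = (h + 2 ^ i)%N by rewrite /s4 /= /upd /= T3.
  have r4 : rarr s4 = rarr s3 by [].
  clearbody s4.
  pose K := (2 ^ i.-1)%N.
  have KE : (2 ^ i = K + K)%N by rewrite -{1}(prednK i0) expnS mul2n -addnn.
  have rnE a b : runs_ok s4 a b j <-> runs_ok s3 a b j.
    by rewrite /runs_ok /runs /rn !n4.
  apply: (@wp_while R _ _ s4 (fun s' => exists d,
     [/\ (d <= K)%N, narr s' vRh 0 = (h + d + d)%N, narr s' vRt 0 = (h + 2 ^ i + d)%N &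
         runs_ok s' (h + d + d) (h + 2 ^ i + d) j])
     (fun s' => 300 * (\sum_(narr s' vRh 0 <= u < h + 2 ^ i) (narr s' vRsz u + 1)))%N).
  + exists 0%N; rewrite !addn0 !n4 //; split=> //; exact/rnE.
  + move=> s5 ag5 [d [dK H5 T5 ok5]] g5.
    have E5 : narr s5 vEnd 0 = (h + 2 ^ i)%N by rewrite (ag5.1 vEnd isT).
    have dK' : (d < K)%N by move: g5; rewrite /= H5 E5 KE; lia.
    have st5 : static n D q Y s5.
      by apply: static_eq st3; rewrite ?(ag5.1 vN isT) ?(ag5.1 vD isT) ?(ag5.1 vPow isT) ?(ag5.2 rY isT) ?n4 ?r4.
    have J5 : narr s5 vJ 0 = j by rewrite (ag5.1 vJ isT) n4.
    set h5 := (h + d + d)%N in H5 ok5 *; set t5 := (h + 2 ^ i + d)%N in T5 ok5 *.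
    have ht : (h5.+1 < t5)%N by rewrite /h5 /t5 KE; lia.
    have in1 : (h5 <= h5 < t5)%N by rewrite leqnn ltnW.
    have in2 : (h5 <= h5.+1 < t5)%N by rewrite leqnSn.
    have [z1 a1] := runs_size ok5 in1; have [z2 a2] := runs_size ok5 in2.
    have z12 : (narr s5 vRsz h5 + narr s5 vRsz h5.+1 <= n)%N.
      have [pe _] := ok5; have := perm_size pe; rewrite size_iota.
      rewrite (runs_cons _ (ltnW ht)) (runs_cons _ ht) !size_cat !size_rd; lia.
    apply: wp_seq; apply: wp_use (merge_ok st5 J5 jD H5 T5 ht a1 a2 z12) _.
    move=> s6 T6 ag6 [m6 low6 sz6 hT6].
    have ok6 : runs_ok s6 h5.+2 t5.+1 j.
      by apply: merge_step ht ok5 m6 low6 _ => u ut; rewrite sz6 (negbTE ut).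
    do 2 (apply: wp_seq || apply: wp_nset); apply: wp_nset; set s7 := Store _ _.
    have H7 : narr s7 vRh 0 = h5.+2 by rewrite /s7 /= /upd /= (ag6.1 vRh isT) H5 addn2.
    have T7 : narr s7 vRt 0 = t5.+1 by rewrite /s7 /= /upd /= (ag6.1 vRt isT) T5 addn1.
    have n7 a : a \notin [:: vRh; vRt] -> narr s7 a = narr s6 a.
      by rewrite !inE !negb_or => /andP[h1 h2]; rewrite /s7 /= !upd_neq.
    clearbody s7.
    have rnE7 a b : runs_ok s7 a b j <-> runs_ok s6 a b j by rewrite /runs_ok /runs /rn !n7.
    split.
      exists d.+1; rewrite H7 T7 /h5 /t5 !addnS !addSn; split=> //.
      by apply/rnE7; move: ok6; rewrite /h5 /t5.
    rewrite H7 H5.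
    have -> : (\sum_(h5.+2 <= u < h + 2 ^ i) (narr s7 vRsz u + 1) = \sum_(h5.+2 <= u < h + 2 ^ i) (narr s5 vRsz u + 1))%N.
      by apply: eq_big_nat => u /andP[_ u2]; rewrite n7 // sz6 ltn_eqF // /t5; lia.
    rewrite (big_ltn (m := h5)) ?(big_ltn (m := h5.+1)); [|rewrite /h5 KE; lia|rewrite /h5 KE; lia].
    move: hT6; rewrite /=; move: (\sum_(_ <= _ < _) _)%N => S; lia.
  + move=> s5 T5 ag5 [d [dK H5 TT5 ok5]] g5 hT5.
    have E5 : narr s5 vEnd 0 = (h + 2 ^ i)%N by rewrite (ag5.1 vEnd isT).
    have dE : d = K by move: g5; rewrite /= H5 E5 KE; lia.
    split.
      exists i.-1, (h + d + d)%N; rewrite H5 TT5; split=> //.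
      * by rewrite -/K dE KE; lia.
      * by rewrite (leq_trans (leq_pred i)).
      * by move: ok5; rewrite -/K dE KE !addnA.
    have -> : (narr s5 vRt 0 - narr s5 vRh 0 = 2 ^ i.-1)%N by rewrite H5 TT5 KE dE -/K; lia.
    have -> : (narr s3 vRt 0 - narr s3 vRh 0 = 2 ^ i)%N by rewrite H3 T3 addKn.
    rewrite !trunc_expnK //.
    have -> : (i * (1000 * n) = 1000 * n + i.-1 * (1000 * n))%N by rewrite -{1}(prednK i0) mulSn.
    have hs : (\sum_(narr s4 vRh 0 <= u < h + 2 ^ i) (narr s4 vRsz u + 1) <= n + 2 * n)%N.
      rewrite !n4 // H3 big_split /= sum_nat_const_nat muln1 addKn; apply: leq_add.
        have [pe _] := ok3; have := perm_size pe; rewrite size_iota => <-.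
        rewrite /runs size_flatten /shape -map_comp sumnE big_map /index_iota; apply: eq_leq.
        by apply: eq_bigr => u _; rewrite /= size_rd.
      by apply: leq_trans P2; rewrite leq_exp2l.
    move: hT5 hs n0; rewrite /=; move: (\sum_(_ <= _ < _) _)%N (i.-1 * _)%N => S X; lia.
- move=> s3 T3 ag3 [i [h [H3 Tt3 ik [pe so]]]] g hT3.
  have i0 : i = 0%N.
    move: g; rewrite /= H3 Tt3 leq_add2l -ltnNge; case: i {Tt3 ik pe so} => // i.
    rewrite expnS; have : (0 < 2 ^ i)%N by rewrite expn_gt0. lia.
  move: pe so; rewrite i0 expn0 addn1 runs_cons // /runs subnn /= cats0 => pe so.
  have zh : narr s3 vRsz h = n by have := perm_size pe; rewrite size_iota size_rd.
  have N3 : narr s3 vN 0 = n by rewrite (ag3.1 vN isT) m2.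
  have J3 : narr s3 vJ 0 = j by rewrite (ag3.1 vJ isT) m2.
  apply: (@wp_for R vI _ _ s3 n 40 (fun i s' =>
    (forall a, (a < j * n)%N -> narr s' vL a = narr s vL a) /\
    rd (narr s' vL) (j * n) i = take i (rn s3 h))) => //.
  + by move=> s' ag; rewrite /= (ag.1 vN isT).
  + rewrite take0 /= upd_neq //; split=> // a _; by rewrite (ag3.1 vL isT) m2.
  + move=> i' s4 in' s4I ag4 [low4 I4]; apply: wp_nset.
    rewrite [neval _ (NAdd _ _)](_ : _ = (j * n + i')%N); last first.
      by rewrite /= (ag4.1 vJ isT) (ag4.1 vN isT) J3 N3 s4I.
    rewrite [neval _ (run _ _)](_ : _ = nth 0%N (rn s3 h) i'); last first.
      rewrite /= (ag4.1 vRun isT) (ag4.1 vRh isT) (ag4.1 vN isT) N3 s4I H3.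
      by rewrite nth_rd ?zh.
    split=> //; rewrite /= upd_neq //; split.
      move=> a ha; rewrite upd_at low4 //; case: eqP => // E; lia.
    rewrite rdS upd_at eqxx (take_nth 0%N) ?size_rd ?zh // -I4; congr rcons.
    by apply: eq_rd => u hu; rewrite upd_at eqn_add2l ltn_eqF.
  + move=> s4 T4 ag4 [low4 I4] hT4.
    have e4 : rd (narr s4 vL) (j * n) n = rn s3 h.
      by rewrite I4 -{1}zh -(size_rd (narr s3 vRun) (h * n) (narr s3 vRsz h)) take_size.
    rewrite e4; split=> //; first by split=> //; apply: so; rewrite leqnn ltnSn.
    move: hT3; rewrite H2 Tl2 subn0 trunc_expnK // => hT3.
    move: hT1 hT3 hT4 P2 n0; rewrite /= mulnS; nia.
Qed.

Lemma sort_ok s :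
  static n D q Y s ->
  wp sort_cmd s (fun s' T =>
    static n D q Y s' /\ root_ok n D Y s' /\
    exists k, (2 ^ k <= 2 * n)%N /\ (T <= 1700 * (n * D * k.+1))%N).
Proof.
move=> st; have [sN sD _ sY] := st.
apply: wp_seq; apply: wp_nset; set s1 := Store _ _.
have n1 a : a != vP -> narr s1 a = narr s a by move=> h; rewrite /s1 /= upd_neq.
have P1 : narr s1 vP 0 = 1%N by [].
have r1 : rarr s1 = rarr s by [].
clearbody s1.
apply: wp_seq; apply: (@wp_while R _ _ s1
  (fun s' => exists k, narr s' vP 0 = (2 ^ k)%N /\ (2 ^ k <= 2 * n)%N)
  (fun s' => (2 * n - narr s' vP 0) * 20)%N).
- by exists 0%N; rewrite P1 expn0; split=> //; lia.
- move=> s2 ag2 [k [Pk k2]]; rewrite /= (ag2.1 vN isT) n1 // Pk sN addn1 => kn.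
  apply: wp_nset; rewrite /= /upd /= Pk; split; last by have := expn_gt0 2 k; lia.
  by exists k.+1; rewrite expnS mul2n -addnn; split=> //; lia.
move=> s2 T2 ag2 [k [Pk k2]] g2 hT2.
have nP : (n <= 2 ^ k)%N.
  by move: g2; rewrite /= (ag2.1 vN isT) n1 // Pk sN addn1 -leqNgt.
have st2 : static n D q Y s2.
  by apply: static_eq st; rewrite ?(ag2.1 vN isT) ?(ag2.1 vD isT) ?(ag2.1 vPow isT) ?(ag2.2 rY isT) ?n1 ?r1.
apply: (@wp_for R vJ _ _ s2 D (1500 * (n * k.+1)) (fun j s' => forall j', (j' < j)%N ->
    let l := rd (narr s' vL) (j' * n) n in perm_eq l (iota 0 n) /\ sorted (le j') l)) => //.
- by move=> s' ag; have [_ <- _ _] := st2; rewrite /= (ag.1 vD isT).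
- move=> j s3 jD s3J ag3 I3.
  have st3 : static n D q Y s3.
    by apply: static_eq st2; rewrite ?(ag3.1 vN isT) ?(ag3.1 vD isT) ?(ag3.1 vPow isT) ?(ag3.2 rY isT).
  have P3 : narr s3 vP 0 = (2 ^ k)%N by rewrite (ag3.1 vP isT).
  apply: wp_use (sort1_ok st3 s3J jD P3 _) _; first by rewrite nP.
  move=> s4 T4 ag4 [low4 [pe so] hT4]; split=> // j'.
  rewrite [narr _ _](_ : _ = narr s4 vL); last by rewrite /= upd_neq.
  rewrite ltnS leq_eqVlt => /orP[/eqP-> //|lt].
  rewrite (_ : rd _ _ _ = rd (narr s3 vL) (j' * n) n); first exact: I3.
  by apply: eq_rd => i hi; apply: low4; apply: addr_lt.
move=> s3 T3 ag3 I3 hT3; split.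
  by apply: static_eq st2; rewrite ?(ag3.1 vN isT) ?(ag3.1 vD isT) ?(ag3.1 vPow isT) ?(ag3.2 rY isT).
split; first exact: I3.
exists k; split=> //; move: hT2 hT3; rewrite P1 /=.
have h1 : (D <= n * D * k.+1)%N by rewrite mulnAC leq_pmull // muln_gt0 n0.
have h2 : (n <= n * D * k.+1)%N by rewrite -mulnA leq_pmulr // muln_gt0 D0.
have -> : (D * (1500 * (n * k.+1) + 2 + 12) = 1500 * (n * D * k.+1) + 14 * D)%N by lia.
move: (n * D * k.+1)%N h1 h2 => X h1 h2; lia.
Qed.

End Sort.

(** * Initialization *)

Section Init.
Variables (R : realType) (n d : nat) (X : 'I_n -> 'rV[R]_d) (rho : R).
Implicit Types (s : store R).

Definition Xn (x k : nat) : R :=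
  match (insub x : option 'I_n), (insub k : option 'I_d) with
  | Some i, Some j => X i 0 j
  | _, _ => 0
  end.

(* Signed coordinates: with the negated ones, only upper tails are scanned. *)
Definition Yn (x j : nat) : R := if (j < d)%N then Xn x j else - Xn x (j - d).

Local Notation D := (d + d)%N.

Lemma input_point i k : (i < n)%N -> (k < d)%N ->
  rarr (input_store X rho) 1 (i * d + k)%N = Xn i k.
Proof.
by move=> ik kd; have d0 := leq_ltn_trans (leq0n k) kd; rewrite /= divnMDl // divn_small // addn0 modnMDl modn_small. Qed.

Lemma Yn_op j : (j < D)%N -> exists2 j', (j' < D)%N & forall x, (x < n)%N -> Yn x j' = - Yn x j.
Proof.
move=> jD; have [jd|dj] := ltnP j d.
  exists (j + d)%N; first lia.
  by move=> x _; rewrite /Yn jd ltnNge leq_addl /= addnK.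
exists (j - d)%N; first lia.
by move=> x _; rewrite /Yn [(j < d)%N]ltnNge dj /= opprK ifT //; lia.
Qed.

Lemma params_ok s : 0 < rho ->
  narr s 0 0 = n -> narr s 0 1 = d -> rarr s 0 0 = rho ->
  wp params_cmd s (fun s' T =>
    [/\ narr s' vN 0 = n, narr s' vD 0 = D, (0 < narr s' vQ 0)%N,
        1 <= (narr s' vQ 0)%:R * rho /\ (narr s' vQ 0)%:R <= rho^-1 + 1 &
        T%:R <= 20 * rho^-1 + 60]).
Proof.
move=> rho0 sn sd sr; have i0 : 0 < rho^-1 by rewrite invr_gt0.
do 3 (apply: wp_seq; apply: wp_nset); set s1 := Store _ _.
have q1 : narr s1 vQ 0 = 1%N by [].
have N1 : narr s1 vN 0 = n by rewrite /s1 /= /upd /= sn.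
have D1 : narr s1 vD 0 = D by rewrite /s1 /= /upd /= sd.
have r1 : rarr s1 0 0 = rho by [].
clearbody s1.
apply: (@wp_whileR R _ _ s1 (fun s' => (0 < narr s' vQ 0)%N /\ (narr s' vQ 0)%:R <= rho^-1 + 1)
  (fun s' => 20 * (rho^-1 + 1 - (narr s' vQ 0)%:R))).
- by rewrite q1; split=> //; rewrite lerDr ltW.
- by move=> s' _ [_ h]; rewrite mulr_ge0 // subr_ge0.
- move=> s2 ag2 [q0 h]; rewrite /= (ag2.2 0%N isT) r1 -ltNge => g.
  apply: wp_nset; rewrite /= /upd /= addn1; move: h g; move: (narr s2 vQ 0) q0 => x x0 h g.
  (* The test has failed at x, so x + 1 is still at most 1/rho + 1. *)
  have h2 : x%:R < rho^-1 by rewrite -[rho^-1]mul1r ltr_pdivlMr.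
  split; first by split=> //; rewrite -natr1 lerD2r ltW.
  apply: le_trans (_ : 20 + 20 * (rho^-1 + 1 - x.+1%:R) <= _); last by rewrite -natr1; lra.
  by rewrite lerD2r ler_nat.
move=> s2 T2 ag2 [q0 h]; rewrite /= (ag2.2 0%N isT) r1 negbK => g hT2.
rewrite (ag2.1 vN isT) (ag2.1 vD isT); split=> //.
apply: le_trans (_ : T2%:R + 25 <= _); first by rewrite -natrD ler_nat /=; lia.
have b : (bcost (BNot (BRle (RNat (NLit 1)) (RMul (RNat (NGet vQ (NLit 0))) (RGet 0 (NLit 0)))))).+1%:R <= 15 :> R.
  by rewrite ler_nat.
by move: hT2; rewrite q1; lra.
Qed.

Lemma pow_ok s q : (0 < n)%N ->
  narr s vN 0 = n -> narr s vQ 0 = q ->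
  wp pow_cmd s (fun s' T =>
    (forall i, (i <= n)%N -> narr s' vPow i = (i ^ q)%N) /\
    (T <= 200 * (n * q.+1))%N).
Proof.
move=> n0 sN sQ.
apply: (@wp_for R vI _ _ s n.+1 (q * 40 + 30) (fun i s' =>
  forall i', (i' < i)%N -> narr s' vPow i' = (i' ^ q)%N)) => //.
- by move=> s' ag; rewrite /= (ag.1 vN isT) sN addn1.
- move=> i s1 ik s1I ag1 I1; apply: wp_seq; apply: wp_nset; set s2 := Store _ _.
  have P2 p : narr s2 vPow p = if p == i then 1%N else narr s1 vPow p.
    by rewrite /s2 /= upd_at s1I.
  have I2 : narr s2 vI 0 = i by rewrite -s1I.
  have Q2 : narr s2 vQ 0 = q by rewrite -sQ -(ag1.1 vQ isT).
  clearbody s2.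
  apply: (@wp_for R vJ _ _ s2 q 25 (fun j s' =>
     forall p, narr s' vPow p = if p == i then (i ^ j)%N else narr s1 vPow p)) => //.
  + by move=> s' ag; rewrite /= (ag.1 vQ isT).
  + move=> j s3 jq s3J ag3 I3; apply: wp_nset; split=> // p.
    rewrite /= upd_neq // upd_at (ag3.1 vI isT) I2 I3.
    by rewrite I3 eqxx expnSr; case: eqP.
  move=> s3 T3 ag3 I3 hT3; split; first by move: hT3; rewrite /=; lia.
  move=> p; rewrite ltnS leq_eqVlt /= upd_neq // I3 => /orP[/eqP->|lt]; first by rewrite eqxx.
  by rewrite ltn_eqF // I1.
move=> s1 T1 ag1 I1 hT1; split=> // .
have : (n.+1 * (q * 40 + 30 + 5 + 12) <= 2 * n * (q * 40 + 47))%N.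
  by rewrite leq_mul //; lia.
move: hT1; rewrite /= => h1 h2; have : (0 < n * q.+1)%N by rewrite muln_gt0 n0.
rewrite mulnS; lia.
Qed.

Lemma copy_ok s : (0 < n)%N -> (0 < d)%N ->
  narr s vN 0 = n -> narr s vD 0 = D -> narr s 0 1 = d ->
  (forall i k, (i < n)%N -> (k < d)%N -> rarr s 1 (i * d + k)%N = Xn i k) ->
  wp copy_cmd s (fun s' T =>
    (forall x j, (x < n)%N -> (j < D)%N -> rarr s' rY (x * D + j)%N = Yn x j) /\
    (T <= 200 * (n * d))%N).
Proof.
move=> n0 d0 sN sD sd sX.
apply: (@wp_for R vI _ _ s n (d * 80 + 40) (fun i s' =>
  forall x j, (x < i)%N -> (j < D)%N -> rarr s' rY (x * D + j)%N = Yn x j)) => //.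
- by move=> s' ag; rewrite /= (ag.1 vN isT).
- move=> i s1 ik s1I ag1 I1.
  apply: (@wp_for R vJ _ _ s1 d 62 (fun k s' =>
     (forall x j, (x < i)%N -> (j < D)%N -> rarr s' rY (x * D + j)%N = Yn x j) /\
     (forall k', (k' < k)%N -> rarr s' rY (i * D + k')%N = Yn i k' /\
        rarr s' rY (i * D + (d + k'))%N = Yn i (d + k')%N))) => //.
  + by move=> s' ag; rewrite /= (ag.1 0%N isT) (ag1.1 0%N isT).
  + move=> k s2 kd s2J ag2 [I2 I3].
    have xE s' : narr s' = narr s2 -> rarr s' 1 = rarr s2 1 ->
       reval s' (RGet 1 (NAdd (NMul (NGet vI (NLit 0)) (NGet 0 (NLit 1))) (NGet vJ (NLit 0)))) = Xn i k.
      move=> e1 e2; rewrite /= e1 e2 (ag2.2 1%N isT) (ag1.2 1%N isT) s2J (ag2.1 vI isT) s1I.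
      by rewrite (ag2.1 0%N isT) (ag1.1 0%N isT) sd sX.
    have D2 : narr s2 vD 0 = D by rewrite (ag2.1 vD isT) (ag1.1 vD isT).
    have d2 : narr s2 0 1 = d by rewrite (ag2.1 0%N isT) (ag1.1 0%N isT).
    have i2 : narr s2 vI 0 = i by rewrite (ag2.1 vI isT).
    apply: wp_seq; apply: wp_rset; rewrite xE //.
    rewrite [neval _ _](_ : _ = (i * D + k)%N); last by rewrite /= i2 D2 s2J.
    set s3 := Store _ _; apply: wp_rset.
    rewrite [neval _ _](_ : _ = (i * D + (d + k))%N); last by rewrite /= i2 D2 s2J d2.
    have -> : reval s3 (RSub (RNat (NLit 0)) (RGet 1 (NAdd (NMul (NGet vI (NLit 0)) (NGet 0 (NLit 1))) (NGet vJ (NLit 0))))) = - Xn i k.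
      have rS e1 e2 : reval s3 (RSub e1 e2) = reval s3 e1 - reval s3 e2 by [].
      by rewrite rS xE //= sub0r.
    split=> //; set s4 := Store _ _.
    have E4 p : rarr s4 rY p = if p == (i * D + (d + k))%N then - Xn i k
        else if p == (i * D + k)%N then Xn i k else rarr s2 rY p.
      by rewrite /s4 /= upd_at upd_at.
    have ne x j : (j < D)%N -> (x < i)%N -> forall j', (j' < D)%N -> (x * D + j == i * D + j')%N = false.
      by move=> jD xi j' jD'; rewrite addr_inj // ltn_eqF.
    split=> [x j xi jD|k'].
      by rewrite E4 !ne ?I2 //; lia.
    rewrite ltnS leq_eqVlt => /orP[/eqP->|lt].
      rewrite !E4 eqxx !eqn_add2l eqxx (_ : (k == d + k)%N = false); last by lia.
      by rewrite /Yn kd ltnNge leq_addr /= addKn.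
    have [h1 h2] := I3 _ lt; rewrite !E4 !eqn_add2l h1 h2.
    rewrite (_ : (k' == d + k)%N = false); last by lia.
    rewrite (_ : (k' == k) = false); last by rewrite ltn_eqF.
    by rewrite (_ : (d + k' == k)%N = false); last by lia.
  move=> s2 T2 ag2 [I2 I3] hT2; split; first by move: hT2; rewrite /=; lia.
  move=> x j; rewrite ltnS leq_eqVlt => /orP[/eqP->|lt] jD; last exact: I2.
  have [jd|dj] := ltnP j d; first by case: (I3 _ jd).
  have kd : (j - d < d)%N by lia.
  by have [_] := I3 _ kd; rewrite subnKC.
move=> s1 T1 ag1 I1 hT1; split=> //.
move: hT1; rewrite /=; have : (n <= n * d)%N by rewrite leq_pmulr.
have : (0 < n * d)%N by rewrite muln_gt0 n0.
lia.
Qed.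

(** M is the eccentricity of point 0. The upper bounds make M + M a valid first radius, and the
    point attaining M keeps it comparable with the diameter. *)
Lemma diam_ok s : (0 < n)%N -> (0 < d)%N ->
  narr s vN 0 = n -> narr s vD 0 = D ->
  (forall x j, (x < n)%N -> (j < D)%N -> rarr s rY (x * D + j)%N = Yn x j) ->
  wp diam_cmd s (fun s' T => exists M : R,
    [/\ rarr s' rR 0 = M + M, forall a, a != rR -> rarr s' a = rarr s a,
       forall x, (x < n)%N -> dY D Yn x 0 <= M,
       exists2 x, (x < n)%N & M <= dY D Yn x 0 &
       (T <= 200 * (n * d))%N]).
Proof.
move=> n0 d0 sN sD sY.
apply: wp_seq; apply: wp_rset; set s1 := Store _ _.
have M1 : rarr s1 rR 0 = 0 by [].
have n1 : narr s1 = narr s by [].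
have r1 a : a != rR -> rarr s1 a = rarr s a by move=> h; rewrite /s1 /= upd_neq.
clearbody s1.
apply: wp_seq; apply: (@wp_for R vI _ _ s1 n (D * 70 + 20) (fun i s' =>
  [/\ 0 <= rarr s' rR 0, exists2 x, (x < n)%N & rarr s' rR 0 <= dY D Yn x 0 &
      forall x j, (x < i)%N -> (j < D)%N -> Yn x j - Yn 0%N j <= rarr s' rR 0])) => //.
- by move=> s' ag; rewrite /= (ag.1 vN isT) n1.
- by rewrite M1; split=> //; exists 0%N => //; apply: maxdiff_ge0.
- move=> i s2 ik s2I ag2 [A1 A2 A3].
  apply: (@wp_for R vJ _ _ s2 D 50 (fun j s' =>
    [/\ 0 <= rarr s' rR 0, exists2 x, (x < n)%N & rarr s' rR 0 <= dY D Yn x 0,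
        rarr s2 rR 0 <= rarr s' rR 0 &
        forall j', (j' < j)%N -> Yn i j' - Yn 0%N j' <= rarr s' rR 0])) => //.
  + by move=> s' ag; rewrite /= (ag.1 vD isT) (ag2.1 vD isT) n1.
  + move=> j s3 jD s3J ag3 [B1 B2 B3 B4].
    set v := RSub _ _.
    have vE : reval s3 v = Yn i j - Yn 0%N j.
      rewrite /= s3J (ag3.1 vI isT) s2I (ag3.1 vD isT) (ag2.1 vD isT) n1 sD.
      rewrite (ag3.2 rY isT) (ag2.2 rY isT) r1 // sY //.
      by rewrite (sY 0%N j n0 jD).
    apply: wp_if; rewrite [beval _ _](_ : _ = (rarr s3 rR 0 <= Yn i j - Yn 0%N j)).
    * move=> le; apply: wp_rset; split=> //; rewrite vE [rarr _ _ _](_ : _ = Yn i j - Yn 0%N j) //.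
      split.
      - exact: le_trans le.
      - by exists i => //; apply: dY_ge.
      - exact: le_trans le.
      - move=> j'; rewrite ltnS leq_eqVlt => /orP[/eqP-> //|/B4 h]; exact: le_trans le.
    * by rewrite -vE.
    * rewrite -ltNge => /ltW le; apply: wp_skip; split=> //; split=> // j'.
      by rewrite ltnS leq_eqVlt => /orP[/eqP->|/B4].
    * by rewrite -vE.
  move=> s3 T3 ag3 [B1 B2 B3 B4] hT3; split; first by move: hT3; rewrite /=; lia.
  split=> // x j; rewrite ltnS leq_eqVlt => /orP[/eqP->|lt] jD; first exact: B4.
  by apply: le_trans B3; apply: A3.
move=> s2 T2 ag2 [A1 A2 A3] hT2; apply: wp_rset; exists (rarr s2 rR 0); split=> //.
- by move=> a ha; rewrite /= upd_neq // ag2.2 ?r1 //= inE.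
- by move=> x xn; apply: dY_le => // k kD; apply: A3.
- move: hT2; rewrite /=; have : (n <= n * d)%N by rewrite leq_pmulr.
  have : (0 < n * d)%N by rewrite muln_gt0 n0.
  lia.
Qed.

End Init.

(** * All scales *)

Section Scales.
Variables (R : realType) (n D q : nat) (Y : nat -> nat -> R) (sep : R).
Hypotheses (D0 : (0 < D)%N) (q0 : (0 < q)%N) (n0 : (0 < n)%N).
Hypothesis Yop : forall j, (j < D)%N ->
  exists2 j', (j' < D)%N & forall x, (x < n)%N -> Y x j' = - Y x j.
Hypothesis sep0 : 0 < sep.
Hypothesis sepP : forall x y, (x < n)%N -> (y < n)%N -> x != y -> sep <= dY D Y x y.
Implicit Types (s : store R).

Local Notation dY := (dY D Y).
Local Notation phi := (phi R q).
Local Notation lambda := (2 * kmax R q D + 2).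

(** A star edge at radius r shows that [sep] is at most (2n + 2) r. The loop continues with r/2, for
    which the factor is 4n + 4. *)
Lemma double_natr : (4 * n + 4)%:R = (2 * n + 2)%:R + (2 * n + 2)%:R :> R.
Proof. by rewrite -natrD addnACA -mulnDl. Qed.

Lemma linked_le s (t t' : R) x y : t <= t' -> linked n D Y s t x y -> linked n D Y s t' x y.
Proof.
by move=> tt' [c [cn [e d] [e' d']]]; exists c; split=> //; split=> //; apply: le_trans tt'.
Qed.

Lemma lambda_ge0 : 0 <= lambda.
Proof. by have := kmax_ge R q0 D0; lra. Qed.

(* Bounds the number of scales still to be processed when the radius is [r]. *)
Definition nscales (r : R) : R := ln ((4 * n + 4)%:R * r / sep) / ln 2 + 1.

Lemma ln2_gt0 : 0 < ln (2 : R).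
Proof. by apply: ln_gt0; lra. Qed.

Lemma nscales_half r : 0 < r -> nscales (r / 2) = nscales r - 1.
Proof.
move=> r0; rewrite /nscales; have k0 : 0 < (4 * n + 4)%:R :> R by rewrite ltr0n; lia.
have -> : (4 * n + 4)%:R * (r / 2) / sep = (4 * n + 4)%:R * r / sep / 2 by ring.
have A0 : 0 < (4 * n + 4)%:R * r / sep by rewrite divr_gt0 ?mulr_gt0.
move: (_ / sep) A0 => A A0; rewrite ln_div ?posrE // mulrBl divff ?gt_eqF ?ln2_gt0 //.
by rewrite addrK addrNK.
Qed.

Lemma nscales_ge1 r : sep <= (4 * n + 4)%:R * r -> 1 <= nscales r.
Proof.
move=> h; rewrite /nscales lerDr divr_ge0 ?(ltW ln2_gt0) //.
by apply: ln_ge0; rewrite ler_pdivlMr // mul1r.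
Qed.

(** A pair waits until the radius is within a factor 2 of its distance d: for r/2 < d <= r the link
    of length lambda r is at most 2 lambda d. A scale that leaves the flag down has no pair at
    distance at most r, so no pair is still waiting. *)
Lemma scales_ok s :
  let r0 := rarr s rR 0 in
  static n D q Y s -> root_ok n D Y s -> edges_ok n D Y s -> 0 < r0 ->
  narr s vGo 0 = 1%N -> narr s vC 0 = 0%N -> sep <= (4 * n + 4)%:R * r0 ->
  (forall x y, (x < n)%N -> (y < n)%N -> dY x y <= r0) ->
  wp (While (BNle (NLit 1) (NGet vGo (NLit 0))) scale_cmd) s (fun s' T =>
    [/\ edges_ok n D Y s',
        forall x y, (x < n)%N -> (y < n)%N -> x != y -> linked n D Y s' (2 * lambda * dY x y) x y,
        (narr s' vC 0)%:R <= 2 * phi n * nscales r0 &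
        T%:R <= ((6 * D * q * (node_cost * D))%:R * phi n + 80) * nscales r0 + 20]).
Proof.
move=> r0 st rt eok r0gt go1 C0 hs0 all0.
(* With the flag down no scale follows, and the radius may be so small that [nscales] is negative;
   hence the separate value 0. *)
pose L s' := if narr s' vGo 0 == 1%N then nscales (rarr s' rR 0) else 0.
pose W : R := (6 * D * q * (node_cost * D))%:R.
have W0 : 0 <= W by apply: ler0n.
have pn := phi_ge0 R q n.
apply: (@wp_whileR R _ _ s (fun s' =>
  [/\ [/\ static n D q Y s', root_ok n D Y s', edges_ok n D Y s' & 0 < rarr s' rR 0],
      narr s' vGo 0 = 0%N \/ (narr s' vGo 0 = 1%N /\ sep <= (4 * n + 4)%:R * rarr s' rR 0),
      forall x y, (x < n)%N -> (y < n)%N -> x != y ->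
        (narr s' vGo 0 = 1%N /\ dY x y <= rarr s' rR 0) \/ linked n D Y s' (2 * lambda * dY x y) x y &
      (narr s' vC 0)%:R + 2 * phi n * L s' <= 2 * phi n * nscales r0])
  (fun s' => (W * phi n + 80) * L s')).
- split=> //; first by right.
    by move=> x y xn yn _; left; split=> //; apply: all0.
  by rewrite /L go1 eqxx C0 add0r.
- move=> s' _ [_ hgo _ _]; rewrite mulr_ge0 ?addr_ge0 ?mulr_ge0 // /L.
  case: hgo => [->|[-> h]] //=; apply: le_trans (nscales_ge1 h); lra.
- move=> s' ag [[st' rt' eok' r'0] hgo cov ed] g.
  have [hgo1 hs] : narr s' vGo 0 = 1%N /\ sep <= (4 * n + 4)%:R * rarr s' rR 0.
    by case: hgo => // h; move: g; rewrite /= h.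
  have Ls : L s' = nscales (rarr s' rR 0) by rewrite /L hgo1.
  set r := rarr s' rR 0 in r'0 hs cov Ls *.
  apply: wp_use (scale_ok D0 q0 n0 Yop st' rt' eok' (ltW r'0)) _; rewrite -/r.
  move=> s2 T2 _ [[st2 rt2 eok2 sub2 r2] pairs go2 C2 hT2].
  have L2 : L s2 <= L s' - 1.
    rewrite Ls /L; case: go2 => [->|[-> _]] /=; last by rewrite r2 nscales_half.
    by rewrite subr_ge0 nscales_ge1.
  split.
    split.
    + by split=> //; rewrite r2 divr_gt0.
    + case: go2 => [->|[-> [x [y [xn yn xy d]]]]]; [by left | right; split=> //].
      rewrite r2; apply: le_trans (le_trans (sepP xn yn xy) d) _.
      by rewrite double_natr; move: (2 * n + 2)%:R => c; lra.
    + move=> x y xn yn xy; have lam := lambda_ge0.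
      case: (cov x y xn yn xy) => [[_ d]|]; last by move=> h; right; apply: linked_sub h.
      have [g2 l2] := pairs x y xn yn xy d.
      (* Below r/2 the pair waits for the next scale, which does take place since this pair has
         raised the flag. *)
      have [dle|dgt] := leP (dY x y) (r / 2); first by left; rewrite r2.
      right; apply: linked_le l2; nra.
    + have : 2 * phi n * L s2 <= 2 * phi n * (L s' - 1) by apply: ler_wpM2l => //; apply: mulr_ge0.
      lra.
  have : (W * phi n + 80) * L s2 <= (W * phi n + 80) * (L s' - 1).
    by apply: ler_wpM2l => //; rewrite addr_ge0 // mulr_ge0.
  have : (bcost (BNle (NLit 1) (NGet vGo (NLit 0))) + T2).+1%:R <= T2%:R + 20 :> R.
    by rewrite -natrD ler_nat addnC -addnS leq_add2l.
  move: hT2; rewrite -/W; lra.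
- move=> s' T ag [[st' rt' eok' r'0] hgo cov ed] g hT.
  have {hgo} g0 : narr s' vGo 0 = 0%N by case: hgo => // -[h _]; move: g; rewrite /= h.
  split=> //.
  + by move=> x y xn yn xy; case: (cov x y xn yn xy) => // -[h _]; rewrite g0 in h.
  + by move: ed; rewrite /L g0 mulr0 addr0.
  + move: hT; rewrite /L go1 eqxx -/W -/r0 => hT; apply: le_trans hT _.
    by rewrite lerD2l ler_nat.
Qed.

End Scales.

(** * The complete run on the input store *)

Section Main.
Variables (R : realType) (n d : nat) (X : 'I_n -> 'rV[R]_d) (rho sep : R).
Hypotheses (n1 : (1 < n)%N) (d0 : (0 < d)%N) (rho0 : 0 < rho).

Local Notation D := (d + d)%N.
Local Notation Y := (Yn X).
Local Notation dY := (dY D Y).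

Hypothesis sep0 : 0 < sep.
Hypothesis sepP : forall x y, (x < n)%N -> (y < n)%N -> x != y -> sep <= dY x y.

(** The values q, k and M met during the run stay existential, constrained just enough for the final
    bounds to be pure arithmetic. *)
Lemma spanner_cmd_ok :
  wp spanner_cmd (input_store X rho) (fun s T => exists (q k : nat) (M : R),
    [/\ [/\ (0 < q)%N, 1 <= q%:R * rho, q%:R <= rho^-1 + 1, (2 ^ k <= 2 * n)%N &
          exists2 x, (x < n)%N & M <= dY x 0%N],
        [/\ 0 < M & sep <= (4 * n + 4)%:R * (M + M)],
        edges_ok n D Y s /\ narr s 0 0 = narr s vC 0,
        forall x y, (x < n)%N -> (y < n)%N -> x != y ->
          linked n D Y s (2 * (2 * kmax R q D + 2) * dY x y) x y &
        (narr s vC 0)%:R <= 2 * phi R q n * nscales n sep (M + M) /\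
        T%:R <= 20 * rho^-1 + 200 * (n * q.+1)%:R + 400 * (n * d)%:R + 1700 * (n * D * k.+1)%:R +
           ((6 * D * q * (node_cost * D))%:R * phi R q n + 80) * nscales n sep (M + M) + 200]).
Proof.
have n0 : (0 < n)%N by apply: ltnW.
have D0 : (0 < D)%N by lia.
have Yop := @Yn_op R n d X.
apply: wp_seq; apply: wp_use (params_ok (n := n) (d := d) rho0 _ _ _) _ => //.
move=> s1 T1 ag1 [N1 D1 q0 [q1 q2] hT1]; set q := narr s1 vQ 0 in q0 q1 q2.
apply: wp_seq; apply: wp_use (pow_ok n0 N1 (erefl q)) _ => s2 T2 ag2 [pw2 hT2].
have in2 a : a \notin [:: 3; 4; 5; 6; 7; 8]%N -> narr s2 a = narr (input_store X rho) a.
  rewrite !inE !negb_or => /and5P[h3 h4 h5 h6 /andP[h7 h8]].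
  by rewrite ag2.1 /= ?inE ?negb_or ?h6 ?h7 ?h8 // ag1.1 //= !inE !negb_or ?h3 ?h4 ?h5.
have ir2 : rarr s2 = rarr (input_store X rho).
  by apply/funext => a; rewrite ag2.2 // ag1.2.
have N2 : narr s2 vN 0 = n by rewrite (ag2.1 vN isT).
have D2 : narr s2 vD 0 = D by rewrite (ag2.1 vD isT).
apply: wp_seq; apply: wp_use (@copy_ok R n d X s2 n0 d0 N2 D2 _ _) _.
- by rewrite in2.
- by move=> i k ik kd; rewrite ir2; apply: input_point.
move=> s3 T3 ag3 [Y3 hT3].
have N3 : narr s3 vN 0 = n by rewrite (ag3.1 vN isT).
have D3 : narr s3 vD 0 = D by rewrite (ag3.1 vD isT).
apply: wp_seq; apply: wp_use (diam_ok n0 d0 N3 D3 Y3) _.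
move=> s4 T4 ag4 [M [r4 rk4 MU [x0 x0n ML] hT4]].
have st4 : static n D q Y s4.
  split.
  - by rewrite (ag4.1 vN isT).
  - by rewrite (ag4.1 vD isT).
  - by move=> i ik; rewrite (ag4.1 vPow isT) (ag3.1 vPow isT) pw2.
  - by move=> x j xn jD; rewrite rk4 // Y3.
apply: wp_seq; apply: wp_use (sort_ok D0 n0 st4) _ => s5 T5 ag5 [st5 [rt5 [k [k2 hT5]]]].
apply: wp_seq; apply: wp_nset; set s6 := Store _ _.
have n6 a : a != vGo -> narr s6 a = narr s5 a by move=> h; rewrite /s6 /= upd_neq.
have go6 : narr s6 vGo 0 = 1%N by [].
have r6 : rarr s6 = rarr s5 by [].
clearbody s6.
have z a : a \in [:: vC; vFlag] -> narr s6 a = fun=> 0%N.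
  rewrite !inE => /orP[]/eqP->; rewrite n6 //.
    by rewrite (ag5.1 vC isT) (ag4.1 vC isT) (ag3.1 vC isT) in2.
  by rewrite (ag5.1 vFlag isT) (ag4.1 vFlag isT) (ag3.1 vFlag isT) in2.
have C6 : narr s6 vC 0 = 0%N by rewrite z.
have es6 : es s6 = [::] by rewrite /es C6.
have eok6 : edges_ok n D Y s6.
  by split; rewrite ?es6 // ?C6 // => u x _ _; rewrite z // /el es6.
have st6 : static n D q Y s6 by apply: static_eq st5; rewrite ?n6 ?r6.
have rt6 : root_ok n D Y s6 by move=> j jD; rewrite n6 //; apply: rt5.
have R6 : rarr s6 rR 0 = M + M by rewrite r6 (ag5.2 rR isT).
have dM x y : (x < n)%N -> (y < n)%N -> dY x y <= M + M.
  move=> xn yn; apply: dY_le => [|i iD].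
    by have := maxdiff_ge0 Y x 0%N D; have := MU x xn; rewrite /dY; lra.
  have h1 := le_trans (dY_ge Y x 0%N iD) (MU _ xn).
  have := le_trans (dY_ge Y 0%N y iD) (_ : dY 0%N y <= M); rewrite (dYC Yop n0 yn) => /(_ (MU _ yn)).
  lra.
have s01 : sep <= M + M by apply: le_trans (dM 0%N 1%N n0 n1); apply: sepP.
have M0 : 0 < M by rewrite -(pmulrn_lgt0 M (ltn0Sn 1)) mulr2n; apply: lt_le_trans sep0 s01.
have hK : sep <= (4 * n + 4)%:R * (M + M).
  apply: le_trans s01 _; rewrite ler_peMl ?addr_ge0 ?(ltW M0) // ler1n; lia.
apply: wp_seq; apply: wp_use (@scales_ok R n D q Y sep D0 q0 n0 Yop sep0 sepP s6 st6 rt6 eok6 _ go6 C6 _ _) _; rewrite ?R6 //.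
  by rewrite addr_gt0.
move=> s7 T7 _ [eok7 lk7 C7 hT7]; apply: wp_nset; set s8 := Store _ _.
have n8 a : a != 0%N -> narr s8 a = narr s7 a by move=> h; rewrite /s8 /= upd_neq.
have z8 : narr s8 0 0 = narr s7 vC 0 by [].
have r8 : rarr s8 = rarr s7 by [].
clearbody s8.
have es8 : es s8 = es s7 by rewrite /es !n8.
exists q, k, M; split=> //.
- by split=> //; exists x0.
- by split; [apply: edges_ok_eq eok7; rewrite ?n8 ?r8 | rewrite z8 n8].
- by move=> x y xn yn xy; apply: linked_sub (lk7 _ _ xn yn xy); rewrite es8.
- rewrite n8 //; split=> //.
  have hn : (T2 + T3 + T4 + T5)%:R <= 200 * (n * q.+1)%:R + 400 * (n * d)%:R + 1700 * (n * D * k.+1)%:R :> R.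
    apply: le_trans (_ : (200 * (n * q.+1) + 400 * (n * d) + 1700 * (n * D * k.+1))%:R <= _).
      rewrite ler_nat; move: hT2 hT3 hT4 hT5; clear.
      by move: (n * q.+1)%N (n * d)%N (n * D * k.+1)%N => a b c; lia.
    move: (n * q.+1)%N (n * d)%N (n * D * k.+1)%N => a b c.
    by rewrite (natrD _ (200 * a + 400 * b)) (natrD _ (200 * a)) (natrM _ 200) (natrM _ 400) (natrM _ 1700) lexx.
  have ht : (T1 + (T2 + (T3 + (T4 + (T5 + ((1 + 1).+1 + (T7 + (1 + 2).+1)))))))%:R <=
      T1%:R + (T2 + T3 + T4 + T5)%:R + T7%:R + 50 :> R.
    by rewrite -!natrD ler_nat; clear; lia.
  apply: le_trans ht _.
  apply: le_trans (lerD (lerD (lerD hT1 hn) hT7) (lexx 50)) _.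
  move: (n * q.+1)%:R (n * d)%:R (n * D * k.+1)%:R => a b c.
  by move: (_ * nscales _ _ _) => e; lra.
Qed.

End Main.

(** * The spanner *)

Section Dataset.
Variables (R : realType) (n d : nat) (X : 'I_n -> 'rV[R]_d).
Implicit Types (i j : 'I_n).

(** An absolute value is the larger of two opposite signed differences, one from a coordinate and
    one from its negation. *)
Lemma dist_X_dY i j : dist_X X i j = dY (d + d) (Yn X) i j.
Proof.
have XE (u : 'I_n) (k : 'I_d) : Xn X u k = X u 0 k by rewrite /Xn !valK.
rewrite /dist_X -[LHS]/(mx_norm _) mx_normrE; apply/le_anti/andP; split.
  apply: bigmax_le => [|[u k] _]; first exact: maxdiff_ge0.
  rewrite /= ord1 !mxE -!XE ler_norml; apply/andP; split.
    rewrite lerNl opprB.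
    have := @dY_ge R (d + d) (Yn X) i j (d + k)%N; rewrite ltn_add2l ltn_ord => /(_ isT).
    by rewrite /Yn ltnNge leq_addr /= addKn; lra.
  have := @dY_ge R (d + d) (Yn X) i j k; rewrite ltn_addr // => /(_ isT).
  by rewrite /Yn ltn_ord.
apply: dY_le => [|k kD].
  by apply: le_trans (_ : \big[Num.max/0]_(ij : 'I_1 * 'I_d) 0 <= _);
    [elim/big_ind: _ => // a b ? ?; rewrite le_max; apply/orP; left | apply: le_bigmax2].
have B (l : 'I_d) : `|(X i - X j) 0 l| <=
    \big[Num.max/0]_(ij : 'I_1 * 'I_d) `|(X i - X j) ij.1 ij.2|.
  exact: (@le_bigmax _ _ _ 0 (fun ij : 'I_1 * 'I_d => `|(X i - X j) ij.1 ij.2|) (0, l)).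
rewrite /Yn; case: ltnP => kd.
  apply: le_trans (B (Ordinal kd)); rewrite !mxE -!XE /=; exact: ler_norm.
have kd' : (k - d < d)%N by lia.
apply: le_trans (B (Ordinal kd')); rewrite !mxE -!XE /= -normrN opprB opprK addrC.
exact: ler_norm.
Qed.

Lemma dist_XC i j : dist_X X i j = dist_X X j i.
Proof. by rewrite /dist_X distrC. Qed.

Lemma dist_X_triangle i j k : dist_X X i k <= dist_X X i j + dist_X X j k.
Proof. exact: ler_distD. Qed.

Lemma dist_X_ge0 i j : 0 <= dist_X X i j. Proof. exact: normr_ge0. Qed.

Lemma diam_X_ge i j : dist_X X i j <= diam_X X.
Proof. exact: (@le_bigmax _ _ _ 0 (fun p : 'I_n * 'I_n => dist_X X p.1 p.2) (i, j)). Qed.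

Lemma sep_X_le i j : i != j -> sep_X X <= dist_X X i j.
Proof.
by move=> ij; apply: (@bigmin_le_cond _ _ _ _ (i, j) _ (fun p : 'I_n * 'I_n => dist_X X p.1 p.2)).
Qed.

Lemma dist_X_gt0 i j : injective X -> i != j -> 0 < dist_X X i j.
Proof. by move=> inj ij; rewrite normr_gt0 subr_eq0; apply: contra ij => /eqP/inj->. Qed.

Lemma sep_X_gt0 : (1 < n)%N -> injective X -> 0 < sep_X X.
Proof.
move=> n1 inj; apply: lt_bigmin => [|[i j] /= ij]; last exact: dist_X_gt0.
(* The minimum has the diameter as its default value, so the positivity of the diameter is needed
   too; two distinct points give it. *)
pose a := Ordinal (ltnW n1); pose b := Ordinal n1.
by apply: lt_le_trans (diam_X_ge a b); apply: dist_X_gt0.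
Qed.

(** In dimension 0 all points coincide. *)
Lemma dim_gt0 : (1 < n)%N -> injective X -> (0 < d)%N.
Proof.
move=> n1 inj; case: (posnP d) => // d0.
pose a := Ordinal (ltnW n1); pose b := Ordinal n1.
suff /inj/(congr1 val) : X a = X b by [].
by apply/rowP => -[k kd]; exfalso; move: kd; rewrite d0.
Qed.

End Dataset.

Lemma set2_eq (T : finType) (u v a b : T) :
  [set u; v]%SET = [set a; b]%SET -> (u = a /\ v = b) \/ (u = b /\ v = a).
Proof.
move=> eq.
have : u \in [set a; b]%SET by rewrite -eq !inE eqxx.
have : v \in [set a; b]%SET by rewrite -eq !inE eqxx orbT.
have : a \in [set u; v]%SET by rewrite eq !inE eqxx.
have : b \in [set u; v]%SET by rewrite eq !inE eqxx orbT.
rewrite !inE; do 4 (case/orP=> /eqP ?);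
  by first [left; split; congruence | right; split; congruence].
Qed.

(** * From the output arrays to a spanner *)

Section Graph.
Variables (R : realType) (n d : nat) (X : 'I_n -> 'rV[R]_d).
Local Notation Y := (Yn X).
Local Notation D := (d + d)%N.
Hypothesis n0 : (0 < n)%N.
Implicit Types (s : store R).

Definition to_ord (x : nat) : 'I_n := insubd (Ordinal n0) x.

Lemma to_ordK x : (x < n)%N -> to_ord x = x :> nat.
Proof. by move=> xn; rewrite /to_ord val_insubd xn. Qed.

Lemma to_ord_val (i : 'I_n) : to_ord i = i.
Proof. by apply/val_inj; rewrite /= to_ordK. Qed.

Definition edge_list s : seq ('I_n * 'I_n) := [seq (to_ord e.1, to_ord e.2) | e <- es s].

Definition graph_of s : wgraph R 'I_n :=
  WGraph [set [set e.1; e.2] | e in edge_list s]%SET (dist_X X).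

Lemma mem_edge_list s u v : edges_ok n D Y s ->
  ((u, v) \in edge_list s) = ((val u, val v) \in es s).
Proof.
move=> [ok _ _ _]; apply/mapP/idP => [[e he [-> ->]]|h].
  have /and3P[h1 h2 _] := ok _ he.
  by rewrite /= !to_ordK // -surjective_pairing.
by exists (val u, val v) => //=; rewrite !to_ord_val.
Qed.

Lemma adj_graph s u v : edges_ok n D Y s -> adj (graph_of s) u v = el s u v.
Proof.
move=> ok; rewrite /adj /=; apply/imsetP/orP => [[[a b]]|].
  rewrite /= (mem_edge_list _ _ ok) => he eq.
  by case: (set2_eq eq) => -[-> ->]; [left | right].
case=> h; [exists (u, v) | exists (v, u)]; rewrite ?mem_edge_list //.
by rewrite finset.setUC.
Qed.

Lemma graph_output s : edges_ok n D Y s -> narr s 0 0 = narr s vC 0 ->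
  outputs_graph s (graph_of s).
Proof.
move=> ok mC; have [e1 e2 _ [e4 e5]] := ok.
have lt i : (i < narr s vC 0)%N -> (narr s 1 i < n)%N /\ (narr s 2 i < n)%N.
  move=> hi; have /e1/and3P[? ? _] // : (narr s 1 i, narr s 2 i) \in es s.
  by apply/mapP; exists i; rewrite // mem_iota.
rewrite /outputs_graph mC; exists (edge_list s); split=> //.
- rewrite /edge_list /es /mkseq -!map_comp; apply/eq_in_map => i; rewrite mem_iota => hi.
  by rewrite /= to_ordK //; case: (lt i hi).
- rewrite /edge_list /es /mkseq -!map_comp; apply/eq_in_map => i; rewrite mem_iota => hi.
  by rewrite /= to_ordK //; case: (lt i hi).
- rewrite /edge_list /es /mkseq -!map_comp; apply/eq_in_map => i; rewrite mem_iota => hi.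
  by have [h1 h2] := lt i hi; rewrite /= dist_X_dY !to_ordK // e2.
- have ul : uniq (edge_list s).
    rewrite map_inj_in_uniq // => -[a b] [a' b'] /e1/and3P[/= h1 h2 _] /e1/and3P[/= h3 h4 _].
    by case=> /(congr1 val) + /(congr1 val); rewrite /= !to_ordK // => -> ->.
  (* No pair is listed in both orientations, so distinct pairs give distinct edges and the counter
     is the cardinality. *)
  rewrite /= card_in_imset; first by rewrite (card_uniqP ul) size_map size_mkseq.
  move=> [a b] [a' b'] /=; rewrite !(mem_edge_list _ _ ok) => h h' /set2_eq[[-> ->] //|[E1 E2]].
  by have := e5 _ _ h; rewrite E1 E2 h'.
Qed.

Lemma graph_simple s : edges_ok n D Y s -> simple_graph (graph_of s).
Proof.
move=> ok e /imsetP[[a b]]; rewrite /= (mem_edge_list _ _ ok) => h ->.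
have [e1 _ _ _] := ok; have /and3P[_ _ ab] := e1 _ h.
by rewrite cards2 (_ : a != b).
Qed.

Lemma walk_ge s x p : path (adj (graph_of s)) x p ->
  dist_X X x (last x p) <= walk_weight (graph_of s) x p.
Proof.
rewrite /walk_weight; elim: p x => [|y p IH] x /=.
  by rewrite big_nil /dist_X subrr normr0.
move=> /andP[_ /IH h]; rewrite big_cons /=.
by apply: le_trans (dist_X_triangle X x y _) _; rewrite lerD2l.
Qed.

(** The walk through the common centre has two edges of length at most (t/2) d(x, y) each; it
    shrinks to one edge when the centre is x or y. No walk is shorter than the distance, by the
    triangle inequality. *)
Lemma graph_spanner s (t : R) : edges_ok n D Y s -> 1 <= t ->
  (forall x y, (x < n)%N -> (y < n)%N -> x != y -> linked n D Y s (t / 2 * dY D Y x y) x y) ->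
  is_spanner (dist_X X) t (graph_of s).
Proof.
move=> ok t1 lk; split=> //; first exact: graph_simple.
move=> x y; split.
  by apply/ereal_infP => _ [p [hp <-] <-]; rewrite lee_fin walk_ge.
have [<-|xy] := eqVneq x y.
  apply: (@le_trans _ _ (walk_weight (graph_of s) x [::])%:E).
    by apply: ereal_inf_lbound; exists [::].
  by rewrite /walk_weight big_nil lee_fin mulr_ge0 ?dist_X_ge0 //; lra.
have [c [cn [ex dx] [ey dy]]] := lk x y (ltn_ord x) (ltn_ord y) xy.
set C := to_ord c; have Cc : val C = c by apply: to_ordK.
rewrite -Cc -!dist_X_dY in dx dy.
have hx : C = x \/ adj (graph_of s) x C.
  case: ex => [E|e]; first by left; apply: val_inj; rewrite Cc.
  by right; rewrite adj_graph // elC Cc.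
have hy : C = y \/ adj (graph_of s) C y.
  case: ey => [E|e]; first by left; apply: val_inj; rewrite Cc.
  by right; rewrite adj_graph // Cc.
have bound p : path (adj (graph_of s)) x p -> last x p = y ->
    walk_weight (graph_of s) x p <= dist_X X x C + dist_X X C y ->
    (gdist (graph_of s) x y <= (t * dist_X X x y)%:E)%E.
  move=> hp hl hw; apply: (@le_trans _ _ (walk_weight (graph_of s) x p)%:E).
    by apply: ereal_inf_lbound; exists p.
  rewrite lee_fin; apply: le_trans hw _; rewrite (dist_XC X x C); lra.
case: hx => [Ex|ax].
  case: hy => [Ey|ay]; first by move: xy; rewrite -Ex -Ey eqxx.
  apply: (bound [:: y]); rewrite -?Ex /= ?ay //.
  by rewrite /walk_weight /= big_seq1 /= lerDr dist_X_ge0.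
case: hy => [Ey|ay].
  apply: (bound [:: y]); rewrite -?Ey /= ?ax //.
  by rewrite /walk_weight /= big_seq1 /= lerDl dist_X_ge0.
apply: (bound [:: C; y]); rewrite /= ?ax ?ay //.
by rewrite /walk_weight /= !big_cons big_nil /= addr0.
Qed.

End Graph.

(** * From the potential to the stated bounds *)

Section Bounds.
Variable R : realType.
Implicit Types (n d q k : nat) (rho : R).

(** The choice of q makes 1/q at most rho, so the exponent 1 + 1/q is at most 1 + rho. *)
Lemma phi_le n q rho : (0 < n)%N -> (0 < q)%N -> 1 <= q%:R * rho ->
  phi R q n <= n%:R `^ (1 + rho).
Proof.
move=> n0 q0 h; apply: ler_powR; rewrite ?ler1n // lerD2l.
by rewrite -[_^-1]mul1r ler_pdivrMr ?ltr0n // mulrC.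
Qed.

Lemma ln2_ge : 2^-1 <= ln 2 :> R.
Proof.
have := @ln1D_ge R 1 ltac:(lra); rewrite (_ : 1 + 1 = 2 :> R); last lra.
by apply: le_trans; lra.
Qed.

Lemma log_size n k : (0 < n)%N -> (2 ^ k <= 2 * n)%N -> k.+1%:R <= 4 * lnmax1 (n%:R : R).
Proof.
move=> n0 h; have nR : 0 < n%:R :> R by rewrite ltr0n.
have l1 := lnmax1_ge1 (n%:R : R); have l2 := lnmax1_ge (n%:R : R); have hl := ln2_ge.
have : ln (2 ^+ k : R) <= ln (2 * n%:R).
  by rewrite ler_ln ?posrE ?exprn_gt0 ?mulr_gt0 // -natrX -natrM ler_nat.
rewrite lnXn // lnM ?posrE // -(mulr_natl (ln _)) -(natr1 k) => hk.
have k0 := ler0n R k; move: (ln 2) hl hk => e he hk.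
have e0 : 0 < e by lra.
have : 0 <= lnmax1 n%:R * (2 * e - 1) by apply: mulr_ge0; lra.
rewrite mulrBr mulr1 => h3.
have : k%:R * e <= (1 + 2 * lnmax1 n%:R) * e by rewrite mulrDl mul1r; lra.
rewrite ler_pM2r // => h4; lra.
Qed.

(** The argument of the logarithm is at most 16 n diam/sep, and ln 16 <= 15. Dividing by ln 2 >= 1/2
    leaves 2 (15 + a + b) + 1, and (a - 1)(b - 1) >= 0 turns the sum a + b into the product: 31 + 2
    (1 + ab) <= 35 ab. *)
Lemma nscales_le n (sep M diam : R) : (1 < n)%N -> 0 < sep -> 0 < M -> M <= diam ->
  nscales n sep (M + M) <= 35 * (lnmax1 n%:R * lnmax1 (diam / sep)).
Proof.
move=> n1 s0 M0 Md; set a := lnmax1 n%:R; set b := lnmax1 _.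
have a1 : 1 <= a := lnmax1_ge1 _; have b1 : 1 <= b := lnmax1_ge1 _.
have al : ln n%:R <= a := lnmax1_ge _; have bl : ln (diam / sep) <= b := lnmax1_ge _.
have nR : 2 <= n%:R :> R by rewrite ler_nat.
have D0 : 0 < diam / sep by rewrite divr_gt0 //; lra.
have h16 : ln (16 : R) <= 15.
  by have := @le_ln1Dx R 15 ltac:(lra); rewrite (_ : 1 + 15 = 16 :> R) //; lra.
have h : ln ((4 * n + 4)%:R * (M + M) / sep) <= 15 + a + b.
  apply: le_trans (_ : ln (16 * n%:R * (diam / sep)) <= _).
    have p1 : 0 < 16 * n%:R * (diam / sep) by rewrite mulr_gt0 //; lra.
    have p2 : 0 < (4 * n + 4)%:R * (M + M) / sep.
      by rewrite divr_gt0 // mulr_gt0 ?addr_gt0 // ltr0n addn_gt0 orbT.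
    rewrite ler_ln ?posrE //.
    have e : (4 * n + 4)%:R <= 8 * n%:R :> R by rewrite natrD (natrM _ 4); lra.
    rewrite mulrA ler_pM2r ?invr_gt0 //.
    apply: le_trans (_ : 8 * n%:R * (M + M) <= _); first by apply: ler_wpM2r => //; lra.
    have : n%:R * M <= n%:R * diam by apply: ler_wpM2l.
    by move=> ?; lra.
  have n0R : 0 < n%:R :> R by lra.
  have p16 : 0 < 16 * n%:R :> R by rewrite mulr_gt0.
  move: D0 bl; move: (diam / sep) => Q Q0 bl.
  by rewrite (@lnM R _ Q) ?posrE // (@lnM R 16) ?posrE //; lra.
have i2 : (ln 2)^-1 <= 2 :> R.
  rewrite -[leRHS]invrK lef_pV2 ?posrE ?ln2_gt0 ?invr_gt0 //; exact: ln2_ge.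
rewrite /nscales.
have : ln ((4 * n + 4)%:R * (M + M) / sep) / ln 2 <= (15 + a + b) * 2.
  have i0 : 0 < (ln 2)^-1 :> R by rewrite invr_gt0 ln2_gt0.
  apply: le_trans (_ : (15 + a + b) / ln 2 <= _); first by apply: ler_wpM2r => //; apply: ltW.
  by apply: ler_wpM2l => //; lra.
have : a + b <= 1 + a * b by nra.
have : 1 <= a * b by nra.
lra.
Qed.

Lemma edges_bound (E F P I a b ns c : R) :
  0 <= F <= P -> 1 <= I -> 1 <= a -> 1 <= b -> ns <= 35 * (a * b) -> 70 <= c ->
  E <= 2 * F * ns -> E <= c * (P * I * a * b).
Proof.
move=> /andP[F0 FP] I1 a1 b1 hns c70 hE; apply: le_trans hE _.
have ab : 1 <= a * b by rewrite -[leLHS]mulr1 ler_pM.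
apply: le_trans (_ : 2 * F * (35 * (a * b)) <= _).
  by apply: ler_wpM2l => //; rewrite mulr_ge0.
have -> : 2 * F * (35 * (a * b)) = 70 * (F * 1 * (a * b)) by ring.
have -> : P * I * a * b = P * I * (a * b) by ring.
have x0 : 0 <= a * b by lra.
have h : F * 1 * (a * b) <= P * I * (a * b) by apply: ler_wpM2r => //; apply: ler_pM.
by apply: ler_pM => //; rewrite mulr1 mulr_ge0.
Qed.

Lemma time_bound n d q k (F P I a b ns c : R) :
  (0 < n)%N -> (0 < d)%N -> n%:R <= F -> F <= P -> 1 <= I -> 1 <= a -> 1 <= b -> 0 <= c ->
  q%:R <= 2 * I -> k.+1%:R <= 4 * a -> ns <= 35 * (a * b) ->
  20 * I + 200 * (n%:R * q.+1%:R) + 400 * (n%:R * d%:R) + 1700 * (n%:R * (d%:R + d%:R) * k.+1%:R) +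
    (6 * (d%:R + d%:R) * q%:R * (c * (d%:R + d%:R)) * F + 80) * ns + 200 <=
  (100 * 200 + 40 * 42 * c) * (P * I * d%:R ^+ 2 * a * b).
Proof.
move=> n0 d0 nF FP I1 a1 b1 c0 qI ka hns.
have n1 : 1 <= n%:R :> R by rewrite ler1n.
have d1 : 1 <= d%:R :> R by rewrite ler1n.
have q0 : 0 <= q%:R :> R by apply: ler0n.
rewrite -(natr1 q); move: n%:R d%:R q%:R k.+1%:R n1 d1 q0 nF qI ka {n0 d0} => N d' q' k' n1 d1 q0 nF qI ka.
have ab : 1 <= a * b by rewrite -[leLHS]mulr1 ler_pM.
set w := d' ^+ 2 * (a * b).
have d2 : d' <= d' ^+ 2 by rewrite expr2 ler_peMl //; lra.
have dw : d' <= w by rewrite -[leLHS]mulr1 ler_pM //; lra.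
have daw : d' * a <= w by rewrite /w ler_pM //; [lra|lra|rewrite ler_peMr //; lra].
have w1 : 1 <= w by lra.
have PI : 1 <= P * I by rewrite -[leLHS]mulr1 ler_pM //; lra.
have NP : N <= P by lra.
have IP : I <= P * I by rewrite ler_peMl //; lra.
set B := P * I * w.
have PB x : 0 <= x -> x <= w -> P * x <= B.
  by move=> x0 xw; rewrite /B ler_pM //; [lra | rewrite ler_peMr //; lra].
have PIB : P * I <= B by rewrite /B ler_peMr //; lra.
have -> : P * I * d' ^+ 2 * a * b = B by rewrite /B /w; ring.
have t1 : N * (q' + 1) <= 3 * B.
  apply: le_trans (_ : P * (3 * I) <= _); first by rewrite ler_pM //; lra.
  by rewrite mulrCA; lra.
have t2 : N * d' <= B.
  by apply: le_trans (PB d' _ dw); [rewrite ler_wpM2r //; lra | lra].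
have t3 : N * (d' + d') * k' <= 8 * B.
  apply: le_trans (_ : N * (d' + d') * (4 * a) <= _).
    by rewrite ler_wpM2l // mulr_ge0 //; lra.
  have -> : N * (d' + d') * (4 * a) = 8 * (N * (d' * a)) by ring.
  have da0 : 0 <= d' * a by rewrite mulr_ge0 //; lra.
  rewrite ler_pM2l //; apply: le_trans (PB _ da0 daw); exact: ler_wpM2r.
have t4 : (6 * (d' + d') * q' * (c * (d' + d')) * F + 80) * ns <= (40 * 42 * c + 40 * 70) * B.
  have F0 : 0 <= F by lra.
  have cd0 : 0 <= c * d' ^+ 2 by rewrite mulr_ge0 // exprn_ge0 //; lra.
  have -> : 6 * (d' + d') * q' * (c * (d' + d')) * F = 24 * (c * d' ^+ 2) * (F * q') by ring.
  have Fq : F * q' <= P * (2 * I) by rewrite ler_pM.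
  have h1 : 24 * (c * d' ^+ 2) * (F * q') + 80 <= 48 * (c * d' ^+ 2) * (P * I) + 80.
    rewrite lerD2r; apply: le_trans (_ : 24 * (c * d' ^+ 2) * (P * (2 * I)) <= _).
      by rewrite ler_wpM2l // mulr_ge0.
    by rewrite le_eqVlt; apply/orP; left; apply/eqP; ring.
  have X0 : 0 <= 24 * (c * d' ^+ 2) * (F * q') + 80 by rewrite addr_ge0 // mulr_ge0 // mulr_ge0.
  apply: le_trans (ler_wpM2l X0 hns) _.
  apply: le_trans (_ : (48 * (c * d' ^+ 2) * (P * I) + 80) * (35 * (a * b)) <= _).
    by apply: ler_wpM2r h1; lra.
  (* The 48 is 6 from the potential, 4 from D = 2d used twice, and 2 from q <= 2I. Then 48 * 35 = 40
     * 42 and 80 * 35 = 40 * 70. *)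
  have -> : (48 * (c * d' ^+ 2) * (P * I) + 80) * (35 * (a * b)) = 40 * 42 * c * B + 40 * 70 * (a * b).
    by rewrite /B /w; ring.
  have abB : a * b <= B.
    have abw : a * b <= w by rewrite /w ler_peMl //; lra.
    by apply: le_trans abw _; rewrite /B ler_peMl //; lra.
  by rewrite [leRHS]mulrDl lerD2l; lra.
have B1 : 1 <= B by lra.
have E1 : (40 * 42 * c + 40 * 70) * B = 40 * 42 * (c * B) + 40 * 70 * B by ring.
have E2 : (100 * 200 + 40 * 42 * c) * B = 100 * 200 * B + 40 * 42 * (c * B) by ring.
by rewrite E2; rewrite E1 in t4; lra.
Qed.

End Bounds.

Theorem theorem2p8 (R : realType) :
  exists (A : cmd) (C : R), 0 < C /\
    forall (n d : nat) (X : 'I_n -> 'rV[R]_d) (rho : R),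
      (1 < n)%N -> injective X -> 0 < rho -> rho < 1 ->
      exists (s : store R) (T : nat) (G : wgraph R 'I_n) (t : R),
        [/\ exec A (input_store X rho) s T /\ outputs_graph s G,
            is_spanner (dist_X X) t G,
            t <= C * (rho^-1 * lnmax1 (lnmax1 d%:R)),
            #|edges G|%:R <=
              C * (n%:R `^ (1 + rho) * rho^-1 * lnmax1 n%:R *
                   lnmax1 (aspect_ratio X)) &
            T%:R <=
              C * (n%:R `^ (1 + rho) * rho^-1 * d%:R ^+ 2 * lnmax1 n%:R *
                   lnmax1 (aspect_ratio X))].
Proof.
(* The constant of the running time; it also exceeds those of the stretch and of the sparsity. *)
exists spanner_cmd, (100 * 200 + 40 * 42 * node_cost%:R).
have nc0 : 0 <= node_cost%:R :> R by apply: ler0n.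
split; first by lra.
move=> n d X rho n1 inj rho0 rho1.
have n0 : (0 < n)%N := ltnW n1; have d0 := dim_gt0 n1 inj.
have sep0 := sep_X_gt0 n1 inj.
have sepP x y : (x < n)%N -> (y < n)%N -> x != y -> sep_X X <= dY (d + d) (Yn X) x y.
  move=> xn yn xy; have := @sep_X_le R n d X (Ordinal xn) (Ordinal yn) xy.
  by rewrite dist_X_dY.
have [s [T [ex [q [k [M [[q0 q1 q2 k2 [x0 x0n MU]] [M0 _] [ok mC] lk [hE hT]]]]]]]] :=
  spanner_cmd_ok n1 d0 rho0 sep0 sepP.
have Md : M <= diam_X X.
  apply: le_trans MU _; have := diam_X_ge X (Ordinal x0n) (Ordinal n0).
  by rewrite dist_X_dY.
have ns := nscales_le n1 sep0 M0 Md; rewrite -/(aspect_ratio X) in ns.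
have ph := phi_le n0 q0 q1.
have pn : n%:R <= phi R q n by apply: phi_ge.
have hk := @log_size R n k n0 k2.
have kl := kmax_le R q0 d0.
have k1 : 1 <= kmax R q (d + d) by apply: kmax_ge => //; rewrite addn_gt0 d0.
set I := rho^-1; have I1 : 1 <= I by rewrite /I -invr1 lef_pV2 ?posrE // ltW.
rewrite -/I in q2 hT.
have qI : q%:R <= 2 * I by lra.
(* Two edges per walk, a factor 2 from halving the radius, and the relative diameter 2 kmax + 2 of a
   box neighbourhood. *)
set t := 2 * (2 * (2 * (kmax R q (d + d)) + 2)).
exists s, T, (graph_of X n0 s), t.
split.
- by split=> //; apply: graph_output.
- apply: graph_spanner => //; first by rewrite /t; lra.
  move=> x y xn yn xy; have := lk x y xn yn xy; congr (linked _ _ _ _ (_ * _) _ _).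
  by rewrite /t; field.
- set l := lnmax1 (lnmax1 _) in kl *; have l1 : 1 <= l := lnmax1_ge1 _.
  have : q%:R * l <= 2 * I * l by apply: ler_wpM2r => //; lra.
  have : 1 <= I * l by nra.
  have : 0 <= node_cost%:R * (I * l) by apply: mulr_ge0 => //; nra.
  rewrite /t; lra.
- have -> : #|edges (graph_of X n0 s)|%:R = (narr s vC 0)%:R :> R.
    by have [es [_ _ _ _ <-]] := graph_output n0 ok mC; rewrite mC.
  apply: edges_bound ns _ hE; rewrite ?phi_ge0 ?lnmax1_ge1 //; lra.
- apply: le_trans hT _; rewrite !natrM !natrD -/I.
  by apply: time_bound; rewrite ?lnmax1_ge1.
Qed.
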